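(* Let $L>0$ and let $a>0$ and $u_s>0$ be given. Consider the saturated Korteweg-de Vries equation $$\begin{cases} y_t+y_x+y_{xxx}+yy_x+\mathrm{sat}(ay)=0, & (t,x)\in[0,+\infty)\times[0,L],\\ y(t,0)=y(t,L)=0,\quad y_x(t,L)=0, & t\ge 0,\\ y(0,x)=y_0(x), & x\in[0,L].\end{cases}\qquad(\ast)$$ Then: (i) There exists a class $\mathcal K$ function $\alpha:\mathbb R_{\ge0}\to\mathbb R_{\ge0}$ such that, for every $y_0\in L^2(0,L)$, the mild solution $y$ to $(\ast)$ satisfies $$\|y(t,\cdot)\|_{L^2(0,L)}\le \alpha\big(\|y_0\|_{L^2(0,L)}\big)e^{-at},\qquad \forall t\ge 0.$$ (ii) Given any $r>0$, for any $y_0\in L^2(0,L)$ such that $\|y_0\|_{L^2(0,L)}\le r$, any mild solution $y$ to $(\ast)$ satisfies $$\|y(t,\cdot)\|_{L^2(0,L)}\le \|y_0\|_{L^2(0,L)}\,e^{-\mu t},\qquad \forall t\ge 0,$$ where $\mu:=\min\left\{a,\frac{u_s}{r}\right\}$.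
   Context: All functions are real-valued. A function $\alpha:\mathbb R_{\ge0}\to\mathbb R_{\ge0}$ is of class $\mathcal K$ if it is nonnegative, increasing and $\alpha(0)=0$. The saturation map $\mathrm{sat}:L^2(0,L)\to L^2(0,L)$ with level $u_s>0$ is defined by $\mathrm{sat}(s)=s$ if $\|s\|_{L^2(0,L)}\le u_s$, and $\mathrm{sat}(s)=\frac{u_s}{\|s\|_{L^2(0,L)}}\,s$ if $\|s\|_{L^2(0,L)}\ge u_s$. For a function $y$ of $(t,x)$, $\mathrm{sat}(ay)$ at time $t$ means $\mathrm{sat}(a\,y(t,\cdot))$. Let $A$ be the operator on $L^2(0,L)$ with domain $D(A)=\{w\in H^3(0,L): w(0)=w(L)=w'(L)=0\}$ and $Aw=-w'-w'''$; it generates a strongly continuous semigroup of contractions on $L^2(0,L)$, denoted $W(t)$. A mild solution of $(\ast)$ is a function $y$ belonging to $C([0,T];L^2(0,L))\cap L^2(0,T;H^1(0,L))$ for every $T>0$ such that, for all $t\ge0$, $$y(t)=W(t)y_0-\int_0^t W(t-\tau)(yy_x)(\tau)\,d\tau-\int_0^t W(t-\tau)\,\mathrm{sat}(ay(\tau,\cdot))\,d\tau.$$ For every $y_0\in L^2(0,L)$ such a mild solution exists and is unique. *)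

(* Defs.v *)
From HB Require Import structures.
From mathcomp Require Import all_boot all_order all_algebra.
From mathcomp Require Import all_classical all_reals all_analysis.
From mathcomp Require Import measurable_realfun ess_sup_inf.
Import Order.TTheory GRing.Theory Num.Theory.
Import numFieldNormedType.Exports.

Set Implicit Arguments.
Unset Strict Implicit.
Unset Printing Implicit Defensive.

Local Open Scope classical_set_scope.
Local Open Scope ring_scope.

(* The library's quotient L^p space as a normed module; the operations and the
   norm are computed on representatives. *)
Section lspace.
Context d (T : measurableType d) (R : realType).
Variables (mu : {measure set T -> \bar R}) (p : \bar R) (p1 : (1 <= p)%E).
Implicit Types (f g : LfunType mu p1) (u v w : LspaceType mu p1).
Local Open Scope quotient_scope.

Lemma ae_eq_Lnorm (f g : T -> R) : measurable_fun setT f ->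
  measurable_fun setT g -> f = g %[ae mu] ->
  'N[mu]_p[EFin \o f]%E = 'N[mu]_p[EFin \o g]%E.
Proof.
move=> mf mg fg; rewrite unlock; case: p p1 => [r _|_|//] /=.
- congr (_ `^ _)%E; apply: ae_eq_integral => //=.
  + apply/measurable_EFinP.
    apply: (@measurableT_comp _ _ _ _ _ _ (@powR R ^~ r)) => //.
    exact: measurableT_comp.
  + apply/measurable_EFinP.
    apply: (@measurableT_comp _ _ _ _ _ _ (@powR R ^~ r)) => //.
    exact: measurableT_comp.
  + by apply: filterS fg => x /= fgx Dx; rewrite fgx.
- case: ifPn => // _; apply: eq_ess_sup.
  by apply: filterS fg => x /= fgx; rewrite fgx.
Qed.

Lemma Lspace_Lfun u : (u : T -> R) \in Lfun mu p.
Proof.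
apply/andP; split; rewrite inE/=.
- exact: measurable_funPT (repr (u : {mfun_ mu, T >-> measurableTypeR R})).
- exact: Lebesgue_finite.
Qed.

Definition Lrep u : LfunType mu p1 := Lfun_Sub p1 (Lspace_Lfun u).

Definition Lmfun f : {mfun T >-> measurableTypeR R} :=
  HB.pack_for {mfun T >-> measurableTypeR R} (f : T -> measurableTypeR R)
    (@isMeasurableFun.Build _ _ T (measurableTypeR R) f (measurable_funPT f)).

Definition Lpi f : {mfun_ mu, T >-> measurableTypeR R} :=
  \pi_({mfun_ mu, T >-> measurableTypeR R}) (Lmfun f).

Lemma Lmfun_repr f : repr (Lpi f) = f %[ae mu].
Proof.
have : ae_eq_op mu (repr (Lpi f)) (Lmfun f).
  by rewrite -eqmodE reprK.
by move/asboolP.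
Qed.

Lemma Lcls_finite f : finite_norm mu p (Lpi f).
Proof.
rewrite /finite_norm (@ae_eq_Lnorm _ f).
- exact: Lfunction_finite.
- exact: measurable_funPT (repr (Lpi f)).
- exact: measurable_funPT f.
- exact: Lmfun_repr.
Qed.

Definition Lcls f : LspaceType mu p1 :=
  LebesgueSpace.Pack (LebesgueSpace.Class
    (isFinLebesgue.Build d T R mu p p1 _ (Lcls_finite f))).

Lemma LclsK f : Lrep (Lcls f) = f %[ae mu].
Proof. exact: Lmfun_repr. Qed.

Lemma Lspace_inj u v : u = v :> {mfun_ mu, T >-> measurableTypeR R} -> u = v.
Proof.
case: u v => [u [[Pu]]] [v [[Pv]]] /= uv.
by case: _ / uv Pv => Pv; rewrite (Prop_irrelevance Pu Pv).
Qed.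

Lemma eq_Lcls f g : f = g %[ae mu] -> Lcls f = Lcls g.
Proof.
by move=> fg; apply/Lspace_inj/eqP; rewrite /= eqmodE; apply/asboolP.
Qed.

Lemma LrepK : cancel Lrep Lcls.
Proof.
move=> u; apply: Lspace_inj; rewrite /= -[RHS]reprK.
apply/eqP; rewrite eqmodE; apply/asboolP; exact: ae_eq_refl.
Qed.

Lemma Lspace_ext u v : u = v <-> Lrep u = Lrep v %[ae mu].
Proof.
split=> [->|uv]; first exact: ae_eq_refl.
by rewrite -[u]LrepK -[v]LrepK; exact: eq_Lcls.
Qed.

HB.instance Definition _ := gen_eqMixin (LspaceType mu p1).
HB.instance Definition _ := gen_choiceMixin (LspaceType mu p1).

Definition Lspace_zero := Lcls 0.
Definition Lspace_opp u := Lcls (- Lrep u).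
Definition Lspace_add u v := Lcls (Lrep u + Lrep v).
Definition Lspace_scale (k : R) u := Lcls (k *: Lrep u).
Definition Lspace_norm u : R := fine 'N[mu]_p[EFin \o Lrep u]%E.

Lemma LclsN f : Lspace_opp (Lcls f) = Lcls (- f).
Proof.
by apply: eq_Lcls; apply: filterS (LclsK f) => x /= fx Dx; rewrite !fctE fx.
Qed.

Lemma LclsD f g : Lspace_add (Lcls f) (Lcls g) = Lcls (f + g).
Proof.
by apply: eq_Lcls; apply: filterS2 (LclsK f) (LclsK g) => x /= fx gx Dx;
  rewrite !fctE fx ?gx.
Qed.

Lemma LclsZ k f : Lspace_scale k (Lcls f) = Lcls (k *: f).
Proof.
by apply: eq_Lcls; apply: filterS (LclsK f) => x /= fx Dx; rewrite !fctE fx.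
Qed.

Lemma Lcls_norm f : Lspace_norm (Lcls f) = fine 'N[mu]_p[EFin \o f]%E.
Proof.
congr fine; apply: ae_eq_Lnorm; [exact: measurable_funPT|exact: measurable_funPT|].
exact: LclsK.
Qed.

Lemma Lspace_addA : associative Lspace_add.
Proof.
move=> u v w; rewrite -[u]LrepK -[v]LrepK -[w]LrepK.
by rewrite !LclsD addrA.
Qed.

Lemma Lspace_addC : commutative Lspace_add.
Proof. by move=> u v; rewrite /Lspace_add addrC. Qed.

Lemma Lspace_add0 : left_id Lspace_zero Lspace_add.
Proof. by move=> u; rewrite -[u]LrepK LclsD add0r. Qed.

Lemma Lspace_addN : left_inverse Lspace_zero Lspace_opp Lspace_add.
Proof. by move=> u; rewrite -[u]LrepK LclsN LclsD addNr. Qed.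

HB.instance Definition _ := GRing.isZmodule.Build (LspaceType mu p1)
  Lspace_addA Lspace_addC Lspace_add0 Lspace_addN.

Lemma Lspace_scaleA a b u :
  Lspace_scale a (Lspace_scale b u) = Lspace_scale (a * b) u.
Proof. by rewrite -[u]LrepK !LclsZ scalerA. Qed.

Lemma Lspace_scale1 : left_id 1 Lspace_scale.
Proof. by move=> u; rewrite -[u]LrepK LclsZ scale1r. Qed.

Lemma Lspace_scaleDr : right_distributive Lspace_scale +%R.
Proof.
by move=> a u v; rewrite -[u]LrepK -[v]LrepK [_ + _]LclsD !LclsZ scalerDr -LclsD.
Qed.

Lemma Lspace_scaleDl v : {morph Lspace_scale^~ v : a b / a + b}.
Proof. by move=> a b; rewrite -[v]LrepK !LclsZ scalerDl -LclsD. Qed.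

HB.instance Definition _ := GRing.Zmodule_isLmodule.Build R (LspaceType mu p1)
  Lspace_scaleA Lspace_scale1 Lspace_scaleDr Lspace_scaleDl.

Lemma Lspace_normD u v :
  Lspace_norm (u + v) <= Lspace_norm u + Lspace_norm v.
Proof.
rewrite -[u]LrepK -[v]LrepK [_ + _]LclsD !Lcls_norm; exact: ler_LnormD.
Qed.

Lemma Lspace_normZ (k : R) u : Lspace_norm (k *: u) = `|k| * Lspace_norm u.
Proof.
rewrite -[u]LrepK [_ *: _]LclsZ !Lcls_norm.
by apply: EFin_inj; rewrite EFinM !finite_norm_fine -LnormZ.
Qed.

Lemma Lspace_norm_eq0 u : Lspace_norm u = 0 -> u = 0.
Proof.
rewrite -[u]LrepK Lcls_norm => /fine_Lnormr_eq0 h; exact: eq_Lcls.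
Qed.

HB.instance Definition _ := Lmodule_isNormed.Build R (LspaceType mu p1)
  Lspace_normD Lspace_normZ Lspace_norm_eq0.

End lspace.
Section functional.
Context (R : realType) (V : normedModType R).
Implicit Types (f s : R -> V) (D : set R) (u v : V).
Local Notation leb := (@lebesgue_measure R).

Definition simple s :=
  finite_set (range s) /\ forall v, measurable (s @^-1` [set v]).

Definition simple_integral D s : V :=
  \sum_(v \in range s) fine (leb (D `&` s @^-1` [set v])) *: v.

(* Strong measurability on [D] of a map valued in the subspace [H] of [V] normed
   by [N]: it is the a.e. limit, for [N], of simple maps with values in [H]. *)
Definition strongly_measurable_in (H : set V) (N : V -> R) D f :=
  exists s_ : nat -> R -> V,
    (forall n, simple (s_ n) /\ forall t, H (s_ n t)) /\
    {ae leb, forall t, D t -> N (f t - s_ n t) @[n --> \oo] --> (0 : R)}.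

Definition strongly_measurable D f :=
  strongly_measurable_in [set: V] (fun v => `|v|) D f.

(* [D] is meant to have finite measure. *)
Definition is_bochner_integral D f v :=
  strongly_measurable D f /\
  exists s_ : nat -> R -> V, [/\ forall n, simple (s_ n),
    (\int[leb]_(t in D) `|f t - s_ n t|%:E)%E @[n --> \oo] --> 0%E &
    simple_integral D (s_ n) @[n --> \oo] --> v].

(* [W t] is only meaningful for [0 <= t]. *)
Definition c0_contraction_semigroup (W : R -> {linear V -> V}) :=
  [/\ forall u, W 0 u = u,
      forall t1 t2 u, 0 <= t1 -> 0 <= t2 -> W (t1 + t2) u = W t1 (W t2 u),
      forall u, W t u @[t --> 0^'+] --> u &
      forall t u, 0 <= t -> `|W t u| <= `|u| ].

Definition generates (A : V -> V) (domA : set V) (W : R -> {linear V -> V}) :=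
  forall u v, t^-1 *: (W t u - u) @[t --> 0^'+] --> v <-> domA u /\ A u = v.

Definition sat (us : R) v : V := if `|v| <= us then v else (us / `|v|) *: v.

End functional.

Section kdv.
Context (R : realType) (L : R).
Local Notation leb := (@lebesgue_measure R).

Definition leb0L : {measure set (measurableTypeR R) -> \bar R} :=
  mrestr leb (measurable_itv `]0, L[).

Definition L2 : normedModType R := LspaceType2 leb0L.

Implicit Types u v : L2.

(* The class of [f], or 0 when [f] is not square integrable on ]0, L[. *)
Definition L2class (f : R -> R) : L2 :=
  if pselect (f \in Lfun leb0L 2%:E) is left fL2
  then Lcls (Lfun_Sub (lee1n 2) fL2) else 0.

Definition L2mul u v : L2 := L2class (fun x => Lrep u x * Lrep v x).

Definition test_function (phi : R -> R) :=
  (forall n x, derivable (phi^`(n))%classic x 1) /\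
  exists a b, [/\ 0 < a, b < L & forall x, phi x != 0 -> a <= x <= b].

Definition weak_derivative u v := forall phi, test_function phi ->
  \int[leb0L]_x (Lrep u x * (phi^`())%classic x) = - \int[leb0L]_x (Lrep v x * phi x).

(* Junk value 0 when there is no weak derivative in L^2. *)
Definition wderiv u : L2 := xget 0 [set v | weak_derivative u v].

(* H^k(0, L) *)
Definition sobolev (k : nat) : set L2 :=
  [set u | forall i, (i < k)%N ->
     exists v, weak_derivative (iter i wderiv u) v].

Definition H1norm u : R := Num.sqrt (`|u| ^+ 2 + `|wderiv u| ^+ 2).

(* The continuous representative of [u] on [0, L] takes the value [c] at [x]. *)
Definition has_value u (x c : R) := exists g : R -> R,
  [/\ {within `[0, L], continuous g}, Lrep u = g %[ae leb0L] & g x = c].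

Definition kdv_dom : set L2 := [set w |
  [/\ sobolev 3 w, has_value w 0 0, has_value w L 0 & has_value (wderiv w) L 0]].

Definition kdv_op (w : L2) : L2 := - wderiv w - iter 3 wderiv w.

(* L^2(0, T; H^1(0, L)) *)
Definition L2H1 (T : R) (y : R -> L2) :=
  [/\ {ae leb, forall t, t \in `]0, T[ -> sobolev 1 (y t)},
      strongly_measurable_in (sobolev 1) H1norm `]0, T[ y &
      (\int[leb]_(t in `]0%R, T[) (H1norm (y t) ^+ 2)%:E < +oo)%E].

Definition mild_solution (a us : R) (W : R -> {linear L2 -> L2}) (y0 : L2)
    (y : R -> L2) :=
  (forall T, 0 < T -> {within `[0, T], continuous y} /\ L2H1 T y) /\
  forall t, 0 <= t -> exists I1 I2 : L2,
    [/\ is_bochner_integral `[0, t]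
          (fun tau => W (t - tau) (L2mul (y tau) (wderiv (y tau)))) I1,
        is_bochner_integral `[0, t]
          (fun tau => W (t - tau) (sat us (a *: y tau))) I2 &
        y t = W t y0 - I1 - I2].

End kdv.

(* Only the values on [0, +oo[ matter. *)
Definition classK (R : realType) (alpha : R -> R) :=
  [/\ forall r, 0 <= r -> 0 <= alpha r,
      forall r1 r2, 0 <= r1 -> r1 < r2 -> alpha r1 < alpha r2 &
      alpha 0 = 0].

(* Main.v *)
(* Write E(t) = |y(t)|^2. Formally E' = - y_x(t,0)^2 - 2 <sat(a y), y>, and
   <sat(a y), y> = |y| min(a |y|, u_s) since the saturation only rescales. As long
   as |y| <= r this is at least mu |y|^2, whence (ii). For (i), the norm falls below
   u_s / a by the time T = a rho^2 / u_s^2, rho = |y_0|: until then it decays at least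
   like exp(- u_s t / rho), and rho exp(- a rho / u_s) <= u_s / a. From T on it decays
   at rate a, so alpha(rho) = rho exp(a T) works.

   For mild solutions the energy inequality comes from the contraction property:
   with J = y(t) - W(t - s) y(s), |y(t)|^2 - |y(s)|^2 <= 2 <y(t), J>, and
   summing over finer and finer subdivisions yields
   E(t) - E(s) <= - 2 \int_s^t <y, y y_x + sat(a y)>.
   As <u, u u_x> = (u(L)^3 - u(0)^3) / 3, it remains to see that y(t, 0) = y(t, L) = 0
   for almost every t, which mild solutions are not assumed to satisfy. This follows
   from the weak form of the equation, tested against polynomials tending to 0 in C^1
   while their second derivatives concentrate at an end of [0, L]. *)
Require Import Defs.
From mathcomp Require Import all_boot all_order all_algebra.
From mathcomp Require Import all_classical all_reals all_analysis.
From mathcomp Require Import measurable_realfun.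
From mathcomp Require Import finmap ring lra.
From HB Require Import structures.
Import Order.TTheory GRing.Theory Num.Theory.
Import numFieldNormedType.Exports.

Set Implicit Arguments.
Unset Strict Implicit.
Unset Printing Implicit Defensive.

Local Open Scope classical_set_scope.
Local Open Scope ring_scope.


(** * Integrals of almost everywhere defined functions *)

(** The energy cannot be differentiated: a mild solution comes with no time derivative in L^2, and
    y_x(t, 0) has no meaning for it. The contraction property stands in for the favourable sign of
    the boundary dissipation, at the price of having inequalities over ]s, t] only. Vector-valued
    integrals are only used after pairing with a fixed vector, so all time integrals are scalar.
    Going from subdivisions to integrals is dominated convergence; the majorant is a constant plus a
    multiple of [H1norm (y x) ^+ 2], integrable because y is in L^2(0, T; H^1) and y y_x is
    quadratic. In space, integration by parts is stated as an identity continuous in the derivative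
    for the L^2 norm, and checked on test functions, which are dense. For the traces, membership in
    H^1 carries no boundary values. Duality moves the operator A onto polynomials p subject to the
    boundary conditions of the adjoint, p(0) = p(L) = p'(0) = 0. These leave p''(0) and p''(L) free,
    and these two numbers are the coefficients of y(t, 0) and y(t, L) in the weak equation. *)

Section has_int.
Context d (T : measurableType d) (R : realType) (mu : {measure set T -> \bar R}).
Implicit Types (D E : set T) (f g m : T -> R) (c : R).

Lemma aeS (P Q : T -> Prop) : (forall x, P x -> Q x) ->
  {ae mu, forall x, P x} -> {ae mu, forall x, Q x}.
Proof. exact: filterS. Qed.

Lemma aeS2 (P Q S : T -> Prop) : (forall x, P x -> Q x -> S x) ->
  {ae mu, forall x, P x} -> {ae mu, forall x, Q x} -> {ae mu, forall x, S x}.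
Proof. exact: filterS2. Qed.

Lemma aeS3 (P Q S U : T -> Prop) : (forall x, P x -> Q x -> S x -> U x) ->
  {ae mu, forall x, P x} -> {ae mu, forall x, Q x} ->
  {ae mu, forall x, S x} -> {ae mu, forall x, U x}.
Proof. exact: filterS3. Qed.

(* [f] itself need not be measurable: a Bochner integrand is controlled only up
   to a negligible set. *)
Definition has_int D f c := exists g,
  [/\ mu.-integrable D (EFin \o g), {ae mu, forall x, D x -> f x = g x} &
      (\int[mu]_(x in D) (g x)%:E)%E = c%:E].

Lemma has_int_integrable D f : measurable D ->
  mu.-integrable D (EFin \o f) -> has_int D f (\int[mu]_(x in D) f x).
Proof.
move=> mD fi; exists f; split => //; first exact: aeW.
by rewrite fineK//; exact: integrable_fin_num.
Qed.

Lemma has_int_ae D f g c : {ae mu, forall x, D x -> f x = g x} ->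
  has_int D f c -> has_int D g c.
Proof.
move=> fg [h [hi fh hc]]; exists h; split => //.
by apply: filterS2 fg fh => x fg fh Dx; rewrite -fg// fh.
Qed.

Lemma has_int_eq D f g c : (forall x, D x -> f x = g x) ->
  has_int D f c -> has_int D g c.
Proof. by move=> fg; apply: has_int_ae; apply: aeW => x Dx; exact: fg. Qed.

Lemma has_int0 D : has_int D (fun=> 0) 0.
Proof.
exists (fun=> 0); split; [exact: integrable0|exact: aeW|].
by rewrite integral0.
Qed.

Lemma has_intD D f g c1 c2 : has_int D f c1 -> has_int D g c2 -> measurable D ->
  has_int D (fun x => f x + g x) (c1 + c2).
Proof.
move=> [f' [fi ff fc]] [g' [gi gg gc]] mD; exists (fun x => f' x + g' x); split.
- by have := integrableD mD fi gi; apply: eq_integrable.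
- by apply: filterS2 ff gg => x ff gg Dx; rewrite ff ?gg.
- by rewrite EFinD -fc -gc -integralD_EFin.
Qed.

Lemma has_intZ D k f c : has_int D f c -> measurable D ->
  has_int D (fun x => k * f x) (k * c).
Proof.
move=> [f' [fi ff fc]] mD; exists (fun x => k * f' x); split.
- by have := integrableZl mD k fi; apply: eq_integrable.
- by apply: filterS ff => x ff Dx; rewrite ff.
- by rewrite EFinM -fc -integralZl.
Qed.

Lemma has_intB D f g c1 c2 : has_int D f c1 -> has_int D g c2 -> measurable D ->
  has_int D (fun x => f x - g x) (c1 - c2).
Proof.
move=> fc gc mD; have := has_intD fc (has_intZ (-1) gc mD) mD.
rewrite mulN1r; apply: has_int_eq => x _.
by rewrite mulN1r.
Qed.

Lemma has_int_le D f g c1 c2 : has_int D f c1 -> has_int D g c2 -> measurable D ->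
  {ae mu, forall x, D x -> f x <= g x} -> c1 <= c2.
Proof.
move=> [f' [fi ff fc]] [g' [gi gg gc]] mD fg.
have h0 : (0%:E <= (c2 - c1)%:E)%E.
  rewrite EFinB -fc -gc -integralB_EFin//.
  (* The inequality holds almost everywhere only; the maximum makes the integrand nonnegative
     everywhere without changing its integral. *)
  have -> : (\int[mu]_(x in D) ((g' x)%:E - (f' x)%:E) =
     \int[mu]_(x in D) (Num.max 0 (g' x - f' x))%:E)%E.
    apply: ae_eq_integral => //.
    - by have /integrableB/(_ fi) := gi => /(_ mD)/measurable_int.
    - apply/measurable_EFinP/measurable_maxr => //.
      by apply: measurable_funB; apply/measurable_EFinP;
        [exact: measurable_int gi|exact: measurable_int fi].
    - apply: filterS3 ff gg fg => x ff gg fg Dx.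
      rewrite /= -EFinB; congr EFin; apply/esym/max_idPr.
      by rewrite subr_ge0 -ff// -gg// fg.
  by apply: integral_ge0 => x _; rewrite lee_fin le_max lexx.
by rewrite -subr_ge0 -lee_fin.
Qed.

Lemma has_int_uniq D f c1 c2 :
  has_int D f c1 -> has_int D f c2 -> measurable D -> c1 = c2.
Proof.
by move=> h1 h2 mD; apply/le_anti/andP; split;
  [exact: (has_int_le h1 h2 mD (aeW _ _))|exact: (has_int_le h2 h1 mD (aeW _ _))].
Qed.

Lemma has_int_norm_le D f m c M : has_int D f c -> has_int D m M -> measurable D ->
  {ae mu, forall x, D x -> `|f x| <= m x} -> `|c| <= M.
Proof.
move=> fc mM mD fm; rewrite ler_norml; apply/andP; split; last first.
  apply: (has_int_le fc mM mD); apply: filterS fm => x fm Dx.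
  by rewrite (le_trans (ler_norm _))// fm.
rewrite -mulN1r; apply: (has_int_le (has_intZ (-1) mM mD) fc mD).
apply: filterS fm => x fm Dx; rewrite mulN1r.
by have := fm Dx; rewrite ler_norml => /andP[].
Qed.

Lemma has_int_sub D E f c : has_int D f c -> measurable D -> measurable E ->
  E `<=` D -> exists c', has_int E f c'.
Proof.
move=> [g [gi fg gc]] mD mE ED; exists (\int[mu]_(x in E) g x).
apply: (@has_int_ae _ g).
  by apply: filterS fg => x fg /ED Dx; rewrite fg.
by apply: has_int_integrable => //; exact: integrableS gi.
Qed.

Lemma has_intU D E f c1 c2 : has_int D f c1 -> has_int E f c2 ->
  measurable D -> measurable E -> [disjoint D & E] ->
  has_int (D `|` E) f (c1 + c2).
Proof.
move=> [f' [fi ff fc]] [g' [gi gg gc]] mD mE DE.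
have nDE x : E x -> x \notin D.
  move=> Ex; apply/negP; rewrite in_setE => Dx.
  by move: DE => /disj_setPS => /(_ x); apply.
exists (fun x => if x \in D then f' x else g' x).
have eD : {in D, forall x, (f' x)%:E = (if x \in D then f' x else g' x)%:E}.
  by move=> x xD; rewrite xD.
have eE : {in E, forall x, (g' x)%:E = (if x \in D then f' x else g' x)%:E}.
  by move=> x; rewrite in_setE => xE; rewrite (negbTE (nDE _ xE)).
have iD : mu.-integrable D (fun x => (if x \in D then f' x else g' x)%:E).
  exact: eq_integrable fi.
have iE : mu.-integrable E (fun x => (if x \in D then f' x else g' x)%:E).
  exact: eq_integrable gi.
have mh : measurable_fun (D `|` E)
    (fun x => (if x \in D then f' x else g' x)%:E).
  apply/measurable_funU => //; split; [exact: measurable_int iD|exact: measurable_int iE].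
split.
- apply/integrableP; split => //.
  rewrite ge0_integral_setU//; last exact: measurableT_comp.
  apply: lte_add_pinfty; first by case/integrableP : iD.
  by case/integrableP : iE.
- apply: filterS2 ff gg => x ff gg [Dx|Ex]; first by rewrite mem_set// ff.
  by rewrite (negbTE (nDE _ Ex)) gg.
- rewrite integral_setU//= EFinD -fc -gc; congr (_ + _)%E.
    by apply: eq_integral => x /eD.
  by apply: eq_integral => x /eE.
Qed.

Lemma has_intUB D E f c c1 : has_int (D `|` E) f c -> has_int D f c1 ->
  measurable D -> measurable E -> [disjoint D & E] -> has_int E f (c - c1).
Proof.
move=> hc h1 mD mE DE.
have mDE : measurable (D `|` E) by exact: measurableU.
have [c2 h2] : exists c2, has_int E f c2.
  by apply: (has_int_sub hc mDE mE) => x; right.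
by rewrite (has_int_uniq hc (has_intU h1 h2 mD mE DE) mDE) addrAC subrr add0r.
Qed.

(** The limsup is measurable whether or not the sequence converges, and it equals [f] wherever it
    does. *)
Lemma ae_lim_measurable D (f_ : nat -> T -> R) f :
  (forall n, measurable_fun D (f_ n)) ->
  {ae mu, forall x, D x -> f_ n x @[n --> \oo] --> f x} ->
  exists2 g, measurable_fun D g & {ae mu, forall x, D x -> f x = g x}.
Proof.
move=> mf ff; exists (fun x => fine (limn_esup (fun n => (f_ n x)%:E))).
  apply/measurableT_comp; first exact: fine_measurable.
  by apply: measurable_fun_limn_esup => n; apply/measurable_EFinP.
apply: filterS ff => x ff Dx.
have h1 : (EFin \o f_^~ x) @ \oo --> (f x)%:E.
  by apply: cvg_EFin; [exact: nearW|exact: ff].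
rewrite is_cvg_limn_esupE; last by apply/cvg_ex; eexists; exact: h1.
by rewrite (cvg_lim _ h1).
Qed.

Lemma has_int_dom D (f_ : nat -> T -> R) f m (c_ : nat -> R) M :
  (forall n, has_int D (f_ n) (c_ n)) -> has_int D m M -> measurable D ->
  {ae mu, forall x, D x -> f_ n x @[n --> \oo] --> f x} ->
  (forall n, {ae mu, forall x, D x -> `|f_ n x| <= m x}) ->
  exists2 c, has_int D f c & c_ n @[n --> \oo] --> c.
Proof.
move=> /choice[g_ fg] [m' [mi mm mM]] mD ff fm.
have gig n : mu.-integrable D (EFin \o g_ n) by case: (fg n).
have mg n : measurable_fun D (g_ n).
  by apply/measurable_EFinP; exact: measurable_int (gig n).
have aefg : {ae mu, forall x n, D x -> f_ n x = g_ n x}.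
  by apply: ae_foralln => n; case: (fg n).
have aefm : {ae mu, forall x n, D x -> `|f_ n x| <= m x}.
  exact: ae_foralln.
have [h mh fh] : exists2 h, measurable_fun D h &
    {ae mu, forall x, D x -> f x = h x}.
  apply: (ae_lim_measurable mg); apply: filterS2 ff aefg => x ff fgx Dx.
  apply: cvg_trans (ff Dx); apply: near_eq_cvg; apply: nearW => n /=.
  by rewrite fgx.
have gh : {ae mu, forall x, D x -> (EFin \o g_^~ x) @ \oo --> (EFin \o h) x}.
  apply: filterS3 ff aefg fh => x ff fgx fhx Dx; rewrite /= -fhx//.
  apply: cvg_EFin; first exact: nearW.
  apply: cvg_trans (ff Dx); apply: near_eq_cvg; apply: nearW => n /=.
  by rewrite fgx.
have gm : {ae mu, forall x n, D x -> (`|(EFin \o g_ n) x| <= (EFin \o m') x)%E}.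
  apply: filterS3 aefm aefg mm => x fmx fgx mmx n Dx.
  by rewrite /= lee_fin -fgx// -mmx// fmx.
have [hi _ hc] := @dominated_convergence _ _ _ mu D mD
  (fun n => EFin \o g_ n) (EFin \o h) (EFin \o m')
  (fun n => measurable_int mu (gig n)) (proj2 (measurable_EFinP _ _) mh) gh mi gm.
exists (\int[mu]_(x in D) h x).
    by exists h; split => //; rewrite fineK//; exact: integrable_fin_num.
  have : (fun n => (c_ n)%:E) @ \oo --> (\int[mu]_(x in D) h x)%R%:E.
    rewrite fineK; last exact: integrable_fin_num.
    apply: cvg_trans hc; apply: near_eq_cvg; apply: nearW => n /=.
    by case: (fg n).
  by move=> /fine_cvg.
Qed.

Import HBNNSimple.

(** The integral of a nonnegative function is a supremum over the simple functions below it, so it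
    is monotone even when [h] is not measurable. The integrals in [is_bochner_integral] and [L2H1]
    are handled this way. *)
Lemma ge0_le_lower_integral D (g h : T -> \bar R) : measurable D ->
  measurable_fun D g -> (forall x, D x -> 0 <= g x)%E ->
  (forall x, D x -> 0 <= h x)%E -> {ae mu, forall x, D x -> (g x <= h x)%E} ->
  (\int[mu]_(x in D) g x <= \int[mu]_(x in D) h x)%E.
Proof.
move=> mD mg g0 h0 [N [mN N0 gh]].
rewrite (ge0_negligible_integral mN mD mg g0 N0).
rewrite !ge0_integralE//; last by move=> x [/g0].
apply: ereal_sup_le => _ [f /= fg <-]; exists f => // x.
apply: le_trans (fg x) _; rewrite /patch; case: ifPn => xDN; last first.
  by case: ifPn => //; rewrite in_setE => /h0.
move: xDN; rewrite in_setE => -[Dx Nx]; rewrite mem_set//.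
by apply: contrapT => ngh; apply: Nx; apply: gh => /= /(_ Dx).
Qed.

Lemma has_int_sum D (I : Type) (s : seq I) (f : I -> T -> R) (c : I -> R) :
  (forall i, has_int D (f i) (c i)) -> measurable D ->
  has_int D (fun x => \sum_(i <- s) f i x) (\sum_(i <- s) c i).
Proof.
move=> fc mD; elim: s => [|i s IH].
  by rewrite big_nil; apply: has_int_eq (has_int0 D) => x _; rewrite big_nil.
rewrite big_cons; apply: has_int_eq (has_intD (fc i) IH mD) => x _.
by rewrite big_cons.
Qed.

Lemma has_int_indic D E : measurable D -> (mu D < +oo)%E -> measurable E ->
  has_int D \1_E (fine (mu (D `&` E))).
Proof.
move=> mD fD mE.
have lt : (mu (E `&` D) < +oo)%E.
  by apply: le_lt_trans fD; apply: le_measure;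
    rewrite ?in_setE//; exact: measurableI.
exists \1_E; split; first last.
- by rewrite integral_indic// setIC fineK// ge0_fin_numE// setIC.
- exact: aeW.
- apply/integrableP; split.
    by apply/measurable_EFinP; exact: measurable_indic.
  rewrite (eq_integral (fun x => (\1_E x)%:E)) ?integral_indic// => x _.
  by rewrite /= ger0_norm// indicE ler0n.
Qed.

Lemma has_int_const D c : measurable D -> (mu D < +oo)%E ->
  has_int D (fun=> c) (c * fine (mu D)).
Proof.
move=> mD fD; have := has_intZ c (has_int_indic mD fD measurableT) mD.
by rewrite setIT; apply: has_int_eq => x _; rewrite indicT mulr1.
Qed.

Lemma has_int_Rintegral D f c : has_int D f c -> measurable D ->
  measurable_fun D f -> \int[mu]_(x in D) f x = c.
Proof.
move=> [g [gi fg gc]] mD mf; rewrite /Rintegral.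
rewrite (@ae_eq_integral _ _ _ mu D (EFin \o g) (EFin \o f)) ?gc//.
- exact/measurable_EFinP.
- exact: measurable_int gi.
- by apply: aeS fg => x fg Dx /=; rewrite fg.
Qed.

Lemma has_int_setT D f c : measurable D ->
  has_int D f c <-> has_int setT (fun x => f x * \1_D x) c.
Proof.
move=> mD; split=> -[g [gi fg gc]].
  exists (g \_ D); split.
  - by move/(integrable_mkcond _ mD) : gi; rewrite restrict_EFin.
  - apply: aeS fg => x fg _; rewrite patchE indicE.
    by case: ifPn => xD; rewrite ?mulr0// mulr1 fg//; exact: set_mem.
  - rewrite -gc [RHS]integral_mkcond; apply: eq_integral => x _.
    by rewrite restrict_EFin.
exists g; split; first exact: integrableS gi.
- by apply: aeS fg => x /(_ Logic.I) <- Dx; rewrite indicE mem_set// mulr1.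
- have gD : {ae mu, forall x, g x = (g \_ D) x}.
    apply: aeS fg => x /(_ Logic.I); rewrite patchE indicE.
    by case: ifPn => // xD <-; rewrite mulr0.
  rewrite -gc [LHS]integral_mkcond; apply: ae_eq_integral => //.
  + have /measurable_int := (integrable_mkcond _ mD).1
      (integrableS measurableT mD (@subsetT _ _) gi).
    exact.
  + exact: measurable_int gi.
  + by apply: aeS gD => x gD _; rewrite restrict_EFin/= gD.
Qed.

Lemma has_int_ae_set D E f c : measurable D -> measurable E ->
  {ae mu, forall x, D x <-> E x} -> has_int D f c -> has_int E f c.
Proof.
move=> mD mE DE /(has_int_setT _ _ mD) h; apply/has_int_setT => //.
apply: has_int_ae h; apply: aeS DE => x DE _; rewrite !indicE.
by congr (_ * _%:R); congr (_ : bool); apply/idP/idP => /set_mem/DE/mem_set.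
Qed.

End has_int.

Lemma cvg_distP (R : realType) (V : normedModType R) (T : Type)
    (F : set_system T) (FF : Filter F) (f : T -> V) (v : V) :
  f x @[x --> F] --> v <-> `|v - f x| @[x --> F] --> (0 : R).
Proof.
split=> [/cvgrPdist_le fv|/cvgrPdist_le fv]; apply/cvgrPdist_le => e e0.
  by apply: filterS (fv e e0) => x; rewrite sub0r normrN normr_id.
by apply: filterS (fv e e0) => x; rewrite sub0r normrN normr_id.
Qed.

(** * Integral inequalities from finer and finer subdivisions *)

Section partition.
Context (R : realType).
Local Notation leb := (@lebesgue_measure R).

(* Adding up the increments of [Phi] over finer and finer subdivisions: [k a b]
   tends to [k0] at [x] when [a] and [b] both tend to [x], [a < x <= b]. *)
Lemma has_int_partition (s t : R) (Phi : R -> R) (k : R -> R -> R -> R)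
    (k0 m : R -> R) M : s < t ->
  (forall a b, s <= a -> a < b -> b <= t ->
    exists2 c, has_int leb `]a, b] (k a b) c & Phi b - Phi a <= c) ->
  has_int leb `]s, t] m M ->
  {ae leb, forall x, x \in `]s, t] -> forall a b, s <= a -> a < x -> x <= b ->
    b <= t -> `|k a b x| <= m x} ->
  {ae leb, forall x, x \in `]s, t] -> forall e : R, 0 < e -> exists2 d : R, 0 < d &
    forall a b, s <= a -> a < x -> x <= b -> b <= t -> b - a < d ->
    `|k a b x - k0 x| <= e} ->
  exists2 c, has_int leb `]s, t] k0 c & Phi t - Phi s <= c.
Proof.
move=> st Phik mM km kk0.
(* On each of n + 1 equal pieces ]p, q], [F] is [k p q]; the increments of [Phi] telescope. *)
have step n : exists F c, [/\ has_int leb `]s, t] F c, Phi t - Phi s <= c &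
    forall x, x \in `]s, t] -> exists a b, [/\ s <= a, a < x, x <= b, b <= t &
      b - a <= (t - s) / n.+1%:R /\ F x = k a b x]].
  pose h := (t - s) / n.+1%:R; pose p (j : nat) := s + j%:R * h.
  have h0 : 0 < h by rewrite divr_gt0// subr_gt0.
  have pS j : p j.+1 = p j + h by rewrite /p -[j.+1]addn1 natrD; ring.
  have pn : p n.+1 = t by rewrite /p /h mulrC divfK ?pnatr_eq0//; ring.
  have sp j : s <= p j by rewrite /p lerDl mulr_ge0// ltW.
  have pt j : (j <= n.+1)%N -> p j <= t.
    by move=> jn; rewrite -pn lerD2l ler_wpM2r ?ler_nat// ltW.
  suff H j : (j <= n.+1)%N -> exists F c,
      [/\ has_int leb `]s, p j] F c, Phi (p j) - Phi s <= c &
      forall x, x \in `]s, p j] -> exists a b, [/\ s <= a, a < x, x <= b, b <= t &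
      b - a <= h /\ F x = k a b x]].
    by have := H n.+1 (leqnn _); rewrite pn.
  elim: j => [_|j IH jn].
    exists (fun=> 0), 0; rewrite /p mul0r addr0; split.
    - exact: has_int0.
    - by rewrite subrr.
    - by move=> x; rewrite in_itv/= => /andP[/lt_le_trans h1 /h1]; rewrite ltxx.
  have [F [c [Fc Phic Fx]]] := IH (ltnW jn).
  have pjS : p j < p j.+1 by rewrite pS ltrDl.
  have [c' kc' Phic'] := Phik _ _ (sp j) pjS (pt _ jn).
  exists (fun x => if x <= p j then F x else k (p j) (p j.+1) x), (c + c').
  have -> : `]s, p j.+1]%classic = `]s, p j]%classic `|` `]p j, p j.+1]%classic.
    by rewrite -itv_bndbnd_setU// bnd_simp ?sp// ltW.
  split.
  - apply: has_intU => //.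
    + apply: has_int_eq Fc => x /=; rewrite in_itv/= => /andP[_ xp].
      by rewrite xp.
    + apply: has_int_eq kc' => x /=; rewrite in_itv/= => /andP[px _].
      by rewrite leNgt px.
    + apply/disj_setPS => x [] /=; rewrite !in_itv/= => /andP[_ xp] /andP[].
      by move=> /(le_lt_trans xp); rewrite ltxx.
  - by rewrite -[leLHS](subrKA (Phi (p j))) addrC lerD.
  - move=> x; rewrite in_itv/= => /andP[sx xp]; have [xj|jx] := leP x (p j).
      have [|a [b [? ? ? ? [? ?]]]] := Fx x; first by rewrite in_itv/= sx.
      by exists a, b.
    exists (p j), (p j.+1); split => //; first exact: pt.
    by split => //; rewrite pS addrAC subrr add0r.
have [F /choice[c Fc]] := choice step.
have [c0 k0c0 cc0] : exists2 c0, has_int leb `]s, t] k0 c0 & c n @[n --> \oo] --> c0.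
  apply: (@has_int_dom _ _ _ leb _ F k0 m c M _ mM) => //.
  - by move=> n; case: (Fc n).
  - apply: aeS kk0 => x kk0 xst; apply/cvgrPdist_le => e e0.
    have [d d0 H] := kk0 xst e e0.
    have hd : (t - s) / n.+1%:R @[n --> \oo] --> (0 : R).
      rewrite -[0](mulr0 (t - s)); apply: cvgM; first exact: cvg_cst.
      exact: cvg_harmonic.
    have /cvgrPdist_lt/(_ d d0) := hd; apply: filterS => n.
    rewrite sub0r normrN ger0_norm; last by rewrite divr_ge0// subr_ge0 ltW.
    move=> hn; have [_ _ /(_ x xst)[a [b [? ? ? ? [ba ->]]]]] := Fc n.
    by rewrite distrC H// (le_lt_trans ba).
  - move=> n; apply: aeS km => x km xst.
    have [_ _ /(_ x xst)[a [b [? ? ? ? [ba ->]]]]] := Fc n.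
    exact: km.
exists c0 => //; apply: (cvgr_to_ge cc0); apply: nearW => n.
by case: (Fc n).
Qed.

End partition.

(** * Bochner integrals tested against bounded functionals *)

Section bochner.
Context (R : realType) (V : normedModType R).
Local Notation leb := (@lebesgue_measure R).
Implicit Types (s f : R -> V) (D : set R).

Lemma simple_fun_sum s (g : V -> R) (x : R) : simple s ->
  g (s x) = \sum_(v <- fset_set (range s)) g v * \1_(s @^-1` [set v]) x.
Proof.
move=> [fs _]; rewrite (big_fsetD1 (s x))/=; last first.
  by rewrite in_fset_set// mem_set//; exists x.
rewrite indicE mem_set// mulr1 big_seq big1 ?addr0// => v.
rewrite in_fsetD1 => /andP[vs _]; rewrite indicE memNset ?mulr0//.
by move=> /= sv; move: vs; rewrite sv eqxx.
Qed.

Lemma has_int_simple D s (g : V -> R) : measurable D -> (leb D < +oo)%E ->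
  simple s -> has_int leb D (g \o s)
   (\sum_(v \in range s) fine (leb (D `&` s @^-1` [set v])) * g v).
Proof.
move=> mD fD ss; have [fs ms] := ss; rewrite fsbig_finite//.
have H v : has_int leb D (fun x => g v * \1_(s @^-1` [set v]) x)
    (fine (leb (D `&` s @^-1` [set v])) * g v).
  by rewrite mulrC; apply: has_intZ => //; apply: has_int_indic => //; exact: ms.
have := has_int_sum (mu := leb) (f := fun v x => g v * \1_(s @^-1` [set v]) x)
  (fset_set (range s)) H mD.
by apply: has_int_eq => x _; rewrite -simple_fun_sum.
Qed.

(** Since [s] takes finitely many values on measurable sets, [g] may be arbitrary; this matters for
    [H1norm], which is not continuous on L^2. *)
Lemma measurable_simple s (g : V -> R) : simple s ->
  measurable_fun (setT : set (measurableTypeR R)) (g \o s).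
Proof.
move=> ss; have [fs ms] := ss.
rewrite (_ : _ \o _ = fun x =>
    \sum_(v <- fset_set (range s)) g v * \1_(s @^-1` [set v]) x).
  apply: measurable_sum => v; apply: measurable_funM => //.
  by apply: measurable_indic; exact: ms.
by apply/funext => x /=; rewrite (simple_fun_sum g).
Qed.

Lemma measurable_simple_dist s r : simple s -> simple r ->
  measurable_fun (setT : set (measurableTypeR R)) (fun x => `|r x - s x|).
Proof.
move=> ss sr; have [fs ms] := ss.
rewrite (_ : (fun x => _) = fun x =>
    \sum_(v <- fset_set (range s)) `|r x - v| * \1_(s @^-1` [set v]) x).
  apply: measurable_sum => v; apply: measurable_funM => //.
    exact: (measurable_simple (fun w => `|w - v|)).
  by apply: measurable_indic; exact: ms.
by apply/funext => x /=; rewrite (simple_fun_sum (fun v => `|r x - v|) _ ss).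
Qed.

(** The maps [s_] approximate [f] in mean and determine the value. Measurability has to come from
    the other approximants [r], since convergence of the integrals of [|f - s_ n|] says nothing
    about it. *)
Lemma bochner_functional D f (v : V) (l : {linear V -> R^o}) C : 0 <= C ->
  measurable D ->
  (leb D < +oo)%E -> (forall u, `|l u| <= C * `|u|) ->
  is_bochner_integral D f v -> has_int leb D (l \o f) (l v).
Proof.
move=> C0 mD fD lC [[r [rs fr]] [s_ [ss fs Is]]].
have rn n := (rs n).1.
have lcvg (F : set_system nat) (u_ : nat -> V) u : Filter F ->
    `|u - u_ n| @[n --> F] --> (0 : R) -> l (u_ n) @[n --> F] --> l u.
  move=> FF uu; apply/cvgrPdist_le => e e0.
  have : C * `|u - u_ n| @[n --> F] --> (0 : R).
    by rewrite -[0](mulr0 C); apply: cvgM => //; exact: cvg_cst.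
  move=> /cvgrPdist_le/(_ e e0); apply: filterS => n.
  rewrite sub0r normrN => le; rewrite -linearB (le_trans (lC _))//.
  by rewrite (le_trans (ler_norm _)).
have [g mg fg] : exists2 g, measurable_fun D g &
    {ae leb, forall x, D x -> (l \o f) x = g x}.
  apply: (@ae_lim_measurable _ _ _ leb D (fun n => l \o r n)) => [n|].
    by apply: measurable_funTS; exact: measurable_simple.
  by apply: aeS fr => x fr Dx; apply: lcvg; exact: fr.
(* The distance to [s_ n] agrees almost everywhere with a measurable function, being the limit of
   the distances between the simple maps [r m] and [s_ n]. *)
have dist n : exists2 h, measurable_fun D h &
    {ae leb, forall x, D x -> `|f x - s_ n x| = h x}.
  apply: (@ae_lim_measurable _ _ _ leb D (fun m x => `|r m x - s_ n x|)) => [m|].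
    by apply: measurable_funTS; exact: measurable_simple_dist.
  apply: aeS fr => x /[apply] fr; apply/cvgrPdist_le => e e0.
  have /cvgrPdist_le/(_ e e0) := fr; apply: filterS => m.
  rewrite sub0r normrN normr_id => le.
  by rewrite (le_trans (ler_dist_dist _ _))// opprB addrA subrK.
have /choice[h0 h0m] : forall n, exists h : R -> R,
    [/\ measurable_fun (D : set (measurableTypeR R)) h, forall x, 0 <= h x &
    {ae leb, forall x, D x -> `|f x - s_ n x| = h x}].
  move=> n; have [h mh fh] := dist n.
  exists (fun x => `|h x|); split => //; first exact: measurableT_comp.
  by apply: aeS fh => x fh Dx; rewrite -fh// normr_id.
have hle n : (\int[leb]_(x in D) (h0 n x)%:E <=
    \int[leb]_(x in D) `|f x - s_ n x|%:E)%E.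
  have [mh hp fh] := h0m n.
  apply: ge0_le_lower_integral => //; first exact/measurable_EFinP.
  - by move=> x _; rewrite lee_fin.
  - by apply: aeS fh => x fh Dx; rewrite fh.
have hsmall e : 0 < e -> \forall n \near \oo,
    (\int[leb]_(x in D) `|f x - s_ n x|%:E < e%:E)%E.
  move=> e0; have /fine_cvgP[ffin /cvgrPdist_lt/(_ e e0) fe] := fs.
  apply: filterS2 ffin fe => n ffin /=.
  rewrite sub0r normrN => fe; rewrite -(fineK ffin) lte_fin.
  by rewrite (le_lt_trans (ler_norm _)).
have hint n e : (\int[leb]_(x in D) `|f x - s_ n x|%:E < e%:E)%E ->
    exists2 c, has_int leb D (h0 n) c & c < e.
  move=> lt; have [mh hp fh] := h0m n.
  have hi : leb.-integrable D (EFin \o h0 n).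
    apply/integrableP; split; first exact/measurable_EFinP.
    have -> : (\int[leb]_(x in D) `|(EFin \o h0 n) x| =
        \int[leb]_(x in D) (h0 n x)%:E)%E.
      by apply: eq_integral => x _; rewrite /= ger0_norm.
    by rewrite (le_lt_trans (hle n))// (lt_trans lt)// ltry.
  exists (\int[leb]_(x in D) h0 n x); first exact: has_int_integrable.
  rewrite -lte_fin fineK; last exact: integrable_fin_num.
  exact: le_lt_trans lt.
have lsI n : has_int leb D (l \o s_ n) (l (simple_integral D (s_ n))).
  have := has_int_simple l mD fD (ss n).
  congr has_int; rewrite /simple_integral !fsbig_finite//; try by case: (ss n).
  by rewrite linear_sum; apply: eq_bigr => u _; rewrite linearZ.
(* One index with mean distance below 1 is enough: [l \o f] is dominated by C (|s_n| + |f -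
   s_n|). *)
have [c lc] : exists c, has_int leb D (l \o f) c.
  have [n _ /(_ n (leqnn n)) lt] := hsmall 1 ltr01.
  have [c hc _] := hint n 1 lt; have [mh hp fh] := h0m n.
  have [M lM] : exists M, has_int leb D (fun x => C * `|s_ n x|) M.
    eexists; apply: has_intZ => //.
    exact: (has_int_simple (fun v => `|v|) mD fD (ss n)).
  have [k [ki hk _]] := has_intD lM (has_intZ C hc mD) mD.
  exists (\int[leb]_(x in D) g x); apply: (@has_int_ae _ _ _ leb D g).
    by apply: aeS fg => x fg Dx; rewrite fg.
  apply: has_int_integrable => //.
  apply/integrableP; split; first exact/measurable_EFinP.
  case/integrableP : (ki) => mk; apply: le_lt_trans.
  apply: ge0_le_lower_integral => //.
    by apply: measurableT_comp => //; exact/measurable_EFinP.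
  apply: aeS3 hk fh fg => x hk fh fg Dx; rewrite lee_fin -hk// -fg//.
  apply: le_trans (ler_norm _); rewrite -fh//= -mulrDr.
  apply: le_trans (lC _) _; apply: ler_wpM2l => //.
  by rewrite -[in leLHS](subrKC (s_ n x) (f x)) ler_normD.
suff -> : l v = c by [].
apply/eqP; rewrite -subr_eq0 -normr_le0; apply/ler_addgt0Pl => e e0.
rewrite addr0; have e2 : 0 < e / 2 by rewrite divr_gt0.
(* Dividing by [C + 1] covers the case C = 0. *)
have eC : 0 < e / 2 / (C + 1) by rewrite divr_gt0// ltr_wpDl.
have lI : l (simple_integral D (s_ n)) @[n --> \oo] --> l v.
  by apply: lcvg; have /cvg_distP := Is; exact.
have [n _ /(_ n (leqnn n)) [lt lIn]] : \forall n \near \oo,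
    (\int[leb]_(x in D) `|f x - s_ n x|%:E < (e / 2 / (C + 1))%:E)%E /\
    `|l v - l (simple_integral D (s_ n))| <= e / 2.
  apply: filterS2 (hsmall _ eC) _; last first.
    by move/cvgrPdist_le : lI => /(_ _ e2); exact.
  by move=> n h1 h2; split.
have [k hk ke] := hint n _ lt; have [mh hp fh] := h0m n.
rewrite -(subrKA (l (simple_integral D (s_ n)))) (splitr e).
rewrite (le_trans (ler_normD _ _))// lerD//.
rewrite distrC.
have : `|c - l (simple_integral D (s_ n))| <= C * k.
  apply: (has_int_norm_le (has_intB lc (lsI n) mD) (has_intZ C hk mD) mD).
  apply: aeS fh => x fh Dx; rewrite /= -fh// -linearB.
  exact: lC.
move/le_trans; apply; apply: (@le_trans _ _ ((C + 1) * k)).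
  rewrite ler_wpM2r ?lerDl//.
  apply: (has_int_le (has_int0 leb D) hk mD); apply: aeW => x _; exact: hp.
by rewrite mulrC -ler_pdivlMr ?ltr_wpDl// ltW.
Qed.

End bochner.

(** * The space L^2(0, L) *)

Section L2.
Context (R : realType) (L : R).
Local Notation leb := (@lebesgue_measure R).
Local Notation leb0L := (leb0L L).
Implicit Types (u v w : L2 L) (f g : measurableTypeR R -> R) (c : R).

Lemma leb0LE (A : set R) : leb0L A = leb (A `&` `]0, L[).
Proof. by []. Qed.

Lemma leb0L_setT : (leb0L setT < +oo)%E.
Proof.
rewrite leb0LE setTI lebesgue_measure_itv/=.
by case: ifP => _; rewrite ?ltry// -EFinB ltry.
Qed.

Lemma ae_leb0LP (P : R -> Prop) : {ae leb0L, forall x, P x} <->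
  {ae leb, forall x, x \in `]0, L[ -> P x}.
Proof.
split=> -[N [mN N0 PN]].
  exists (N `&` `]0, L[); split => //; first exact: measurableI.
  move=> x /= /not_implyP[xL nP]; split => //; exact: PN.
exists (N `|` ~` `]0, L[); split => //.
- by apply: measurableU => //; exact: measurableC.
- rewrite leb0LE setIUl setICl setU0.
  by apply: (subset_measure0 _ mN _ N0) => //; exact: measurableI.
- move=> x /= nP; have [xL|] := pselect (x \in `]0, L[); last by right.
  by left; apply: PN => /= /(_ xL).
Qed.

Lemma has_int_leb0L f c : has_int leb0L setT f c -> has_int leb `]0, L[ f c.
Proof.
have mC : measurable (~` `]0, L[ : set (measurableTypeR R)).
  exact: measurableC.
have nC : leb0L (~` `]0, L[) = 0%E.
  by rewrite leb0LE setICl measure0.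
have eD : setT `\` ~` `]0, L[%classic = `]0, L[%classic :> set R.
  by rewrite setDE setCK setTI.
have meq A : measurable A -> A `<=` `]0, L[%classic -> leb0L A = leb A.
  by move=> mA AL; rewrite leb0LE setIidl.
move=> [g [gi fg gc]]; exists g; split.
- have /integrableP[mg lt] := gi.
  apply/integrableP; split; first exact: measurable_funTS.
  move: lt; rewrite (ge0_negligible_integral mC _ _ _ nC)//; last first.
    exact: measurableT_comp.
  by rewrite eD (eq_measure_integral leb).
- by move/ae_leb0LP : fg; apply: aeS => x fg xL; exact: fg.
- rewrite -gc (negligible_integral mC _ gi nC)// eD.
  by apply: eq_measure_integral => A mA AL; rewrite meq.
Qed.

Lemma measurable_Lrep u : measurable_fun setT (Lrep u).
Proof. exact: measurable_funPT (Lrep u). Qed.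
Hint Resolve measurable_Lrep : core.

Definition ip u v : R := \int[leb0L]_x (Lrep u x * Lrep v x).

Lemma ip_leb0L u v : has_int leb0L setT (fun x => Lrep u x * Lrep v x) (ip u v).
Proof.
apply: has_int_integrable => //.
have /Lfun1_integrable := Lfun2_mul_Lfun1 (Lspace_Lfun u) (Lspace_Lfun v).
by apply: eq_integrable.
Qed.

Lemma LrepD u v : {ae leb0L, forall x, Lrep (u + v) x = Lrep u x + Lrep v x}.
Proof.
by apply: aeS (@LclsK _ _ _ leb0L _ (lee1n 2) (Lrep u + Lrep v)) => x; exact.
Qed.

Lemma LrepZ c u : {ae leb0L, forall x, Lrep (c *: u) x = c * Lrep u x}.
Proof.
by apply: aeS (@LclsK _ _ _ leb0L _ (lee1n 2) (c *: Lrep u)) => x; exact.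
Qed.

Lemma LrepB u v : {ae leb0L, forall x, Lrep (u - v) x = Lrep u x - Lrep v x}.
Proof.
rewrite -scaleN1r; apply: aeS2 (LrepD u (-1 *: v)) (LrepZ (-1) v) => x -> ->.
by rewrite mulN1r.
Qed.

Lemma ipC u v : ip u v = ip v u.
Proof. by congr fine; apply: eq_integral => x _; rewrite mulrC. Qed.

Lemma ip_is_linear u : linear_for *%R (ip u).
Proof.
move=> c v w; apply: (@has_int_uniq _ _ _ leb0L setT) => //; first exact: ip_leb0L.
have := has_intD (has_intZ c (ip_leb0L u v) measurableT) (ip_leb0L u w) measurableT.
apply: has_int_ae; apply: aeS2 (LrepD (c *: v) w) (LrepZ c v) => x e1 e2 _.
by rewrite e1 e2 mulrDr mulrCA.
Qed.

HB.instance Definition _ u :=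
  GRing.isLinear.Build R (L2 L) R^o *:%R (ip u) (ip_is_linear u).

Lemma ipDl u v w : ip (u + v) w = ip u w + ip v w.
Proof. by rewrite ![ip _ w]ipC linearD. Qed.

Lemma ipZl c u v : ip (c *: u) v = c * ip u v.
Proof. by rewrite ![ip _ v]ipC linearZ. Qed.

Lemma ipBl u v w : ip (u - v) w = ip u w - ip v w.
Proof. by rewrite ![ip _ w]ipC linearB. Qed.

Lemma ipDr u v w : ip w (u + v) = ip w u + ip w v.
Proof. exact: linearD. Qed.

Lemma ipZr c u v : ip v (c *: u) = c * ip v u.
Proof. exact: linearZ. Qed.

Lemma ipBr u v w : ip w (u - v) = ip w u - ip w v.
Proof. exact: linearB. Qed.

Lemma ip_norm u : ip u u = `|u| ^+ 2.
Proof.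
have h : (`|u| %:E = 'N[leb0L]_2%:E[EFin \o Lrep u])%E.
  exact: (finite_norm_fine (Lrep u)).
apply: EFin_inj.
have := @poweR_Lnorm _ _ _ leb0L (EFin \o Lrep u) 2.
rewrite -h pnatr_eq0 poweR_EFin powR_mulrn// => /(_ isT) ->.
rewrite /ip fineK; last first.
  apply: integrable_fin_num => //.
  have /Lfun1_integrable := Lfun2_mul_Lfun1 (Lspace_Lfun u) (Lspace_Lfun u).
  by apply: eq_integrable.
apply: eq_integral => x _ /=.
by rewrite powR_mulrn// -normrX ger0_norm ?sqr_ge0// expr2.
Qed.

Lemma ip_cauchy u v : `|ip u v| <= `|u| * `|v|.
Proof.
have [->|v0] := eqVneq v 0.
  by rewrite linear0 !normr0 mulr0.
have nv : 0 < `|v| by rewrite normr_gt0.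
rewrite -[leLHS]ger0_norm// -[leRHS]ger0_norm ?mulr_ge0//.
rewrite -ler_sqr ?nnegrE// !real_normK ?num_real// exprMn.
pose w := u - (ip u v / `|v| ^+ 2) *: v.
have : 0 <= ip w w by rewrite ip_norm sqr_ge0.
rewrite /w !(ipBl, ipBr, ipZl, ipZr) [ip v u]ipC !ip_norm.
have v2 : `|v| ^+ 2 != 0 by rewrite expf_neq0// gt_eqF.
set a := `|u| ^+ 2; set b := `|v| ^+ 2 in v2 *; set c := ip u v => h.
have b0 : 0 < b by rewrite exprn_gt0.
rewrite -subr_ge0 -(pmulr_lge0 _ (_ : 0 < b^-1)) ?invr_gt0//.
by apply: le_trans h _; rewrite le_eqVlt; apply/orP; left; apply/eqP; field.
Qed.

Lemma normD_sqr u v : `|u + v| ^+ 2 = `|u| ^+ 2 + 2 * ip u v + `|v| ^+ 2.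
Proof. by rewrite -!ip_norm !(ipDl, ipDr) [ip v u]ipC; ring. Qed.

Lemma Lfun2P f : measurable_fun setT f ->
  leb0L.-integrable setT (EFin \o (fun x => f x ^+ 2)) -> f \in Lfun leb0L 2%:E.
Proof.
move=> mf /integrableP[_ lt]; apply/andP; split; [exact: mem_set|].
apply: mem_set; rewrite /= /finite_norm; apply: (@lty_poweRy _ _ 2) => //.
rewrite poweR_Lnorm//; move: lt; congr (_ < _)%E; apply: eq_integral => x _.
by rewrite /= powR_mulrn// -normrX.
Qed.

Lemma Lfun2_le f g : measurable_fun setT f -> g \in Lfun leb0L 2%:E ->
  {ae leb0L, forall x, `|f x| <= `|g x|} -> f \in Lfun leb0L 2%:E.
Proof.
move=> mf gL fg; apply: Lfun2P => //.
have /integrableP[mg lt] := Lfun2_integrable_sqr gL.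
have mf2 : measurable_fun setT (EFin \o (fun x => f x ^+ 2)).
  by apply/measurable_EFinP; exact: measurable_funX.
apply/integrableP; split => //; apply: le_lt_trans lt.
apply: ae_ge0_le_integral => //; [exact: (measurableT_comp _ mf2)|exact: (measurableT_comp _ mg)|].
apply: aeS fg => x fg _ /=.
by rewrite lee_fin !normrX ler_sqr ?nnegrE.
Qed.

Lemma Lfun2_cst c : cst c \in Lfun leb0L 2%:E.
Proof.
apply: Lfun2P => //; apply/integrableP; split; last first.
  rewrite (_ : (fun x => _) = cst (`|c ^+ 2|%:E))// integral_cst//.
  by rewrite lte_mul_pinfty// leb0L_setT.
by apply/measurable_EFinP; apply: measurable_funX; exact: measurable_cst.
Qed.

Lemma Lfun2_bounded f c : measurable_fun setT f ->
  (forall x, x \in `]0, L[ -> `|f x| <= c) -> f \in Lfun leb0L 2%:E.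
Proof.
move=> mf fc; apply: (Lfun2_le mf (Lfun2_cst c)); apply/ae_leb0LP.
by apply: aeW => x xL; rewrite (le_trans (fc x xL))// ler_norm.
Qed.

Lemma L2classE f : f \in Lfun leb0L 2%:E ->
  {ae leb0L, forall x, Lrep (L2class L f) x = f x}.
Proof.
move=> fL; rewrite /L2class; case: pselect => // fL'.
by apply: aeS (LclsK (Lfun_Sub (lee1n 2) fL')) => x; exact.
Qed.

Lemma L2_ext u v : {ae leb0L, forall x, Lrep u x = Lrep v x} -> u = v.
Proof. by move=> uv; apply/Lspace_ext; apply: aeS uv => x. Qed.

Lemma L2class_eq f u : measurable_fun setT f ->
  {ae leb0L, forall x, Lrep u x = f x} -> L2class L f = u.
Proof.
move=> mf uf; have fL : f \in Lfun leb0L 2%:E.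
  apply: (Lfun2_le mf (Lspace_Lfun u)).
  by apply: aeS uf => x ux; rewrite -ux; exact: lexx.
by apply: L2_ext; apply: aeS2 (L2classE fL) uf => x -> ->.
Qed.

Lemma ip_int u v f g : {ae leb0L, forall x, Lrep u x = f x} ->
  {ae leb0L, forall x, Lrep v x = g x} ->
  has_int leb `]0, L[ (fun x => f x * g x) (ip u v).
Proof.
move=> uf vg; apply: has_int_leb0L; apply: has_int_ae (ip_leb0L u v).
by apply: aeS2 uf vg => x -> ->.
Qed.

(** The bound passes to the limit, so (f_n - f)^2 is dominated by (2 g)^2, which is integrable. *)
Lemma L2_dct (f_ : nat -> R -> R) f g :
  (forall n, f_ n \in Lfun leb0L 2%:E) -> f \in Lfun leb0L 2%:E ->
  g \in Lfun leb0L 2%:E ->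
  {ae leb0L, forall x, f_ n x @[n --> \oo] --> f x} ->
  (forall n, {ae leb0L, forall x, `|f_ n x| <= g x}) ->
  L2class L (f_ n) @[n --> \oo] --> L2class L f.
Proof.
move=> fnL fL gL ff fg.
have dE n : {ae leb0L, forall x,
    Lrep (L2class L (f_ n) - L2class L f) x = f_ n x - f x}.
  by apply: aeS3 (L2classE (fnL n)) (L2classE fL)
    (LrepB (L2class L (f_ n)) (L2class L f)) => x e1 e2 ->; rewrite e1 e2.
pose c_ n : R := `|L2class L (f_ n) - L2class L f| ^+ 2.
have dI n : has_int leb0L setT (fun x => (f_ n x - f x) * (f_ n x - f x)) (c_ n).
  rewrite /c_ -ip_norm; apply: has_int_ae (ip_leb0L _ _).
  by apply: aeS (dE n) => x ->.
have gE := L2classE gL.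
have gI : has_int leb0L setT (fun x => 4 * (g x * g x))
    (4 * ip (L2class L g) (L2class L g)).
  apply: has_intZ => //; apply: has_int_ae (ip_leb0L _ _).
  by apply: aeS gE => x ->.
have fgn : {ae leb0L, forall x n, `|f_ n x| <= g x} by exact: ae_foralln.
have [||c c0 cc] := has_int_dom (f := fun=> 0) dI gI measurableT.
- apply: aeS ff => x ff _; rewrite -[0](mulr0 (f x - f x)).
  by apply: cvgM; rewrite ?subrr -?[0](subrr (f x)); apply: cvgB => //; exact: cvg_cst.
- move=> n; apply: aeS2 ff fgn => x ff fgx _.
  have fx : `|f x| <= g x.
    by apply: (cvgr_to_le (cvg_norm ff)); apply: nearW => k; exact: fgx.
  have g0 : 0 <= g x by apply: le_trans fx.
  rewrite normrM -expr2 (_ : 4 * _ = (g x + g x) ^+ 2); last by ring.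
  rewrite ler_sqr ?nnegrE ?addr_ge0//.
  by rewrite (le_trans (ler_normB _ _))// lerD.
have c00 : c = 0 by apply: (has_int_uniq c0 (has_int0 _ _)).
apply/cvgrPdist_le => e e0; move: cc; rewrite c00.
have e20 : 0 < e ^+ 2 by rewrite exprn_gt0.
move=> /cvgrPdist_le/(_ _ e20); apply: filterS => n.
rewrite sub0r normrN ger0_norm ?sqr_ge0// distrC.
by rewrite /c_ ler_sqr ?nnegrE// ltW.
Qed.

End L2.

(** * Smooth functions and smooth approximations of indicators *)

Section smooth.
Context (R : realType).
Implicit Types (f g : R -> R) (C : set (R -> R)).

Definition smooth f := forall n x, derivable (f^`(n))%classic x 1.

Lemma is_derive_ext f g (x : R) (df dg : R) : is_derive x 1 f df ->
  f =1 g -> df = dg -> is_derive x 1 g dg.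
Proof. by move=> fx /funext <- <-. Qed.

Lemma is_derive1E f f' : (forall x : R, is_derive x 1 f (f' x)) -> f^`()%classic = f'.
Proof. by move=> ff'; apply/funext => x; rewrite derive1E; exact: derive_val. Qed.

(* Smoothness by coinduction. *)
Lemma smooth_closed C f : (forall g, C g -> exists2 g', C g' &
  forall x : R, is_derive x 1 g (g' x)) -> C f -> smooth f.
Proof.
move=> CC Cf.
have Cn n : C (f^`(n))%classic.
  elim: n => [|n]; first by rewrite derive1n0.
  by rewrite derive1nS => /CC[g' Cg' /is_derive1E ->].
move=> n x; have [g' _ fg] := CC _ (Cn n).
by have [] := fg x.
Qed.

Lemma smooth_deriv f : smooth f -> smooth f^`()%classic.
Proof. by move=> sf n x; rewrite -derive1Sn. Qed.

Lemma smooth_is_derive f : smooth f ->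
  forall x : R, is_derive x 1 f (f^`()%classic x).
Proof.
by move=> sf x; rewrite derive1E; apply: derivableP; exact: (sf 0%N).
Qed.

Lemma smooth_continuous f : smooth f -> continuous f.
Proof.
move=> sf x; apply: differentiable_continuous; apply/derivable1_diffP.
exact: (sf 0%N x).
Qed.

Lemma smoothI f f' : (forall x : R, is_derive x 1 f (f' x)) -> smooth f' -> smooth f.
Proof.
move=> ff' sf'.
apply: (@smooth_closed [set g | g = f \/ smooth g]); last by left.
move=> g [->|sg]; first by exists f' => //; right.
exists g^`()%classic; last exact: smooth_is_derive.
by right; exact: smooth_deriv.
Qed.

(** By Leibniz' rule the derivative of a product is a sum of products: sums must be included for the
    class to be stable under derivation, as [smooth_closed] demands. *)
Inductive prodspan : (R -> R) -> Prop :=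
| PM f g : smooth f -> smooth g -> prodspan (f * g)
| PD f g : prodspan f -> prodspan g -> prodspan (f + g).

Lemma smooth_prodspan f : prodspan f -> smooth f.
Proof.
apply: smooth_closed => {}f; elim => {f}.
  move=> f g sf sg; exists (f * g^`()%classic + g * f^`()%classic).
    exact: PD (PM sf (smooth_deriv sg)) (PM sg (smooth_deriv sf)).
  by move=> x; have := is_deriveM (smooth_is_derive sf x) (smooth_is_derive sg x).
move=> f g _ [f' pf' ff'] _ [g' pg' gg']; exists (f' + g'); first exact: PD.
by move=> x; apply: is_deriveD.
Qed.

Lemma smoothM f g : smooth f -> smooth g -> smooth (f * g).
Proof. by move=> sf sg; apply: smooth_prodspan; exact: PM. Qed.

Lemma smooth_cst c : smooth (cst c).
Proof.
apply: (@smooth_closed [set f | exists c, f = cst c]); last by exists c.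
by move=> _ [k ->]; exists (cst 0); [exists 0|move=> x; exact: is_derive_cst].
Qed.

Lemma smooth1 f : smooth f -> f = f * cst 1.
Proof. by move=> _; apply/funext => x; rewrite !fctE mulr1. Qed.

Lemma smoothD f g : smooth f -> smooth g -> smooth (f + g).
Proof.
move=> sf sg; apply: smooth_prodspan.
rewrite (smooth1 sf) (smooth1 sg).
by apply: PD; [exact: (PM sf (@smooth_cst 1))|exact: (PM sg (@smooth_cst 1))].
Qed.

Lemma smooth_affine f a b : smooth f -> smooth (fun x => f (a * x + b)).
Proof.
move=> sf.
apply: (@smooth_closed [set g | exists k f, smooth f /\
  g = fun x => k * f (a * x + b)]); last first.
  by exists 1, f; split => //; apply/funext => x; rewrite mul1r.
move=> _ [k [{sf}f [sf ->]]]; exists (fun x => k * a * f^`()%classic (a * x + b)).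
  by exists (k * a), f^`()%classic; split; first exact: (smooth_deriv sf).
move=> x.
have da : is_derive (x : R) 1 (fun x => a * x + b) a.
  by apply: is_derive_eq; rewrite addr0 scaler1.
have := is_deriveZ k (@is_derive1_comp _ f (fun x => a * x + b) x _ _
  (smooth_is_derive sf _) da).
move/is_derive_ext; apply => //.
by rewrite /GRing.scale/= mulrA mulrAC.
Qed.

(** For n = 0, this is the classical smooth function exp(-1/x) extended by 0. The whole family is
    needed because the derivative of [flat n] is [flat n.+2 - n%:R * flat n.+1]. *)
Definition flat n (x : R) : R :=
  if 0 < x then x^-1 ^+ n * expR (- x^-1) else 0.

(* From [expR (x^-1) >= x^-1 ^+ n.+2 / (n.+2)`!]; quadratic decay at 0 is what
   makes [flat n] differentiable there. *)
Lemma flat_bound n x : `|flat n x| <= (n.+2)`!%:R * x ^+ 2.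
Proof.
rewrite /flat; case: ifPn => [x0|_]; last first.
  by rewrite normr0 mulr_ge0// sqr_ge0.
have xi0 : 0 < x^-1 by rewrite invr_gt0.
rewrite ger0_norm; last by rewrite mulr_ge0 ?exprn_ge0 ?expR_ge0// ltW.
rewrite expRN ler_pdivrMr ?expR_gt0//.
have := expR_ge1Dxn n.+1 (ltW xi0).
set E := expR _; set F := (_)`!%:R => h.
have F0 : 0 < F by rewrite ltr0n fact_gt0.
have -> : x^-1 ^+ n = F * x ^+ 2 * (x^-1 ^+ n.+2 / F).
  by rewrite !exprS; field; rewrite !gt_eqF.
apply: ler_wpM2l; first by rewrite mulr_ge0 ?sqr_ge0// ltW.
by rewrite (le_trans _ h)// lerDr.
Qed.

Lemma flat_is_derive n (x : R) :
  is_derive x 1 (flat n) (flat n.+2 x - n%:R * flat n.+1 x).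
Proof.
have [x0|x0|<-] := ltgtP 0 x.
- apply: (@near_eq_is_derive _ R^o R^o (fun x : R => x^-1 ^+ n * expR (- x^-1))).
    near=> y; rewrite /flat ifT//.
    by near: y; exact: lt_nbhsr.
  have xn : x != 0 by rewrite gt_eqF.
  have dV : is_derive x 1 (fun x : R => x^-1) (- x ^- 2).
    apply: DeriveDef; first exact: (@derivableV _ _ id).
    by rewrite (@deriveV _ _ id)// derive_id /GRing.scale/= mulr1.
  rewrite /flat x0.
  have dE : is_derive x 1 (fun x => expR (- x^-1)) (x^-1 ^+ 2 * expR (- x^-1)).
    have := @is_derive1_comp _ _ (fun x : R => - x^-1) x _ _
      (is_derive_expR _) (is_deriveN dV).
    move/is_derive_ext; apply => //.
    by rewrite opprK mulrC exprVn.
  have := is_deriveM (is_deriveX n dV) dE.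
  move/is_derive_ext; apply => //.
    by move=> y; rewrite !fctE.
  rewrite /GRing.scale/= !fctE -exprVn; case: n => [|n]/=.
    by rewrite !expr0; ring.
  by rewrite !exprS; ring.
- rewrite /flat !(ltNge 0 x) (ltW x0)/= mulr0 subr0.
  apply: (@near_eq_is_derive _ R^o R^o (cst 0)).
    near=> y; rewrite ifF//; apply: negbTE; rewrite -leNgt ltW//.
    by near: y; exact: lt_nbhsl.
- have f0 m : flat m 0 = 0 by rewrite /flat ltxx.
  rewrite !f0 mulr0 subr0.
  have H : h^-1 *: (flat n (h *: (1 : R) + 0) - flat n 0) @[h --> (0 : R)^'] --> (0 : R).
    apply/cvgrPdist_le => e e0; set F : R := (n.+2)`!%:R.
    have F0 : 0 < F by rewrite ltr0n fact_gt0.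
    near=> h; rewrite sub0r normrN f0 subr0 addr0 normrZ /GRing.scale/= mulr1.
    have h0 : h != 0 by near: h; exact: nbhs_dnbhs_neq.
    have hn : 0 < `|h| by rewrite normr_gt0.
    rewrite normfV mulrC ler_pdivrMr//.
    apply: le_trans (flat_bound n h) _.
    rewrite -real_normK ?num_real// expr2 mulrA ler_wpM2r//.
    rewrite mulrC -ler_pdivlMr//.
    by near: h; apply: dnbhs0_le; rewrite divr_gt0.
  by apply: DeriveDef; [apply/cvg_ex; exists 0|exact: cvg_lim H].
Unshelve. all: by end_near. Qed.

Inductive flatspan : (R -> R) -> Prop :=
| FM k n : flatspan (fun x => k * flat n x)
| FD f g : flatspan f -> flatspan g -> flatspan (f + g).

Lemma smooth_flat n : smooth (flat n).
Proof.
apply: (@smooth_closed flatspan); last first.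
  rewrite (_ : flat n = fun x => 1 * flat n x); first exact: FM.
  by apply/funext => x; rewrite mul1r.
move=> f; elim => {f} [k m|f g _ [f' pf' ff'] _ [g' pg' gg']].
  exists ((fun x => k * flat m.+2 x) + (fun x => (- (k * m%:R)) * flat m.+1 x)).
    by apply: FD; exact: FM.
  move=> x; have := is_deriveZ k (flat_is_derive m x).
  by move/is_derive_ext; apply => //; rewrite /GRing.scale/= !fctE; ring.
by exists (f' + g'); [exact: FD|move=> x; apply: is_deriveD].
Qed.

Lemma flat0_ge0 x : 0 <= flat 0 x.
Proof. by rewrite /flat; case: ifP => // _; rewrite mulr_ge0 ?expR_ge0. Qed.

Lemma flat0_le1 x : flat 0 x <= 1.
Proof.
rewrite /flat; case: ifP => // x0.
by rewrite expr0 mul1r expR_le1 oppr_le0 invr_ge0 ltW.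
Qed.

Lemma flat0_cvg x : 0 < x -> flat 0 (n.+1%:R * x) @[n --> \oo] --> (1 : R).
Proof.
move=> x0.
rewrite (_ : (fun n => _) = fun n => expR (- (n.+1%:R^-1 * x^-1))); last first.
  apply/funext => n; rewrite /flat mulr_gt0// expr0 mul1r.
  by rewrite invfM.
rewrite -[X in _ --> X]expR0; apply: continuous_cvg; first exact: continuous_expR.
rewrite -[X in _ --> X]oppr0; apply: cvgN; rewrite -[X in _ --> X](mul0r x^-1).
by apply: cvgM; [exact: cvg_harmonic|exact: cvg_cst].
Qed.

(** The factor n + 1 drives both [flat 0] factors to 1 inside ]c, d[, so the limit is the indicator
    of that interval. *)
Definition sbump (c d : R) n (x : R) : R :=
  flat 0 (n.+1%:R * (x - c)) * flat 0 (n.+1%:R * (d - x)).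

Lemma smooth_sbump c d n : smooth (sbump c d n).
Proof.
have := smoothM
  (smooth_affine (a := n.+1%:R) (b := - (n.+1%:R * c)) (@smooth_flat 0))
  (smooth_affine (a := - n.+1%:R) (b := n.+1%:R * d) (@smooth_flat 0)).
congr smooth; apply/funext => x; rewrite /sbump !fctE.
by congr (flat 0 _ * flat 0 _); ring.
Qed.

Lemma sbump_ge0 c d n x : 0 <= sbump c d n x.
Proof. by rewrite mulr_ge0// flat0_ge0. Qed.

Lemma sbump_le1 c d n x : sbump c d n x <= 1.
Proof. by rewrite mulr_ile1// ?flat0_ge0// flat0_le1. Qed.

Lemma sbump_supp c d n x : sbump c d n x != 0 -> c < x < d.
Proof.
rewrite mulf_eq0 negb_or /flat => /andP[].
case: ifP => [+ _|]; last by rewrite eqxx.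
rewrite pmulr_rgt0// subr_gt0 => ->.
case: ifP => [+ _|]; last by rewrite eqxx.
by rewrite pmulr_rgt0// subr_gt0.
Qed.

Lemma sbump_cvg c d x : sbump c d n x @[n --> \oo] --> (\1_(`]c, d[) x : R).
Proof.
rewrite indicE mem_setE in_itv/=; have [/andP[cx xd]|xcd] := boolP (c < x < d).
  rewrite -[X in _ --> X]mulr1.
  by apply: cvgM; apply: flat0_cvg; rewrite subr_gt0.
apply: cvg_near_cst; apply: nearW => n; apply/eqP.
by apply: contraNT xcd => /sbump_supp.
Qed.

End smooth.

(** * Density of the test functions in L^2(0, L) *)

Section density.
Context (R : realType) (L : R).
Local Notation leb := (@lebesgue_measure R).
Local Notation leb0L := (leb0L L).
Local Notation cls := (L2class L).
Implicit Types (u v w : L2 L) (f g : measurableTypeR R -> R) (c : R).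

Lemma Lfun2_continuous (f : R -> R) : continuous f -> f \in Lfun leb0L 2%:E.
Proof.
move=> cf; have [M [_ fM]] : bounded_set (f @` `[0, L]).
  apply: compact_bounded; apply: continuous_compact; last exact: segment_compact.
  exact: continuous_subspaceT.
apply: (@Lfun2_bounded _ _ f (M + 1)); first exact: continuous_measurable_fun.
move=> x xL; apply: (fM (M + 1)); first by rewrite ltrDl.
exists x => //=; rewrite in_itv/=.
by move: xL; rewrite in_itv/= => /andP[/ltW -> /ltW ->].
Qed.

Lemma test_smooth (phi : R -> R) : test_function L phi -> smooth phi.
Proof. by case. Qed.

Lemma Lfun2_test (phi : R -> R) : test_function L phi -> phi \in Lfun leb0L 2%:E.
Proof. by move=> /test_smooth/smooth_continuous; exact: Lfun2_continuous. Qed.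

Lemma testD (f g : R -> R) :
  test_function L f -> test_function L g -> test_function L (f + g).
Proof.
move=> [sf [a [b [a0 bL fab]]]] [sg [a' [b' [a'0 b'L gab]]]].
split; first exact: (smoothD sf sg).
exists (Num.min a a'), (Num.max b b'); split.
- by rewrite lt_min a0.
- by rewrite gt_max bL.
- move=> x; rewrite fctE => fg; rewrite ge_min le_max.
  have [fx|/fab/andP[-> ->]//] := eqVneq (f x) 0.
  have /gab/andP[-> ->] : g x != 0 by move: fg; rewrite fx add0r.
  by rewrite !orbT.
Qed.

Lemma testM (f g : R -> R) : smooth f -> test_function L g ->
  test_function L (f * g).
Proof.
move=> sf [sg [a [b [a0 bL gab]]]]; split; first exact: smoothM.
exists a, b; split => // x; rewrite fctE mulf_eq0 negb_or => /andP[_].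
exact: gab.
Qed.

Lemma test_deriv (f : R -> R) : test_function L f -> test_function L (f^`()%classic).
Proof.
move=> [sf [a [b [a0 bL fab]]]]; split; first exact: smooth_deriv.
exists a, b; split => // x; apply: contraNT; rewrite negb_and -!ltNge => xab.
suff df : is_derive x 1 f 0 by rewrite derive1E derive_val.
apply: (@near_eq_is_derive _ R^o R^o (cst 0)).
case/orP : xab => xab.
  near=> y; apply/eqP; rewrite eq_sym; apply: contraTT (_ : y < a).
    by move=> /fab/andP[ay _]; rewrite -leNgt.
  by near: y; exact: lt_nbhsl.
near=> y; apply/eqP; rewrite eq_sym; apply: contraTT (_ : b < y).
  by move=> /fab/andP[_ yb]; rewrite -leNgt.
by near: y; exact: lt_nbhsr.
Unshelve. all: by end_near. Qed.

Lemma L2classD f g : f \in Lfun leb0L 2%:E -> g \in Lfun leb0L 2%:E ->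
  cls (f + g) = cls f + cls g.
Proof.
move=> fL gL.
have mf : measurable_fun setT f by case/andP : fL => /set_mem.
have mg : measurable_fun setT g by case/andP : gL => /set_mem.
apply: L2class_eq; first exact: measurable_funD.
by apply: aeS3 (LrepD (cls f) (cls g)) (L2classE fL) (L2classE gL) => x -> -> ->.
Qed.

Lemma L2classZ c f : f \in Lfun leb0L 2%:E -> cls (cst c * f) = c *: cls f.
Proof.
move=> fL; have mf : measurable_fun setT f by case/andP : fL => /set_mem.
apply: L2class_eq; first exact: measurable_funM.
by apply: aeS2 (LrepZ c (cls f)) (L2classE fL) => x -> ->.
Qed.

Lemma Lfun2Z c f : f \in Lfun leb0L 2%:E -> cst c * f \in Lfun leb0L 2%:E.
Proof.
move=> fL; apply: (Lfun2_le _ (Lspace_Lfun (c *: cls f))).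
  by apply: measurable_funM => //; case/andP : fL => /set_mem.
apply: aeS2 (LrepZ c (cls f)) (L2classE fL) => x e1 e2.
by rewrite fctE -e2 -e1; exact: lexx.
Qed.

Lemma Lfun2D f g : f \in Lfun leb0L 2%:E -> g \in Lfun leb0L 2%:E ->
  f + g \in Lfun leb0L 2%:E.
Proof.
move=> fL gL; apply: (Lfun2_le _ (Lspace_Lfun (cls f + cls g))).
  by apply: measurable_funD; [case/andP : fL|case/andP : gL] => /set_mem.
apply: aeS3 (LrepD (cls f) (cls g)) (L2classE fL) (L2classE gL) => x e1 e2 e3.
by rewrite fctE -e2 -e3 -e1; exact: lexx.
Qed.

Lemma L2class_Lrep u : cls (Lrep u) = u.
Proof. by apply: L2class_eq; [exact: measurable_Lrep|exact: aeW]. Qed.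

Definition adherent (S : set (L2 L)) u :=
  forall e : R, 0 < e -> exists2 v, S v & `|u - v| < e.

Let T0 : set (L2 L) := [set u | exists2 phi, test_function L phi & u = cls phi].
Let T := adherent T0.

Let T_cvg (u_ : nat -> L2 L) u : (forall n, T (u_ n)) -> u_ n @[n --> \oo] --> u ->
  T u.
Proof.
move=> Tu /cvgrPdist_lt uu e e0; have e2 : 0 < e / 2 by rewrite divr_gt0.
have [n _ /(_ n (leqnn n)) un] := uu _ e2.
have [v T0v uv] := Tu n _ e2; exists v => //.
by rewrite -(subrKA (u_ n)) (splitr e) (le_lt_trans (ler_normD _ _))// ltrD.
Qed.

Let TD u v : T u -> T v -> T (u + v).
Proof.
move=> Tu Tv e e0; have e2 : 0 < e / 2 by rewrite divr_gt0.
have [_ [f tf ->] uf] := Tu _ e2; have [_ [g tg ->] vg] := Tv _ e2.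
exists (cls (f + g)); first by exists (f + g) => //; exact: testD.
rewrite L2classD ?Lfun2_test// opprD addrACA (splitr e).
by rewrite (le_lt_trans (ler_normD _ _))// ltrD.
Qed.

Let TZ c u : T u -> T (c *: u).
Proof.
move=> Tu e e0; have c0 : 0 < `|c| + 1 by rewrite ltr_wpDl.
have [_ [f tf ->] uf] := Tu _ (divr_gt0 e0 c0).
exists (cls (cst c * f)).
  by exists (cst c * f) => //; apply: testM => //; exact: smooth_cst.
rewrite L2classZ ?Lfun2_test// -scalerBr normrZ.
rewrite (@le_lt_trans _ _ ((`|c| + 1) * `|u - cls f|))//.
  by rewrite ler_wpM2r// lerDl.
by rewrite mulrC -ltr_pdivlMr.
Qed.

Let T_oo c d : 0 < c -> d < L -> T (cls \1_(`]c, d[)).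
Proof.
move=> c0 dL; have tb n : test_function L (sbump c d n).
  split; first exact: smooth_sbump.
  exists c, d; split => // x /sbump_supp /andP[/ltW -> /ltW ->//].
apply: (@T_cvg (fun n => cls (sbump c d n))).
  by move=> n e e0; exists (cls (sbump c d n)); [exists (sbump c d n)|rewrite subrr normr0].
apply: (L2_dct (g := cst 1)).
- by move=> n; apply: Lfun2_test.
- apply: (@Lfun2_bounded _ _ _ 1); first exact: measurable_indic.
  by move=> x _; rewrite indicE; case: (_ \in _); rewrite ?normr1 ?normr0.
- exact: Lfun2_cst.
- by apply: aeW => x; exact: sbump_cvg.
- by move=> n; apply: aeW => x; rewrite ger0_norm ?sbump_ge0// sbump_le1.
Qed.

Lemma Lfun2_indic (A : set (measurableTypeR R)) : measurable A ->
  \1_A \in Lfun leb0L 2%:E.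
Proof.
move=> mA; apply: (@Lfun2_bounded _ _ _ 1); first exact: measurable_indic.
by move=> x _; rewrite indicE; case: (_ \in _); rewrite ?normr1 ?normr0.
Qed.

Lemma eq_L2class f g : f \in Lfun leb0L 2%:E -> measurable_fun setT g ->
  {ae leb0L, forall x, f x = g x} -> cls f = cls g.
Proof.
move=> fL mg fg; apply/esym/L2class_eq => //.
by apply: aeS2 (L2classE fL) fg => x -> ->.
Qed.

Let T_oc a b : T (cls \1_(`]a, b])).
Proof.
(* The interval is cut to ]0, L[ and pulled in by 1 / (n + 1), as [T_oo] requires. The open
   intervals miss [b] in the limit, which is a null set. *)
pose c n : R := Num.max a 0 + n.+1%:R^-1; pose d n : R := Num.min b L - n.+1%:R^-1.
apply: (@T_cvg (fun n => cls \1_(`]c n, d n[))).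
  move=> n; apply: T_oo.
    by rewrite ltr_wpDl// le_max lexx orbT.
  by rewrite ltrBlDr (@le_lt_trans _ _ L)// ?ge_min ?lexx ?orbT// ltrDl.
apply: (L2_dct (g := cst 1)).
- by move=> n; exact: Lfun2_indic.
- exact: Lfun2_indic.
- exact: Lfun2_cst.
- apply/ae_leb0LP.
  have : {ae leb, forall x : R, x != b}.
    exists [set b]; split => //; first exact: lebesgue_measure_set1.
    by move=> x /= /negP; rewrite negbK => /eqP.
  apply: aeS => x xb; rewrite in_itv/= => /andP[x0 xL].
  rewrite indicE mem_setE in_itv/=.
  have [xab|xab] := boolP (a < x <= b).
    have cx : Num.max a 0 < x by rewrite gt_max x0; case/andP : xab => ->.
    have xd : x < Num.min b L.
      by rewrite lt_min xL andbT lt_neqAle xb; case/andP : xab.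
    have hc : \forall k \near \oo, (k.+1%:R^-1 : R) < x - Num.max a 0.
      have /cvgrPdist_lt/(_ (x - Num.max a 0)) := @cvg_harmonic R.
      rewrite subr_gt0 => /(_ cx); apply: filterS => k.
      by rewrite sub0r normrN ger0_norm ?invr_ge0.
    have hd : \forall k \near \oo, (k.+1%:R^-1 : R) < Num.min b L - x.
      have /cvgrPdist_lt/(_ (Num.min b L - x)) := @cvg_harmonic R.
      rewrite subr_gt0 => /(_ xd); apply: filterS => k.
      by rewrite sub0r normrN ger0_norm ?invr_ge0.
    apply: cvg_near_cst; near=> n; rewrite indicE mem_setE in_itv/=.
    suff -> : c n < x < d n by [].
    apply/andP; split.
      by rewrite /c -ltrBrDl; near: n; exact: hc.
    by rewrite /d ltrBrDr -ltrBrDl; near: n; exact: hd.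
  apply: cvg_near_cst; apply: nearW => n; rewrite indicE mem_setE in_itv/=.
  suff -> : (c n < x < d n) = false by [].
  apply/negP => /andP[cx xd]; move/negP : xab; apply.
  have n0 : (0 : R) < n.+1%:R^-1 by rewrite invr_gt0.
  have ac : a < c n by rewrite (@le_lt_trans _ _ (Num.max a 0)) ?le_max ?lexx// ltrDl.
  have db : d n < b by rewrite ltrBlDr (@le_lt_trans _ _ b) ?ge_min ?lexx// ltrDl.
  by rewrite (lt_trans ac cx)/= (ltW (lt_trans xd db)).
- move=> n; apply: aeW => x; rewrite indicE.
  by case: (_ \in _); rewrite ?normr1 ?normr0.
Unshelve. all: by end_near. Qed.

Let T_indicT : T (cls \1_setT).
Proof.
rewrite -(@eq_L2class \1_(`]-1, L])); first exact: T_oc.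
- exact: Lfun2_indic.
- exact: measurable_indic.
- apply/ae_leb0LP; apply: aeW => x; rewrite in_itv/= => /andP[x0 xL].
  rewrite indicT indicE mem_setE in_itv/= (ltW xL).
  by rewrite (lt_trans _ x0)// ltrN10.
Qed.

(** Half-open intervals are stable under intersection and generate the measurable sets, so by
    Dynkin's theorem complements and disjoint unions suffice. *)
Let T_indic (A : set (measurableTypeR R)) : measurable A -> T (cls \1_A).
Proof.
apply: (@dynkin_induction _ (measurableTypeR R) (@ocitv R)
  (fun A => T (cls \1_A))) => //.
- exact: ocitvI.
- by move=> _ [x _ <-]; exact: T_oc.
- move=> B mB TB.
  have -> : \1_(~` B) = \1_setT + cst (-1) * \1_B :> (measurableTypeR R -> R).
    apply/funext => x; rewrite !fctE indicT !indicE in_setC.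
    by case: (x \in B) => /=; rewrite ?mulr1 ?mulr0 ?addr0// subrr.
  rewrite L2classD ?L2classZ ?Lfun2Z ?Lfun2_indic//.
  by apply: TD => //; exact: TZ.
- move=> F mF tF TF; pose B n := \big[setU/set0]_(k < n) F k.
  have mB n : measurable (B n) by apply: bigsetU_measurable.
  apply: (@T_cvg (fun n => cls \1_(B n))).
    elim => [|n IH].
      rewrite /B big_ord0 indic0 (_ : cst 0 = cst 0 * \1_setT).
        by rewrite L2classZ ?Lfun2_indic//; exact: TZ.
      by apply/funext => x; rewrite !fctE mul0r.
    have -> : \1_(B n.+1) = \1_(B n) + \1_(F n) :> (measurableTypeR R -> R).
      apply/funext => x; rewrite /B big_ord_recr/= fctE -/(B n) !indicE in_setU.
      have [xB|] := boolP (x \in B n); last by rewrite /= add0r.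
      rewrite memNset ?addr0//= => Fx; move/set_mem : xB.
      rewrite /B -bigcup_mkord => -[k /= kn Fk].
      have := tF k n Logic.I Logic.I (ex_intro _ x (conj Fk Fx)).
      by move=> kE; rewrite kE ltnn in kn.
    by rewrite L2classD ?Lfun2_indic//; exact: TD.
  apply: (L2_dct (g := cst 1)).
  + by move=> n; exact: Lfun2_indic.
  + by apply: Lfun2_indic; exact: bigcup_measurable.
  + exact: Lfun2_cst.
  + apply: aeW => x; apply: cvg_near_cst; rewrite !indicE.
    have [[k _ Fk]|nF] := pselect ((\bigcup_k F k) x).
      exists k.+1 => // n /= kn; have Bx : B n x.
        by rewrite /B -bigcup_mkord; exists k.
      have Ux : (\bigcup_k F k) x by exists k.
      by rewrite !indicE !mem_set.
    apply: nearW => n; rewrite !indicE !memNset//.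
    by rewrite /B -bigcup_mkord => -[k _ Fk]; apply: nF; exists k.
  + move=> n; apply: aeW => x; rewrite indicE.
    by case: (_ \in _); rewrite ?normr1 ?normr0.
Qed.

Let T_simple (s : measurableTypeR R -> R) : simple s -> T (cls s).
Proof.
move=> ss; have [fs ms] := ss.
have -> : s = fun x =>
    \sum_(v <- fset_set (range s)) v * \1_(s @^-1` [set v]) x.
  by apply/funext => x; rewrite -(simple_fun_sum id).
suff : forall r : seq R, T (cls (fun x => \sum_(v <- r) v * \1_(s @^-1` [set v]) x))
  /\ (fun x => \sum_(v <- r) v * \1_(s @^-1` [set v]) x) \in Lfun leb0L 2%:E.
  by move=> /(_ (fset_set (range s)))[].
have mi (v : R) : \1_(s @^-1` [set v]) \in Lfun leb0L 2%:E.
  by apply: Lfun2_indic; exact: ms.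
elim=> [|v r [Tr rL]].
  have -> : (fun x => \sum_(v <- [::]) v * \1_(s @^-1` [set v]) x) = cst 0 * cst 1.
    by apply/funext => x; rewrite big_nil !fctE mul0r.
  split; last by apply: Lfun2Z; exact: Lfun2_cst.
  rewrite L2classZ ?scale0r ?Lfun2_cst//.
  by rewrite -(scale0r (cls \1_setT)); exact: TZ.
have -> : (fun x => \sum_(v <- v :: r) v * \1_(s @^-1` [set v]) x) =
    cst v * \1_(s @^-1` [set v]) +
    (fun x => \sum_(v <- r) v * \1_(s @^-1` [set v]) x).
  by apply/funext => x; rewrite big_cons !fctE.
split; last by apply: Lfun2D => //; exact: Lfun2Z.
rewrite L2classD ?Lfun2Z// L2classZ//.
by apply: TD => //; apply: TZ; apply: T_indic; exact: ms.
Qed.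

Import HBSimple HBNNSimple.

Let T_ge0 f : f \in Lfun leb0L 2%:E -> (forall x, 0 <= f x) -> T (cls f).
Proof.
move=> fL f0; have mf : measurable_fun setT f by case/andP : fL => /set_mem.
have mEf : measurable_fun setT (EFin \o f) by exact/measurable_EFinP.
pose g := nnsfun_approx measurableT mEf.
have fE0 : forall x, setT x -> (0 <= (EFin \o f) x)%E by move=> x _; rewrite lee_fin.
have gf n x : g n x <= f x.
  by rewrite -lee_fin /g nnsfun_approxE; exact: le_approx.
have gL n : (g n : measurableTypeR R -> R) \in Lfun leb0L 2%:E.
  apply: (Lfun2_le _ fL); first exact: measurable_funPT.
  by apply: aeW => x; rewrite !ger0_norm.
apply: (@T_cvg (fun n => cls (g n))).
  move=> n; apply: T_simple; split; first exact: (@fimfunP _ _ (g n)).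
  move=> v; rewrite -[X in measurable X]setTI.
  by apply: (measurable_funPT (g n)) => //; exact: measurable_set1.
apply: (L2_dct (g := f)) => //.
- apply: aeW => x; have := cvg_nnsfun_approx measurableT mEf fE0 (Logic.I : setT x).
  by move=> /fine_cvg.
- by move=> n; apply: aeW => x; rewrite ger0_norm.
Qed.

(** Density as an induction principle: a sequentially closed property of L^2 functions need only be
    checked on test functions. Integration by parts, the cubic identity and the weak form of the
    semigroup all follow this scheme. *)
Lemma L2_test_ind (S : set (L2 L)) :
  (forall phi, test_function L phi -> S (cls phi)) ->
  (forall (u_ : nat -> L2 L) u, (forall n, S (u_ n)) ->
    u_ n @[n --> \oo] --> u -> S u) ->
  forall u, S u.
Proof.
move=> Stest Scvg u.
have Tu : T u.
  have mu := @measurable_Lrep _ _ u.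
  have mp : measurable_fun setT (fun x => Num.max (Lrep u x) 0).
    exact: measurable_maxr.
  have mn : measurable_fun setT (fun x => Num.max (- Lrep u x) 0).
    by apply: measurable_maxr => //; exact: measurableT_comp.
  have pL : (fun x => Num.max (Lrep u x) 0) \in Lfun leb0L 2%:E.
    apply: (Lfun2_le mp (Lspace_Lfun u)); apply: aeW => x.
    rewrite ger0_norm ?le_max ?lexx ?orbT// ge_max normr_ge0 andbT.
    exact: ler_norm.
  have nL : (fun x => Num.max (- Lrep u x) 0) \in Lfun leb0L 2%:E.
    apply: (Lfun2_le mn (Lspace_Lfun u)); apply: aeW => x.
    rewrite ger0_norm ?le_max ?lexx ?orbT// ge_max normr_ge0 andbT.
    by rewrite -normrN; exact: ler_norm.
  have -> : u = cls (fun x => Num.max (Lrep u x) 0) +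
      (-1) *: cls (fun x => Num.max (- Lrep u x) 0).
    rewrite -L2classZ// -L2classD ?Lfun2Z// -[LHS]L2class_Lrep; congr cls.
    apply/funext => x; rewrite !fctE mulN1r.
    have [u0|u0] := leP (Lrep u x) 0.
      by rewrite (elimT max_idPl) ?opprK ?add0r// oppr_ge0.
    by rewrite (elimT max_idPr) ?subr0// oppr_le0 ltW.
  apply: TD; [|apply: TZ]; apply: T_ge0 => // x.
    by rewrite le_max lexx orbT.
  by rewrite le_max lexx orbT.
have /choice[u_ uu] : forall n : nat, exists v, T0 v /\ `|u - v| < n.+1%:R^-1.
  move=> n; have [|v T0v uv] := Tu n.+1%:R^-1; first by rewrite invr_gt0.
  by exists v.
apply: (Scvg u_).
  by move=> n; have [[phi tphi ->] _] := uu n; exact: Stest.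
apply/cvgrPdist_lt => e e0.
have /cvgrPdist_lt/(_ e e0) := @cvg_harmonic R; apply: filterS => n.
rewrite sub0r normrN ger0_norm ?invr_ge0// => ne.
by have [_ uv] := uu n; rewrite (lt_trans uv).
Qed.

End density.

(** * Weak derivatives and traces *)

Section sobolev.
Context (R : realType).
Local Notation leb := (@lebesgue_measure R).

Lemma cvg_cst_uniq (f : nat -> R) (a b : R) : (forall n, f n = a) ->
  f n @[n --> \oo] --> b -> b = a.
Proof.
move=> fa fb; rewrite -(cvg_lim _ fb)//; apply: lim_near_cst => //.
exact: nearW.
Qed.

Lemma ae_neq (b : R) : {ae leb, forall x : R, x != b}.
Proof.
exists [set b]; split => //; first exact: lebesgue_measure_set1.
by move=> x /= /negP; rewrite negbK => /eqP.
Qed.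

Lemma has_int_FTC (F f : R -> R) a b : a < b ->
  (forall x, is_derive x (1 : R) F (f x)) -> continuous f ->
  has_int leb `[a, b] f (F b - F a).
Proof.
move=> ab Ff cf.
have cF : continuous F.
  move=> x; apply: differentiable_continuous; apply/derivable1_diffP.
  by case: (Ff x).
exists f; split; last first.
- rewrite EFinB; apply: continuous_FTC2 => //.
  + exact: continuous_subspaceT.
  + split=> [x _| |]; first by case: (Ff x).
      by apply: cvg_at_right_filter; exact: cF.
    by apply: cvg_at_left_filter; exact: cF.
  + by move=> x _; rewrite derive1E derive_val.
- exact: aeW.
- apply: continuous_compact_integrable; first exact: segment_compact.
  exact: continuous_subspaceT.
Qed.

(** End points are null sets, so the type of the interval is irrelevant. *)
Lemma has_int_itv (f : R -> R) a b (s t s' t' : bool) c :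
  has_int leb [set` Interval (BSide s a) (BSide t b)] f c ->
  has_int leb [set` Interval (BSide s' a) (BSide t' b)] f c.
Proof.
apply: has_int_ae_set => //.
apply: aeS2 (ae_neq a) (ae_neq b) => x xa xb /=.
have E p q : x \in Interval (BSide p a) (BSide q b) = (a < x < b).
  by case: p; case: q; rewrite in_itv/= ?(le_eqVlt a) ?(le_eqVlt x) ?[a == x]eq_sym
    ?(negbTE xa) ?(negbTE xb).
by rewrite !E.
Qed.


Context (L : R).
Local Notation leb0L := (leb0L L).
Local Notation cls := (L2class L).
Implicit Types (u v w : L2 L) (c : R).

Lemma ip_cvg v (u_ : nat -> L2 L) u : u_ n @[n --> \oo] --> u ->
  ip v (u_ n) @[n --> \oo] --> ip v u.
Proof.
move=> /cvg_distP uu; apply/cvg_distP.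
have : `|v| * `|u - u_ n| @[n --> \oo] --> (0 : R).
  by rewrite -[X in _ --> X](mulr0 `|v|); apply: cvgM => //; exact: cvg_cst.
apply: squeeze_cvgr; last exact: cvg_cst.
by apply: nearW => n; rewrite normr_ge0/= -ipBr ip_cauchy.
Qed.

Lemma ip_eq0 u : ip u u = 0 -> u = 0.
Proof. by rewrite ip_norm => /eqP; rewrite sqrf_eq0 normr_eq0 => /eqP. Qed.

Lemma test_orth u : (forall phi, test_function L phi -> ip u (cls phi) = 0) ->
  u = 0.
Proof.
move=> uphi; apply: ip_eq0; move: u uphi => u uphi.
suff : forall w, ip u w = 0 by [].
apply: (@L2_test_ind _ _ (fun w => ip u w = 0)) => // w_ w w0 ww.
exact: (cvg_cst_uniq w0 (ip_cvg ww)).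
Qed.

Lemma ip_cls u (f : R -> R) : f \in Lfun leb0L 2%:E ->
  \int[leb0L]_x (Lrep u x * f x) = ip u (cls f).
Proof.
move=> fL; apply: has_int_Rintegral => //.
  by apply: has_int_ae (ip_leb0L u (cls f)); apply: aeS (L2classE fL) => x ->.
apply: measurable_funM; first exact: measurable_Lrep.
by case/andP : fL => /set_mem.
Qed.

Lemma weak_derivativeP u v : weak_derivative u v <->
  forall phi, test_function L phi ->
    ip u (cls (phi^`()%classic)) = - ip v (cls phi).
Proof.
split=> H phi tphi; have := H phi tphi;
  by rewrite !ip_cls ?Lfun2_test//; exact: test_deriv.
Qed.

Lemma weak_derivative_uniq u v w : weak_derivative u v -> weak_derivative u w ->
  v = w.
Proof.
move=> /weak_derivativeP uv /weak_derivativeP uw; apply/eqP.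
rewrite -subr_eq0; apply/eqP/test_orth => phi tphi.
by rewrite ipBl; apply/eqP; rewrite subr_eq0 -eqr_opp -uv// uw.
Qed.

(** Uniqueness makes the choice in [wderiv] the right one. *)
Lemma wderivE u v : weak_derivative u v -> wderiv u = v.
Proof.
move=> uv; apply: (weak_derivative_uniq _ uv).
by rewrite /wderiv; case: xgetP => [w -> //|/(_ v)].
Qed.

Lemma sobolev1P u : sobolev 1 u -> weak_derivative u (wderiv u).
Proof. by move=> /(_ 0%N isT)[v /= uv]; rewrite (wderivE uv). Qed.

Lemma weak_sobolev1 u v : weak_derivative u v -> sobolev 1 u.
Proof. by move=> uv [|//] _; exists v. Qed.

Lemma weak_derivativeB u v u' v' : weak_derivative u u' -> weak_derivative v v' ->
  weak_derivative (u - v) (u' - v').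
Proof.
move=> /weak_derivativeP uu' /weak_derivativeP vv'.
by apply/weak_derivativeP => phi tphi; rewrite !ipBl uu'// vv'// opprB opprK addrC.
Qed.

Lemma wderivB u v : sobolev 1 u -> sobolev 1 v ->
  wderiv (u - v) = wderiv u - wderiv v.
Proof. by move=> /sobolev1P u1 /sobolev1P v1; apply/wderivE/weak_derivativeB. Qed.

End sobolev.

(** * Primitives of L^2 functions *)

Section primitive.
Context (R : realType) (L : R).
Hypothesis L0 : 0 < L.
Local Notation leb := (@lebesgue_measure R).
Local Notation leb0L := (leb0L L).
Local Notation cls := (L2class L).
Implicit Types (u v w : L2 L) (c : R) (f g : R -> R).

Lemma normC_le u v : {ae leb0L, forall x, `|Lrep u x| <= `|Lrep v x|} ->
  `|u| <= `|v|.
Proof.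
move=> uv; rewrite -ler_sqr ?nnegrE// -!ip_norm.
apply: (has_int_le (ip_leb0L u u) (ip_leb0L v v)) => //.
apply: aeS uv => x uv _; rewrite -!expr2 -[leLHS]real_normK ?num_real//.
by rewrite -[leRHS]real_normK ?num_real// ler_sqr ?nnegrE.
Qed.

Definition L2one : L2 L := cls (cst 1).

Lemma L2one_rep : {ae leb0L, forall x, Lrep L2one x = 1}.
Proof. by have := L2classE (Lfun2_cst L 1); apply: aeS => x ->. Qed.

Lemma norm_cls_le f c : f \in Lfun leb0L 2%:E ->
  (forall x, x \in `]0, L[ -> `|f x| <= c) -> `|cls f| <= c * `|L2one|.
Proof.
move=> fL fc; have c0 : 0 <= c.
  have h : (L / 2) \in `]0, L[.
    by rewrite in_itv/= divr_gt0//= ltr_pdivrMr// ltr_pMr// ltr1n.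
  exact: le_trans (fc _ h).
rewrite -[c]ger0_norm// -normrZ; apply: normC_le.
have fc' : {ae leb0L, forall x, `|f x| <= c}.
  by apply/ae_leb0LP; apply: aeW => x; exact: fc.
have f1 : {ae leb0L, forall x, Lrep (c *: L2one) x = c}.
  by apply: aeS2 (LrepZ c L2one) L2one_rep => x -> ->; rewrite mulr1.
by apply: aeS3 (L2classE fL) fc' f1 => x -> h ->; rewrite (ger0_norm c0).
Qed.

Lemma itvL (x y : R) : x <= y -> leb `]x, y] = (y - x)%:E.
Proof.
move=> xy; rewrite lebesgue_measure_itv/= lte_fin.
case: ltP => [_|yx]; first by rewrite EFinB.
by have -> : x = y by [apply/le_anti; rewrite xy]; rewrite subrr.
Qed.

(* [x |-> chi x] is continuous into L^2, so primitives are inner products. *)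
Definition chi (x : R) : L2 L := cls \1_(`]0, x]).

Lemma chi_rep x : {ae leb0L, forall t, Lrep (chi x) t = \1_(`]0, x]) t}.
Proof. by apply: L2classE; exact: Lfun2_indic. Qed.

(** The left-hand side is the measure of the part of the interval between x and y that lies in ]0,
    L[. Primitives of L^2 functions are thus Hölder continuous of exponent 1/2. *)
Lemma chi_dist x y : `|chi y - chi x| ^+ 2 <= `|y - x|.
Proof.
wlog xy : x y / x <= y.
  move=> H; have [/H//|/ltW/H] := leP x y.
  by rewrite distrC [leRHS]distrC.
rewrite (ger0_norm (_ : 0 <= y - x)) ?subr_ge0// -ip_norm.
have E : {ae leb0L, forall t, Lrep (chi y - chi x) t =
    \1_(`]0, y]) t - \1_(`]0, x]) t}.
  by apply: aeS3 (LrepB (chi y) (chi x)) (chi_rep y) (chi_rep x) => t -> -> ->.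
have H := ip_int E E.
have fin : (leb `]0%R, L[ < +oo)%E by rewrite lebesgue_measure_itv/= lte_fin L0 ltry.
have I := has_int_indic (mu := leb) (measurable_itv `]0%R, L[) fin
  (measurable_itv `]x, y]).
apply: le_trans (has_int_le H I (measurable_itv _) _) _.
  apply: aeW => t; rewrite /= in_itv/= => /andP[t0 tL].
  rewrite !indicE !mem_setE !in_itv/= t0/=.
  have [tx|xt] := leP t x; first by rewrite (le_trans tx xy)/= subrr mul0r.
  by rewrite subr0/=; case: (t <= y); rewrite ?mul0r ?mulr1.
rewrite -lee_fin fineK; last first.
  rewrite ge0_fin_numE//; apply: le_lt_trans fin.
  by apply: le_measure; [apply: mem_set; exact: measurableI|exact: mem_set|].
rewrite -itvL//.
by apply: le_measure; [apply: mem_set; exact: measurableI|exact: mem_set|].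
Qed.

Lemma chi_eq x f : measurable_fun setT (f : measurableTypeR R -> R) ->
  (forall t, t \in `]0, L[ -> \1_(`]0, x]) t = f t) -> chi x = cls f.
Proof.
move=> mf xf; apply: eq_L2class => //; first exact: Lfun2_indic.
by apply/ae_leb0LP; apply: aeW => t; exact: xf.
Qed.

Lemma chi0 : chi 0 = 0.
Proof.
rewrite (@chi_eq _ (cst 0)) => [||t]; last 2 first.
- exact: measurable_cst.
- by rewrite in_itv/= indicE mem_setE in_itv/= => /andP[t0 _]; rewrite leNgt t0 andbF.
rewrite (_ : cst 0 = cst 0 * cst 1); last by apply/funext => t; rewrite !fctE mul0r.
by rewrite L2classZ ?scale0r// Lfun2_cst.
Qed.

Lemma chiL : chi L = L2one.
Proof.
apply: chi_eq => [|t]; first exact: measurable_cst.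
by rewrite in_itv/= indicE mem_setE in_itv/= => /andP[-> /ltW ->].
Qed.

Lemma norm_L2one : `|L2one| ^+ 2 = L.
Proof.
have I := ip_int L2one_rep L2one_rep.
have fin : (leb `]0%R, L[ < +oo)%E by rewrite lebesgue_measure_itv/= lte_fin L0 ltry.
have C := has_int_const (mu := leb) 1 (measurable_itv `]0%R, L[) fin.
have E : ip L2one L2one = 1 * fine (leb `]0%R, L[).
  by apply: (has_int_uniq I) => //; apply: has_int_eq C => t _; rewrite mulr1.
by rewrite -ip_norm E mul1r lebesgue_measure_itv/= lte_fin L0/= subr0.
Qed.

Lemma chi_norm x : x \in `[0, L] -> `|chi x| <= `|L2one|.
Proof.
rewrite in_itv/= => /andP[x0 xL].
rewrite -ler_sqr ?nnegrE// norm_L2one -[chi x]subr0 -chi0.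
by apply: le_trans (chi_dist 0 x) _; rewrite subr0 ger0_norm.
Qed.

Definition prim u (x : R) : R := ip u (chi x).

Lemma prim0 u : prim u 0 = 0.
Proof. by rewrite /prim chi0 linear0. Qed.

Lemma primL u : prim u L = ip u L2one.
Proof. by rewrite /prim chiL. Qed.

Lemma prim_le u x : x \in `[0, L] -> `|prim u x| <= `|u| * `|L2one|.
Proof.
by move=> x0L; rewrite (le_trans (ip_cauchy _ _))// ler_wpM2l// chi_norm.
Qed.

Lemma primB u v x : prim (u - v) x = prim u x - prim v x.
Proof. exact: ipBl. Qed.

Lemma prim_continuous u : continuous (prim u).
Proof.
move=> x; apply/cvgrPdist_le => e e0.
have d0 : 0 < (e / (`|u| + 1)) ^+ 2 by rewrite exprn_gt0// divr_gt0// ltr_wpDl.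
near=> y; rewrite /prim -ipBr (le_trans (ip_cauchy _ _))//.
have : `|chi x - chi y| <= e / (`|u| + 1).
  rewrite -ler_sqr ?nnegrE//; last by rewrite divr_ge0// ?ltW// ltr_wpDl.
  apply: le_trans (chi_dist y x) _.
  near: y; exact: cvgr_dist_le.
rewrite ler_pdivlMr ?ltr_wpDl//; apply: le_trans.
by rewrite mulrC ler_wpM2l// lerDl.
Unshelve. all: by end_near. Qed.

Lemma prim_cls f F x : x \in `[0, L] ->
  (forall t, is_derive t (1 : R) F (f t)) -> continuous f ->
  prim (cls f) x = F x - F 0.
Proof.
rewrite in_itv/= => /andP[]; rewrite le_eqVlt => /predU1P[<- _ _ _|x0 xL Ff cf].
  by rewrite prim0 subrr.
have H := ip_int (L2classE (Lfun2_continuous L cf)) (chi_rep x).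
apply: (has_int_uniq H) => //; move: (has_int_FTC x0 Ff cf).
move=> /(has_int_setT leb _ _ (measurable_itv _)) h.
apply/has_int_setT => //; apply: has_int_ae h.
apply: aeS3 (ae_neq 0) (ae_neq x) (ae_neq L) => t t0 tx tL _ /=.
rewrite -mulrA !indicE !mem_setE !in_itv/= -natrM mulnb; congr (_ * _%:R).
rewrite le_eqVlt eq_sym (negbTE t0)/=; have [t0'|] := ltP 0 t => //=.
have [tx'|//] := leP t x => /=.
by rewrite (@lt_le_trans _ _ x)// lt_neqAle tx.
Qed.

Lemma has_int_derive f F : (forall t, is_derive t (1 : R) F (f t)) -> continuous f ->
  has_int leb `]0, L[ f (F L - F 0).
Proof.
by move=> Ff cf; apply: has_int_itv; exact: (has_int_FTC L0 Ff cf).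
Qed.

Definition primC u : L2 L := cls (prim u).

Lemma primC_rep u : {ae leb0L, forall x, Lrep (primC u) x = prim u x}.
Proof. by apply: L2classE; apply: Lfun2_continuous; exact: prim_continuous. Qed.

Lemma primCB u v : primC (u - v) = primC u - primC v.
Proof.
have E : {ae leb0L, forall x, Lrep (primC u - primC v) x = prim u x - prim v x}.
  by apply: aeS3 (LrepB (primC u) (primC v)) (primC_rep u) (primC_rep v)
    => x -> -> ->.
by apply: L2_ext; apply: aeS2 (primC_rep (u - v)) E => x -> ->; rewrite primB.
Qed.

Lemma primC_norm u : `|primC u| <= `|u| * `|L2one| * `|L2one|.
Proof.
apply: norm_cls_le => [|x xL].
  by apply: Lfun2_continuous; exact: prim_continuous.
by apply: prim_le; exact: subset_itv_oo_cc.
Qed.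

Lemma primC_cvg (u_ : nat -> L2 L) u : u_ n @[n --> \oo] --> u ->
  primC (u_ n) @[n --> \oo] --> primC u.
Proof.
move=> /cvg_distP uu; apply/cvg_distP.
have : `|u - u_ n| * `|L2one| * `|L2one| @[n --> \oo] --> (0 : R).
  rewrite -[X in _ --> X](mul0r `|L2one|) -[X in X * _](mul0r `|L2one|).
  by do 2 (apply: cvgM => //; last exact: cvg_cst).
apply: squeeze_cvgr; last exact: cvg_cst.
by apply: nearW => n; rewrite normr_ge0/= -primCB primC_norm.
Qed.

Lemma prim_cvg (u_ : nat -> L2 L) u x : u_ n @[n --> \oo] --> u ->
  prim (u_ n) x @[n --> \oo] --> prim u x.
Proof.
move=> uu; rewrite /prim ipC (_ : (fun n => _) = fun n => ip (chi x) (u_ n)).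
  exact: ip_cvg.
by apply/funext => n; rewrite ipC.
Qed.

Lemma test_prim phi : test_function L phi -> exists F C, [/\
  forall x, is_derive x (1 : R) F (phi x),
  forall a, (forall x, phi x != 0 -> a <= x) -> forall x, x < a -> F x = 0 &
  forall b, (forall x, phi x != 0 -> x <= b) -> forall x, b <= x -> F x = C].
Proof.
move=> tphi; have [sphi [a [b [a0 bL phiab]]]] := tphi.
have cphi := smooth_continuous sphi.
have phi_int : leb.-integrable setT (EFin \o phi).
  have -> : phi = phi \_ `[a, b].
    apply/funext => x; rewrite patchE mem_setE in_itv/=.
    case: ifPn => // /negP nab; apply/eqP/negPn/negP => /phiab //.
  have iab : leb.-integrable `[a, b] (EFin \o phi).
    apply: continuous_compact_integrable; first exact: segment_compact.
    exact: continuous_subspaceT.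
  rewrite -restrict_EFin.
  have H := (integrable_mkcond (mu := leb) (EFin \o phi) (measurable_itv `[a, b])).1 iab.
  exact: H.
exists (fun x => \int[leb]_(t in `]-oo, x]) phi t), (\int[leb]_t phi t); split.
- move=> x.
  have xx : x < x + 1 by rewrite ltrDl.
  have i1 : leb.-integrable `]-oo, (x + 1)] (EFin \o phi).
    exact: integrableS phi_int.
  have [d1 d2] := continuous_FTC1 xx i1 (ltNyr _) (cphi x).
  by apply: (DeriveDef d1); rewrite -derive1E.
- move=> a' pa x xa; rewrite (@eq_Rintegral _ _ _ _ _ (cst 0)).
    by rewrite Rintegral_cst// mul0r.
  move=> t; rewrite mem_setE in_itv/= => tx; apply/eqP/negPn/negP => /pa.
  by rewrite leNgt (le_lt_trans tx xa).
- move=> b' pb x bx; rewrite Rintegral_mkcond; apply: eq_Rintegral => t _.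
  rewrite patchE mem_setE in_itv/=; case: ifPn => // tx.
  apply/esym/eqP/negPn/negP => /pb tb; move/negP : tx; apply.
  exact: le_trans tb bx.
Qed.

End primitive.

(** * Continuous representatives of H^1 functions *)

Section sobolev_rep.
Context (R : realType) (L : R).
Hypothesis L0 : 0 < L.
Local Notation leb := (@lebesgue_measure R).
Local Notation leb0L := (leb0L L).
Local Notation cls := (L2class L).
Local Notation L2one := (@L2one R L).
Implicit Types (u v w : L2 L) (c : R) (f g : R -> R).

Lemma cls_continuous f : continuous f -> {ae leb0L, forall x, Lrep (cls f) x = f x}.
Proof. by move=> cf; apply: L2classE; exact: Lfun2_continuous. Qed.

Lemma test0 phi : test_function L phi -> phi 0 = 0.
Proof.
move=> [_ [a [b [a0 bL H]]]]; apply/eqP/negPn/negP => /H/andP[].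
by rewrite leNgt a0.
Qed.

Lemma testL phi : test_function L phi -> phi L = 0.
Proof.
move=> [_ [a [b [a0 bL H]]]]; apply/eqP/negPn/negP => /H/andP[_].
by rewrite leNgt bL.
Qed.

Lemma test_prim_int phi : test_function L phi -> exists F,
  [/\ forall x, is_derive x (1 : R) F (phi x), F 0 = 0 &
   ip (cls phi) L2one = 0 -> test_function L F].
Proof.
move=> tphi; have [F [C [dF F0 FC]]] := test_prim tphi.
have [sphi [a [b [a0 bL H]]]] := tphi.
have Fa x : x < a -> F x = 0 by apply: F0 => y /H/andP[].
have Fb x : b <= x -> F x = C by apply: FC => y /H/andP[].
exists F; split; [exact: dF|exact: Fa|].
have -> : ip (cls phi) L2one = F L.
  rewrite -primL (@prim_cls _ _ phi F) ?(Fa 0 a0) ?subr0//.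
    by rewrite in_itv/= lexx ltW.
  exact: smooth_continuous.
rewrite Fb ?ltW// => C0; split; first exact: (smoothI dF sphi).
exists a, b; split => // x Fx; apply/andP; split; rewrite leNgt; apply/negP => h.
  by rewrite Fa ?eqxx in Fx.
by rewrite (Fb _ (ltW h)) C0 eqxx in Fx.
Qed.

(** A test function of mean zero is the derivative of a test function. Subtracting from any [psi]
    the multiple of a fixed [p0] with the same mean thus gives a function orthogonal to [u], so that
    [u] pairs with [psi] as a constant does. *)
Lemma du_bois_reymond u :
  (forall phi, test_function L phi -> ip u (cls phi^`()%classic) = 0) ->
  u = (ip u L2one / L) *: L2one.
Proof.
move=> u0.
(* Otherwise the constant 1 would be orthogonal to all test functions, hence zero. *)
have [p0 [tp0 p1]] : exists p0, test_function L p0 /\ ip (cls p0) L2one != 0.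
  apply: contrapT => no.
  have : L2one = 0.
    apply: test_orth => phi tphi; apply: contrapT => /eqP h; apply: no.
    by exists phi; rewrite ipC.
  by move/(congr1 (fun v => `|v| ^+ 2)); rewrite norm_L2one// normr0 expr0n/=;
    apply/eqP; rewrite gt_eqF.
pose c := ip u (cls p0) / ip (cls p0) L2one.
suff uc : u = c *: L2one.
  by rewrite {2}uc ipZl ip_norm norm_L2one// mulfK ?gt_eqF.
apply/eqP; rewrite -subr_eq0; apply/eqP; apply: test_orth => psi tpsi.
pose k := ip (cls psi) L2one / ip (cls p0) L2one.
pose x := psi + cst (- k) * p0.
have tk : test_function L (cst (- k) * p0).
  by apply: testM => //; exact: smooth_cst.
have tx : test_function L x by exact: testD.
have xE : cls x = cls psi - k *: cls p0.
  by rewrite L2classD ?L2classZ ?scaleNr ?Lfun2_test.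
have [F [dF _]] := test_prim_int tx.
rewrite xE ipBl ipZl divfK// subrr => /(_ erefl) tF.
have := u0 _ tF; rewrite (is_derive1E dF) xE ipBr ipZr => /eqP.
rewrite subr_eq0 => /eqP upsi.
rewrite ipBl upsi ipZl [ip L2one _]ipC /k /c.
by field.
Qed.

Lemma prim_is_derive (v : L2 L) phi F : test_function L phi -> v = cls phi ->
  (forall x, is_derive x (1 : R) F (phi x)) -> F 0 = 0 ->
  {ae leb0L, forall x, Lrep (primC v) x = F x} /\ prim v L = F L.
Proof.
move=> tphi -> dF F0; have cphi := smooth_continuous (test_smooth tphi).
have E x : x \in `[0, L] -> prim (cls phi) x = F x.
  by move=> xL; rewrite (prim_cls xL dF cphi) F0 subr0.
split; last by apply: E; rewrite in_itv/= lexx ltW.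
have H : {ae leb0L, forall x, prim (cls phi) x = F x}.
  by apply/ae_leb0LP; apply: aeW => x xL; apply: E; exact: subset_itv_oo_cc.
by apply: aeS2 (primC_rep L0 (cls phi)) H => x -> ->.
Qed.

Lemma is_derive_continuous (F f : R -> R) :
  (forall x, is_derive x (1 : R) F (f x)) -> continuous F.
Proof.
move=> dF x; apply: differentiable_continuous; apply/derivable1_diffP.
by case: (dF x).
Qed.

(** All terms are continuous in [v] for the L^2 norm, so [v] may be taken to be a test function,
    whose primitive is a classical one. *)
Lemma prim_ibp v phi phi' : (forall x, is_derive x (1 : R) phi (phi' x)) ->
  continuous phi' ->
  ip v (cls phi) + ip (primC v) (cls phi') = prim v L * phi L.
Proof.
move=> dphi cphi'; have cphi := is_derive_continuous dphi.
apply: (@L2_test_ind _ _ (fun v =>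
  ip v (cls phi) + ip (primC v) (cls phi') = prim v L * phi L)) => [f tf|v_ {}v vn vv].
  have [F [dF F0 _]] := test_prim_int tf.
  have [PF ->] := prim_is_derive tf erefl dF F0.
  have cf := smooth_continuous (test_smooth tf).
  have cF := is_derive_continuous dF.
  have I1 := ip_int (cls_continuous cf) (cls_continuous cphi).
  have I2 := ip_int PF (cls_continuous cphi').
  apply: (has_int_uniq (has_intD I1 I2 (measurable_itv _))) => //.
  have dFp x : is_derive x (1 : R) (F * phi) (f x * phi x + F x * phi' x).
    have := is_deriveM (dF x) (dphi x); move/is_derive_ext; apply => //.
    by rewrite /GRing.scale/= addrC mulrC.
  have := has_int_derive L0 dFp; rewrite !fctE F0 mul0r subr0; apply.
  by move=> x; apply: cvgD; apply: cvgM;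
    [exact: cf|exact: cphi|exact: cF|exact: cphi'].
have l1 : ip (v_ n) (cls phi) + ip (primC (v_ n)) (cls phi') - prim (v_ n) L * phi L
    @[n --> \oo] --> ip v (cls phi) + ip (primC v) (cls phi') - prim v L * phi L.
  apply: cvgB; first apply: cvgD.
  - by under eq_fun do rewrite ipC; rewrite ipC; exact: ip_cvg.
  - under eq_fun do rewrite ipC; rewrite ipC; apply: ip_cvg.
    exact: primC_cvg.
  - by apply: cvgM; [exact: prim_cvg|exact: cvg_cst].
apply/eqP; rewrite -subr_eq0; apply/eqP.
have l0 n : ip (v_ n) (cls phi) + ip (primC (v_ n)) (cls phi') -
    prim (v_ n) L * phi L = 0 by rewrite vn subrr.
exact: (cvg_cst_uniq l0 l1).
Qed.

Lemma L2one_ibp phi phi' : (forall x, is_derive x (1 : R) phi (phi' x)) ->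
  continuous phi' -> ip L2one (cls phi') = phi L - phi 0.
Proof.
move=> dphi cphi'; rewrite ipC -primL (prim_cls _ dphi cphi')//.
by rewrite in_itv/= lexx ltW.
Qed.

(** When [u] is in H^1, [u - primC (wderiv u)] is constant, equal to the value of [u] at 0. Taking
    its mean expresses this value by inner products, which gives the bound [crep_bound] at once. *)
Definition trace0 u : R := ip (u - primC (wderiv u)) L2one / L.

(* The continuous representative of [u], when [u] has a weak derivative. *)
Definition crep u (x : R) : R := trace0 u + prim (wderiv u) x.

Lemma crep_continuous u : continuous (crep u).
Proof.
by move=> x; apply: cvgD; [exact: cvg_cst|exact: prim_continuous].
Qed.

Lemma crep_spec u : sobolev 1 u -> u = cls (crep u).
Proof.
move=> /sobolev1P/weak_derivativeP uu.
have : u - primC (wderiv u) = trace0 u *: L2one.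
  apply: du_bois_reymond => phi tphi; rewrite ipBl uu//.
  have sphi := test_smooth tphi.
  have := prim_ibp (wderiv u) (smooth_is_derive sphi)
    (smooth_continuous (smooth_deriv sphi)).
  rewrite (testL tphi) mulr0 => /eqP; rewrite addrC addr_eq0 => /eqP ->.
  by rewrite opprK addrC subrr.
move/eqP; rewrite subr_eq => /eqP {1}->.
rewrite -[L2one]/(cls (cst 1)) -L2classZ ?Lfun2_cst// -L2classD.
- by congr cls; apply/funext => x; rewrite !fctE mulr1.
- by apply: Lfun2Z; exact: Lfun2_cst.
- by apply: Lfun2_continuous; exact: prim_continuous.
Qed.

Lemma crep_rep u : sobolev 1 u -> {ae leb0L, forall x, Lrep u x = crep u x}.
Proof.
move=> u1; apply: aeS (cls_continuous (@crep_continuous u)) => x <-.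
by rewrite -crep_spec.
Qed.

Lemma H1norm_ge u : `|u| <= H1norm u /\ `|wderiv u| <= H1norm u.
Proof.
split; rewrite -[leLHS]ger0_norm// -sqrtr_sqr ler_sqrt ?addr_ge0 ?sqr_ge0//.
  by rewrite lerDl sqr_ge0.
by rewrite lerDr sqr_ge0.
Qed.

(** The embedding of H^1 in the continuous functions. *)
Lemma crep_bound : exists2 K : R, 0 < K & forall u x, x \in `[0, L] ->
  `|crep u x| <= K * H1norm u.
Proof.
(* The first term bounds [trace0], the second the primitive; the last makes the constant
   positive. *)
exists (`|L2one| / L * (1 + `|L2one| * `|L2one|) + `|L2one| + 1).
  by rewrite ltr_wpDl// addr_ge0// mulr_ge0// ?divr_ge0 ?addr_ge0 ?mulr_ge0// ltW.
move=> u x xL; have [h1 h2] := H1norm_ge u; rewrite /crep.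
have H0 : 0 <= H1norm u by exact: sqrtr_ge0.
apply: (@le_trans _ _ ((`|L2one| / L * (1 + `|L2one| * `|L2one|) + `|L2one|) * H1norm u)).
  rewrite mulrDl (le_trans (ler_normD _ _))// lerD//; last first.
    by rewrite (le_trans (prim_le L0 _ xL))// mulrC ler_wpM2l.
  rewrite normrM normfV (gtr0_norm L0).
  set o := `|L2one|; set h := H1norm u.
  have -> : o / L * (1 + o * o) * h = (h + h * o * o) * o / L by ring.
  rewrite ler_wpM2r ?invr_ge0 ?(ltW L0)//.
  rewrite (le_trans (ip_cauchy _ _))// ler_wpM2r//.
  rewrite (le_trans (ler_normB _ _))// lerD//.
  by rewrite (le_trans (primC_norm L0 _))// !ler_wpM2r.
by rewrite ler_wpM2r// lerDl.
Qed.

Lemma sobolev_ibp u phi phi' : sobolev 1 u ->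
  (forall x, is_derive x (1 : R) phi (phi' x)) -> continuous phi' ->
  ip (wderiv u) (cls phi) =
  crep u L * phi L - crep u 0 * phi 0 - ip u (cls phi').
Proof.
move=> u1 dphi cphi'.
have := prim_ibp (wderiv u) dphi cphi' => /eqP; rewrite eq_sym -subr_eq => /eqP <-.
have -> : ip u (cls phi') =
    trace0 u * ip L2one (cls phi') + ip (primC (wderiv u)) (cls phi').
  rewrite -ipZl -ipDl; congr ip; rewrite {1}(crep_spec u1).
  rewrite -[L2one]/(cls (cst 1)) -L2classZ ?Lfun2_cst// -L2classD.
  - by congr cls; apply/funext => x; rewrite !fctE mulr1.
  - by apply: Lfun2Z; exact: Lfun2_cst.
  - by apply: Lfun2_continuous; exact: prim_continuous.
rewrite (L2one_ibp dphi cphi') /crep prim0; ring.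
Qed.

End sobolev_rep.

(** * The nonlinear term and the Korteweg-de Vries operator *)

Section kdv_operator.
Context (R : realType) (L : R).
Hypothesis L0 : 0 < L.
Local Notation leb := (@lebesgue_measure R).
Local Notation leb0L := (leb0L L).
Local Notation cls := (L2class L).
Local Notation L2one := (@L2one R L).
Implicit Types (u v w : L2 L) (c : R) (f g : R -> R).

Lemma continuous_sqr f : continuous f -> continuous (fun x => f x ^+ 2).
Proof.
move=> cf; rewrite (_ : (fun x => _) = f * f).
  by move=> x; apply: cvgM; exact: cf.
by apply/funext => x; rewrite expr2.
Qed.

Lemma ip_cvg2 (v_ w_ : nat -> L2 L) v w :
  v_ n @[n --> \oo] --> v -> w_ n @[n --> \oo] --> w ->
  ip (v_ n) (w_ n) @[n --> \oo] --> ip v w.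
Proof.
move=> vv ww.
have -> : (fun n => ip (v_ n) (w_ n)) =
    (fun n => ip v (w_ n) + ip (v_ n - v) (w_ n)).
  by apply/funext => n; rewrite ipBl addrC subrK.
rewrite -[X in _ --> X]addr0; apply: cvgD; first exact: ip_cvg.
have h : `|v - v_ n| * `|w_ n| @[n --> \oo] --> (0 : R).
  rewrite -[X in _ --> X](mul0r `|w|); apply: cvgM; last exact: cvg_norm.
  by have /cvg_distP := vv.
have hN : - (`|v - v_ n| * `|w_ n|) @[n --> \oo] --> (0 : R).
  by rewrite -[X in _ --> X]oppr0; exact: cvgN.
apply: squeeze_cvgr hN h; apply: nearW => n.
by rewrite -ler_norml (distrC v) ip_cauchy.
Qed.

Lemma L2classB f g : continuous f -> continuous g ->
  cls (fun x => f x - g x) = cls f - cls g.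
Proof.
move=> cf cg; have fL := Lfun2_continuous L cf; have gL := Lfun2_continuous L cg.
rewrite -scaleN1r -L2classZ// -L2classD ?Lfun2Z//.
by congr cls; apply/funext => x; rewrite !fctE mulN1r.
Qed.

(* For [c + prim v = f] this is [3 \int f^2 f' = f(L)^3 - f(0)^3]; it passes to
   the limit from test functions [v] because both sides are continuous in [v]. *)
Lemma prim_cubic v c :
  ip v (cls (fun x => (c + prim v x) ^+ 2)) = ((c + prim v L) ^+ 3 - c ^+ 3) / 3.
Proof.
have cp u : continuous (fun x => (c + prim u x) ^+ 2).
  apply: continuous_sqr => x; apply: cvgD; first exact: cvg_cst.
  exact: prim_continuous.
apply: (@L2_test_ind _ _ (fun v => ip v (cls (fun x => (c + prim v x) ^+ 2)) =
   ((c + prim v L) ^+ 3 - c ^+ 3) / 3)) => [f tf|v_ {}v vn vv].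
  have [F [dF F0 _]] := test_prim_int L0 tf.
  have [PF ->] := prim_is_derive L0 tf erefl dF F0.
  have cf := smooth_continuous (test_smooth tf).
  have cF := is_derive_continuous dF.
  have E : {ae leb0L, forall x, Lrep (cls (fun x => (c + prim (cls f) x) ^+ 2)) x =
      (c + F x) ^+ 2}.
    apply: aeS3 (cls_continuous L (cp (cls f))) PF (primC_rep L0 (cls f)).
    by move=> x -> -> ->.
  have I1 := ip_int (cls_continuous L cf) E.
  apply: (has_int_uniq I1) => //.
  have dG x : is_derive x (1 : R) (fun x => (c + F x) ^+ 3 / 3)
      (f x * (c + F x) ^+ 2).
    have dc : is_derive x (1 : R) (cst c + F) (0 + f x).
      by apply: is_deriveD; exact: dF.
    have := is_deriveZ (3^-1 : R) (is_deriveX 3 dc).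
    move/is_derive_ext; apply => [y|].
      by rewrite !fctE mulrC.
    by rewrite /GRing.scale/= add0r !fctE; field.
  have := has_int_derive L0 dG; rewrite F0 addr0 -mulrBl; apply.
  have csq : continuous (fun x => (c + F x) ^+ 2).
    by apply: continuous_sqr => y; apply: cvgD; [exact: cvg_cst|exact: cF].
  by move=> x; apply: cvgM; [exact: cf|exact: csq].
have cE : cls (fun x => (c + prim (v_ n) x) ^+ 2) @[n --> \oo] -->
    cls (fun x => (c + prim v x) ^+ 2).
  apply/cvg_distP; set o := `|L2one|.
  (* A difference of squares factors, and [prim_le] bounds both factors uniformly on [0, L] by L^2
     norms. *)
  have b n : `|cls (fun x => (c + prim v x) ^+ 2) -
      cls (fun x => (c + prim (v_ n) x) ^+ 2)| <=
      `|v - v_ n| * o * (`|c| + `|c| + (`|v| + `|v_ n|) * o) * o.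
    rewrite -L2classB//; apply: norm_cls_le => //.
      apply: Lfun2_continuous => x; apply: cvgB; exact: cp.
    move=> x xL; have {}xL : x \in `[0, L] by exact: subset_itv_oo_cc.
    rewrite subr_sqr normrM opprD addrACA subrr add0r -primB.
    apply: ler_pM => //; first exact: prim_le.
    rewrite addrACA mulrDl (le_trans (ler_normD _ _))// lerD ?ler_normD//.
    by rewrite (le_trans (ler_normD _ _))// lerD// prim_le.
  apply: (@squeeze_cvgr _ _ _ _ (cst 0)
    (fun n => `|v - v_ n| * o * (`|c| + `|c| + (`|v| + `|v_ n|) * o) * o)).
  - by apply: nearW => n; rewrite normr_ge0 b.
  - exact: cvg_cst.
  - have -> : (0 : R) = 0 * o * (`|c| + `|c| + (`|v| + `|v|) * o) * o by rewrite !mul0r.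
    apply: cvgM; last exact: cvg_cst.
    apply: cvgM.
      by apply: cvgM; [have /cvg_distP := vv; exact|exact: cvg_cst].
    apply: cvgD; first exact: cvg_cst.
    apply: cvgM; last exact: cvg_cst.
    by apply: cvgD; [exact: cvg_cst|exact: cvg_norm].
have l1 := ip_cvg2 vv cE.
have l2 : ((c + prim (v_ n) L) ^+ 3 - c ^+ 3) / 3 @[n --> \oo] -->
    ((c + prim v L) ^+ 3 - c ^+ 3) / 3.
  apply: cvgM; last exact: cvg_cst.
  apply: cvgB; last exact: cvg_cst.
  have h : c + prim (v_ n) L @[n --> \oo] --> c + prim v L.
    by apply: cvgD; [exact: cvg_cst|exact: prim_cvg].
  rewrite (_ : (fun n => _) = fun n => (c + prim (v_ n) L) *
    ((c + prim (v_ n) L) * (c + prim (v_ n) L))).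
    by rewrite exprS expr2; do 2 (apply: cvgM => //).
  by apply/funext => n; rewrite exprS expr2.
apply/eqP; rewrite -subr_eq0; apply/eqP.
have l0 n : ip (v_ n) (cls (fun x => (c + prim (v_ n) x) ^+ 2)) -
    ((c + prim (v_ n) L) ^+ 3 - c ^+ 3) / 3 = 0 by rewrite vn subrr.
exact: (cvg_cst_uniq l0 (cvgB l1 l2)).
Qed.

(** A bounded factor keeps the product square integrable, so that [L2class] does not fall back on
    its default 0. *)
Lemma L2mul_spec u v K : 0 <= K -> {ae leb0L, forall x, `|Lrep u x| <= K} ->
  {ae leb0L, forall x, Lrep (L2mul u v) x = Lrep u x * Lrep v x} /\
  `|L2mul u v| <= K * `|v|.
Proof.
move=> K0 uK.
have mf : measurable_fun setT (fun x => Lrep u x * Lrep v x).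
  by apply: measurable_funM; exact: measurable_Lrep.
have uvL : (fun x => Lrep u x * Lrep v x) \in Lfun leb0L 2%:E.
  apply: (Lfun2_le mf (Lspace_Lfun (K *: v))).
  apply: aeS2 uK (LrepZ K v) => x h e.
  rewrite -[leRHS]/(`|Lrep (K *: v) x|) e !normrM ler_wpM2r//.
  by rewrite (ger0_norm K0).
have E := L2classE uvL; split => //.
rewrite -[K]ger0_norm// -normrZ; apply: normC_le.
apply: aeS3 E uK (LrepZ K v) => x -> h ->.
by rewrite !normrM ler_wpM2r// (ger0_norm K0).
Qed.

Lemma crep_ae_bound u K : sobolev 1 u ->
  (forall x, x \in `[0, L] -> `|crep u x| <= K) ->
  {ae leb0L, forall x, `|Lrep u x| <= K}.
Proof.
move=> u1 uK.
have h : {ae leb0L, forall x, `|crep u x| <= K}.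
  by apply/ae_leb0LP; apply: aeW => x xL; apply: uK; exact: subset_itv_oo_cc.
by apply: aeS2 (crep_rep L0 u1) h => x ->.
Qed.

(** This is [prim_cubic] for the continuous representative of [u]: the left-hand side is the
    integral of u^2 u_x. *)
Lemma ip_convection u : sobolev 1 u ->
  ip (L2mul u (wderiv u)) u = (crep u L ^+ 3 - crep u 0 ^+ 3) / 3.
Proof.
move=> u1; have [K K0 uK] := crep_bound L0.
have KH : 0 <= K * H1norm u by rewrite mulr_ge0 ?(ltW K0)// sqrtr_ge0.
have [E _] := L2mul_spec (wderiv u) KH (crep_ae_bound u1 (fun x => uK u x)).
have := prim_cubic (wderiv u) (trace0 u).
rewrite /crep prim0 addr0 => <-.
have cc : continuous (fun x => (trace0 u + prim (wderiv u) x) ^+ 2).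
  by apply: continuous_sqr; exact: crep_continuous.
have I := ip_int (aeW _ (fun x => erefl (Lrep (wderiv u) x))) (cls_continuous L cc).
apply: (has_int_uniq (has_int_leb0L (ip_leb0L _ _)) _ (measurable_itv _)).
have := I; apply: has_int_ae.
have := (ae_leb0LP L _).1 (aeS2 (fun x a b => conj a b) E (crep_rep L0 u1)).
apply: aeS => x h xL; have [-> ->] := h xL.
by rewrite /crep; ring.
Qed.

Lemma continuous_ae_eq f g : {within `[0, L], continuous f} ->
  {within `[0, L], continuous g} -> {ae leb0L, forall x, f x = g x} ->
  forall x, x \in `[0, L] -> f x = g x.
Proof.
move=> cf cg /ae_leb0LP[N [mN N0 fgN]] x xL; apply: contrapT => /eqP fgx.
have e0 : 0 < `|f x - g x| by rewrite normr_gt0 subr_eq0.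
have cfg : {within `[0, L], continuous (fun x => f x - g x)}.
  by move=> z; apply: cvgB; [exact: cf|exact: cg].
have /subspace_continuousP/(_ x xL)/cvgrPdist_lt/(_ _ e0) := cfg.
rewrite near_withinE => -[/= d d0 H].
(* Clipping to [0, L] leaves an interval of positive length even when [x] is an end point; on it the
   two functions differ, so it lies in the null set [N]. *)
pose p := Num.max 0 (x - d); pose q := Num.min L (x + d).
move: (xL); rewrite in_itv/= => /andP[x0 xL'].
have pq : p < q.
  have d0' : 0 < d by [].
  rewrite gt_max !lt_min; apply/andP; split; apply/andP; split => //.
  - by rewrite ltr_wpDl.
  - by rewrite ltrBlDr (le_lt_trans xL')// ltrDl.
  - by rewrite ltrBlDr -addrA ltrDl addr_gt0.
have sub : `]p, q[ `<=` N.
  move=> y /=; rewrite in_itv/= gt_max lt_min => /andP[/andP[y0 xdy] /andP[yL yxd]].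
  apply: fgN => /=; apply/not_implyP; split; first by rewrite in_itv/= y0.
  move=> fgy.
  have H' : ball x d y -> y \in `[0, L] ->
    `|f x - g x - (f y - g y)| < `|f x - g x| := H y.
  move: H'; rewrite fgy ?in_itv/= ?y0 ?yL// subrr subr0 ltxx (ltW y0) (ltW yL).
  move=> H'; suff : false by []; apply: H' => //.
  by rewrite /ball/= ltr_distlC xdy yxd.
have : (leb `]p, q[ <= leb N)%E by apply: le_measure => //; exact: mem_set.
rewrite [X in (_ <= X)%E]N0 lebesgue_measure_itv/= lte_fin pq -EFinB lee_fin.
by rewrite leNgt subr_gt0 pq.
Qed.

Lemma has_value_crep u x c : sobolev 1 u -> x \in `[0, L] -> has_value u x c ->
  crep u x = c.
Proof.
move=> u1 xL [g [cg ug <-]]; apply: (continuous_ae_eq _ cg) => //.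
  by apply: continuous_subspaceT; exact: crep_continuous.
by apply: aeS2 ug (crep_rep L0 u1) => y e <-; exact: e.
Qed.

Lemma weak_derivative_test phi : test_function L phi ->
  weak_derivative (cls phi) (cls phi^`()%classic).
Proof.
move=> tphi; apply/weak_derivativeP => chi tchi.
have s1 := test_smooth tphi; have s2 := test_smooth tchi.
have c1 := smooth_continuous s1; have c2 := smooth_continuous s2.
have d1 := smooth_deriv s1; have d2 := smooth_deriv s2.
have e1 := smooth_continuous d1; have e2 := smooth_continuous d2.
apply/eqP; rewrite -addr_eq0; apply/eqP.
have I1 := ip_int (cls_continuous L c1) (cls_continuous L e2).
have I2 := ip_int (cls_continuous L e1) (cls_continuous L c2).
apply: (has_int_uniq (has_intD I1 I2 (measurable_itv _))) => //.
have dM x : is_derive x (1 : R) (phi * chi)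
    (phi x * chi^`()%classic x + phi^`()%classic x * chi x).
  have := is_deriveM (smooth_is_derive s1 x) (smooth_is_derive s2 x).
  by move/is_derive_ext; apply => //; rewrite /GRing.scale/= [chi x * _]mulrC.
have := has_int_derive L0 dM; rewrite !fctE !(testL tphi) !(test0 tphi) !mul0r subrr.
apply => x; apply: cvgD; apply: cvgM; [exact: c1|exact: e2|exact: e1|exact: c2].
Qed.

Lemma test_iter n phi : test_function L phi -> test_function L (phi^`(n))%classic.
Proof.
by move=> tphi; elim: n => [|n IH]; rewrite ?derive1n0// derive1nS; exact: test_deriv.
Qed.

Lemma wderiv_iter n phi : test_function L phi ->
  iter n (@wderiv R L) (cls phi) = cls (phi^`(n))%classic.
Proof.
move=> tphi; elim: n => [|n IH]; first by rewrite derive1n0.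
rewrite iterS IH derive1nS; apply: wderivE.
by apply: weak_derivative_test; exact: test_iter.
Qed.

Lemma kdv_dom_test phi : test_function L phi -> kdv_dom (cls phi).
Proof.
move=> tphi.
have hv psi x : test_function L psi -> psi x = 0 -> has_value (cls psi) x 0.
  move=> tpsi px; have cpsi := smooth_continuous (test_smooth tpsi).
  exists psi; split => //; first exact: continuous_subspaceT.
  by apply: aeS (cls_continuous L cpsi) => y -> _.
split.
- move=> i _; exists (cls (phi^`(i.+1))%classic).
  rewrite wderiv_iter// derive1nS; apply: weak_derivative_test.
  exact: test_iter.
- by apply: hv => //; exact: (test0 tphi).
- by apply: hv => //; exact: (testL tphi).
- rewrite -[wderiv _]/(iter 1 (@wderiv R L) _) wderiv_iter//.
  by apply: hv; [exact: test_iter|exact: (testL (test_iter 1 tphi))].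
Qed.

Lemma ipNl u v : ip (- u) v = - ip u v.
Proof. by rewrite -scaleN1r ipZl mulN1r. Qed.

(** Integration by parts, moving up to three derivatives. The conditions on [p0] and [p1] remove
    w''(0), w''(L) and w'(0); the domain of the operator removes w(0), w(L) and w'(L). Nothing is
    asked of [p2] at the ends. *)
Lemma kdv_adjoint w (p0 p1 p2 p3 : R -> R) : kdv_dom w ->
  (forall x, is_derive x (1 : R) p0 (p1 x)) ->
  (forall x, is_derive x (1 : R) p1 (p2 x)) ->
  (forall x, is_derive x (1 : R) p2 (p3 x)) -> continuous p3 ->
  p0 0 = 0 -> p0 L = 0 -> p1 0 = 0 ->
  ip (kdv_op w) (cls p0) = ip w (cls p1 + cls p3).
Proof.
move=> [sw w0 wL w'L] d0 d1 d2 c3 p00 p0L p10.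
have c2 := is_derive_continuous d2; have c1 := is_derive_continuous d1.
have s1 i : (i < 3)%N -> sobolev 1 (iter i (@wderiv R L) w).
  by move=> /sw[v]; exact: weak_sobolev1.
have h0 : sobolev 1 w := s1 0%N isT; have h1 : sobolev 1 (wderiv w) := s1 1%N isT.
have h2 : sobolev 1 (wderiv (wderiv w)) := s1 2%N isT.
have in0 : 0 \in `[0, L] by rewrite in_itv/= lexx ltW.
have inL : L \in `[0, L] by rewrite in_itv/= lexx ltW.
have e0 := has_value_crep h0 in0 w0; have eL := has_value_crep h0 inL wL.
have e'L := has_value_crep h1 inL w'L.
rewrite /kdv_op ipBl ipNl ipDr.
have E0 := sobolev_ibp L0 h0 d0 c1; have E2 := sobolev_ibp L0 h2 d0 c1.
have E1 := sobolev_ibp L0 h1 d1 c2; have E3 := sobolev_ibp L0 h0 d2 c3.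
have Z1 (p q : R) : p * 0 - q * 0 = 0 by rewrite !mulr0 subrr.
have Z2 (p q : R) : 0 * p - q * 0 = 0 by rewrite mulr0 mul0r subrr.
have Z3 (p q : R) : 0 * p - 0 * q = 0 by rewrite !mul0r subrr.
rewrite p00 p0L Z1 sub0r in E0; rewrite p00 p0L Z1 sub0r in E2.
rewrite p10 e'L Z2 sub0r in E1; rewrite e0 eL Z3 sub0r in E3.
by rewrite /= E0 E2 E1 E3 !opprK.
Qed.

End kdv_operator.

Section partition_eq.
Context (R : realType).
Local Notation leb := (@lebesgue_measure R).

(** Equality on each piece allows [has_int_partition] to be applied both to [Phi] and to its
    opposite. *)
Lemma has_int_partition_eq (s t : R) (Phi : R -> R) (k : R -> R -> R -> R)
    (k0 m : R -> R) M : s < t ->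
  (forall a b, s <= a -> a < b -> b <= t ->
    has_int leb `]a, b] (k a b) (Phi b - Phi a)) ->
  has_int leb `]s, t] m M ->
  {ae leb, forall x, x \in `]s, t] -> forall a b, s <= a -> a < x -> x <= b ->
    b <= t -> `|k a b x| <= m x} ->
  {ae leb, forall x, x \in `]s, t] -> forall e : R, 0 < e -> exists2 d : R, 0 < d &
    forall a b, s <= a -> a < x -> x <= b -> b <= t -> b - a < d ->
    `|k a b x - k0 x| <= e} ->
  has_int leb `]s, t] k0 (Phi t - Phi s).
Proof.
move=> st Phik mM km kk0.
have [c kc Pc] : exists2 c, has_int leb `]s, t] k0 c & Phi t - Phi s <= c.
  apply: (has_int_partition st _ mM km kk0) => a b sa ab bt.
  by exists (Phi b - Phi a) => //; exact: Phik.
have [c' kc' Pc'] : exists2 c', has_int leb `]s, t] (fun x => - k0 x) c' &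
    (- Phi t) - (- Phi s) <= c'.
  apply: (@has_int_partition _ _ _ (fun x => - Phi x) (fun a b x => - k a b x)
    (fun x => - k0 x) m M st _ mM) => [a b sa ab bt||].
  - exists (- (Phi b - Phi a)); last by rewrite opprB opprK addrC.
    have := has_intZ (-1) (Phik a b sa ab bt) (measurable_itv _).
    by rewrite mulN1r; apply: has_int_eq => x _; rewrite mulN1r.
  - by apply: aeS km => x km xst a b *; rewrite normrN km.
  - apply: aeS kk0 => x kk0 xst e e0; have [d d0 H] := kk0 xst e e0.
    by exists d => // a b *; rewrite -opprD normrN H.
have cc' : c' = - c.
  apply: (has_int_uniq kc') => //.
  have := has_intZ (-1) kc (measurable_itv _).
  by rewrite mulN1r; apply: has_int_eq => x _; rewrite mulN1r.
suff -> : Phi t - Phi s = c by [].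
apply/le_anti/andP; split => //.
by rewrite -lerN2 -cc' (le_trans _ Pc')// opprB opprK addrC.
Qed.

End partition_eq.

(** * The semigroup and the mild solutions *)

Section semigroup.
Context (R : realType) (V : normedModType R) (W : R -> {linear V -> V}).
Hypothesis cW : c0_contraction_semigroup W.
Implicit Types (u v : V).

Lemma sg0 u : W 0 u = u. Proof. by case: cW. Qed.

Lemma sgD s t u : 0 <= s -> 0 <= t -> W (s + t) u = W s (W t u).
Proof. by case: cW => _ + _ _; apply. Qed.

Lemma sg_le t u : 0 <= t -> `|W t u| <= `|u|.
Proof. by case: cW => _ _ _; apply. Qed.

Lemma sg_sub s t u : 0 <= s -> s <= t -> W t u = W s (W (t - s) u).
Proof. by move=> s0 st; rewrite -sgD ?subr_ge0// subrKC. Qed.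

Lemma sg_dist s t u : 0 <= s -> s <= t -> `|W t u - W s u| <= `|W (t - s) u - u|.
Proof. by move=> s0 st; rewrite (sg_sub u s0 st) -linearB sg_le. Qed.

Lemma sg_right u (e : R) : 0 < e -> exists2 d : R, 0 < d &
  forall h, 0 <= h -> h < d -> `|W h u - u| <= e.
Proof.
move=> e0; have [_ _ /(_ u) /cvgrPdist_le/(_ e e0) + _] := cW.
rewrite near_withinE => -[/= d d0 H]; exists d => // h; rewrite le_eqVlt.
move=> /predU1P[<- _|h0 hd]; first by rewrite sg0 subrr normr0 ltW.
rewrite distrC; apply: H => //.
by rewrite /ball/= sub0r normrN gtr0_norm.
Qed.

Lemma sg_continuous u s (e : R) : 0 <= s -> 0 < e -> exists2 d : R, 0 < d &
  forall t, 0 <= t -> `|t - s| < d -> `|W t u - W s u| <= e.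
Proof.
move=> s0 e0; have [d d0 H] := sg_right u e0; exists d => // t t0.
have [ts|/ltW ts] := leP s t => td.
  by rewrite (le_trans (sg_dist _ s0 ts))// H ?subr_ge0// -(ger0_norm (_ : 0 <= t - s)) ?subr_ge0.
rewrite distrC (le_trans (sg_dist _ t0 ts))// H ?subr_ge0//.
by rewrite -(ger0_norm (_ : 0 <= s - t)) ?subr_ge0// distrC.
Qed.

Context (A : V -> V) (domA : set V).
Hypothesis gA : generates A domA W.

Lemma gen_quotient u (e : R) : domA u -> 0 < e -> exists2 d : R, 0 < d &
  forall h, 0 < h -> h < d -> `|h^-1 *: (W h u - u) - A u| <= e.
Proof.
move=> du e0; have /cvgrPdist_le/(_ e e0) := (gA u (A u)).2 (conj du erefl).
rewrite near_withinE => -[/= d d0 H]; exists d => // h h0 hd.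
rewrite distrC; apply: H => //.
by rewrite /ball/= sub0r normrN gtr0_norm.
Qed.

Lemma gen_invariant u s : domA u -> 0 <= s -> domA (W s u) /\ A (W s u) = W s (A u).
Proof.
move=> du s0; apply/gA.
apply/cvgrPdist_le => e e0; have [d d0 H] := gen_quotient du e0.
rewrite near_withinE; exists d => //= h; rewrite /ball/= sub0r normrN => hd h0.
have E : h^-1 *: (W h (W s u) - W s u) = W s (h^-1 *: (W h u - u)).
    have h0' := ltW h0.
    rewrite -(sgD _ h0' s0) (addrC h) (sgD _ s0 h0') [RHS]linearZ.
    by congr (_ *: _); rewrite linearB.
rewrite E distrC -linearB (le_trans (sg_le _ s0))// H//.
by rewrite gtr0_norm in hd.
Qed.

End semigroup.

(** * Weak form of the semigroup *)

Section semigroup_weak.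
Context (R : realType) (L : R).
Hypothesis L0 : 0 < L.
Local Notation leb := (@lebesgue_measure R).
Local Notation leb0L := (leb0L L).
Local Notation cls := (L2class L).
Context (W : R -> {linear L2 L -> L2 L}).
Hypothesis cW : c0_contraction_semigroup W.
Hypothesis gW : generates (@kdv_op R L) (@kdv_dom R L) W.
Implicit Types (u v w : L2 L) (c : R) (f g : R -> R).

Lemma fin_itv (a b : R) : (leb `]a, b] < +oo)%E.
Proof. by rewrite lebesgue_measure_itv/=; case: ifP; rewrite -?EFinB ltry. Qed.

(** On the domain, <W u, phi> has derivative <A W u, phi> = <W u, psi>. Its difference quotients,
    constant on each piece of a subdivision, integrate to its increments, and [has_int_partition_eq]
    takes the limit. *)
Lemma semigroup_weak_dom (phi psi u : L2 L) a b :
  (forall w, kdv_dom w -> ip (kdv_op w) phi = ip w psi) -> a < b -> kdv_dom u ->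
  has_int leb `]a, b] (fun x => ip (W (x - a) u) psi) (ip (W (b - a) u - u) phi).
Proof.
move=> adj ab du; pose Phi x := ip (W (x - a) u) phi.
have -> : ip (W (b - a) u - u) phi = Phi b - Phi a.
  by rewrite /Phi subrr (sg0 cW) ipBl.
have [d d0 H] := gen_quotient gW du ltr01.
(* Steps shorter than [d] have quotients within 1 of [kdv_op u]; for longer steps the contraction
   property gives 2 |u| / d. *)
pose B : R := (`|kdv_op u| + 1 + 2 * `|u| / d) * `|phi|.
have quot p q : a <= p -> p < q -> (q - p)^-1 *: (W (q - a) u - W (p - a) u) =
    W (p - a) ((q - p)^-1 *: (W (q - p) u - u)).
  move=> ap pq; rewrite (sg_sub cW u (_ : 0 <= p - a)) ?subr_ge0//.
    by rewrite opprB addrA subrK [RHS]linearZ; congr (_ *: _); rewrite linearB.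
  by rewrite lerD2r ltW.
have kE p q : (Phi q - Phi p) / (q - p) =
    ip ((q - p)^-1 *: (W (q - a) u - W (p - a) u)) phi.
  by rewrite ipZl ipBl mulrC.
apply: (@has_int_partition_eq _ _ _ Phi (fun p q x => (Phi q - Phi p) / (q - p))
   _ (fun=> B) _ ab).
- move=> p q ap pq qb.
  have := has_int_const (mu := leb) ((Phi q - Phi p) / (q - p))
    (measurable_itv `]p, q]) (fin_itv p q).
  have -> : fine (leb `]p, q]) = q - p by rewrite lebesgue_measure_itv/= lte_fin pq.
  by rewrite divfK// subr_eq0 gt_eqF.
- exact: has_int_const (fin_itv a b).
- apply: aeW => x _ p q ap px xq qb; have pq : p < q by exact: lt_le_trans xq.
  have qp0 : 0 < q - p by rewrite subr_gt0.
  rewrite kE (le_trans (ip_cauchy _ _))// ler_wpM2r// quot//.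
  rewrite (le_trans (sg_le cW _ _)) ?subr_ge0//.
  have [qpd|qpd] := ltP (q - p) d.
    have := H _ qp0 qpd; move: (_ *: _) => Q HQ.
    have : `|Q| <= `|kdv_op u| + 1.
      by rewrite -[Q](subrK (kdv_op u)) addrC (le_trans (ler_normD _ _))// lerD2l.
    move/le_trans; apply; rewrite lerDl divr_ge0 ?mulr_ge0//; exact: ltW.
  rewrite normrZ normfV gtr0_norm// mulrC.
  apply: (@le_trans _ _ (2 * `|u| / d)); last by rewrite lerDr addr_ge0.
  apply: ler_pM => //; first by rewrite invr_ge0 ltW.
    rewrite (le_trans (ler_normB _ _))// mulr_natl mulr2n lerD2r.
    by rewrite (sg_le cW)// ltW.
  by rewrite lef_pV2.
- apply: aeW => x; rewrite in_itv/= => /andP[ax xb] e e0.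
  have e1 : 0 < e / 2 / (`|phi| + 1) by rewrite !divr_gt0// ltr_wpDl.
  have [d1 d10 H1] := gen_quotient gW du e1.
  have xa0 : 0 <= x - a by rewrite subr_ge0 ltW.
  have [d2 d20 H2] := sg_continuous cW (kdv_op u) xa0 e1.
  exists (Num.min d1 d2) => [|p q ap px xq qb].
    by rewrite lt_min d10.
  rewrite lt_min => /andP[qp1 qp2].
  have pq : p < q by exact: lt_le_trans xq.
  have qp0 : 0 < q - p by rewrite subr_gt0.
  have pa0 : 0 <= p - a by rewrite subr_ge0.
  have [dW AW] := gen_invariant cW gW du xa0.
  rewrite kE quot// -adj// AW -ipBl (le_trans (ip_cauchy _ _))//.
  have : `|W (p - a) ((q - p)^-1 *: (W (q - p) u - u)) - W (x - a) (kdv_op u)| <=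
      e / (`|phi| + 1).
    rewrite -(subrKA (W (p - a) (kdv_op u))).
    have -> : e / (`|phi| + 1) = e / 2 / (`|phi| + 1) + e / 2 / (`|phi| + 1).
      by rewrite -mulrDl -splitr.
    rewrite (le_trans (ler_normD _ _))// lerD//.
      by rewrite -linearB (le_trans (sg_le cW _ pa0))// H1.
    apply: H2 => //; rewrite opprB addrA subrK distrC gtr0_norm ?subr_gt0//.
    by rewrite (le_lt_trans _ qp2)// lerD2r.
  rewrite ler_pdivlMr ?ltr_wpDl//; apply: le_trans.
  by rewrite ler_wpM2l// lerDl.
Qed.

Lemma semigroup_weak (phi psi u : L2 L) a b :
  (forall w, kdv_dom w -> ip (kdv_op w) phi = ip w psi) -> a < b ->
  has_int leb `]a, b] (fun x => ip (W (x - a) u) psi) (ip (W (b - a) u - u) phi).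
Proof.
move=> adj ab.
apply: (@L2_test_ind _ _ (fun u => has_int leb `]a, b]
  (fun x => ip (W (x - a) u) psi) (ip (W (b - a) u - u) phi)))
  => [f tf|u_ {}u un uu].
  by apply: semigroup_weak_dom => //; exact: kdv_dom_test.
have Wcvg (t : R) (v_ : nat -> L2 L) v : 0 <= t -> v_ n @[n --> \oo] --> v ->
    W t (v_ n) @[n --> \oo] --> W t v.
  move=> t0 vv; apply/cvgrPdist_le => e e0.
  have /cvgrPdist_le/(_ e e0) := vv; apply: filterS => n.
  by rewrite -linearB; apply: le_trans; exact: sg_le.
(* Dropping the first N terms bounds the approximants by |u| + 1, the constant majorant for
   dominated convergence. *)
have /cvgrPdist_le/(_ 1 ltr01) [N _ HN] := uu.
have uuN : u_ (n + N)%N @[n --> \oo] --> u by rewrite cvg_shiftn.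
have mM := has_int_const (mu := leb) ((`|u| + 1) * `|psi|)
  (measurable_itv `]a, b]) (fin_itv a b).
have [||c hc cc] := @has_int_dom _ _ _ leb `]a, b]
  (fun n x => ip (W (x - a) (u_ (n + N)%N)) psi) (fun x => ip (W (x - a) u) psi)
  (fun=> (`|u| + 1) * `|psi|) (fun n => ip (W (b - a) (u_ (n + N)%N) - u_ (n + N)%N) phi)
  _ (fun n => un (n + N)%N) mM (measurable_itv _).
- apply: aeW => x /=; rewrite in_itv/= => /andP[ax _].
  under eq_fun do rewrite ipC; rewrite ipC; apply: ip_cvg; apply: Wcvg => //.
  by rewrite subr_ge0 ltW.
- move=> n; apply: aeW => x /=; rewrite in_itv/= => /andP[ax _].
  rewrite (le_trans (ip_cauchy _ _))// ler_wpM2r//.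
  rewrite (le_trans (sg_le cW _ _)) ?subr_ge0 ?(ltW ax)//.
  have := HN (n + N)%N (leq_addl _ _); rewrite /= distrC => h.
  by rewrite -[u_ _](subrK u) addrC (le_trans (ler_normD _ _))// lerD2l.
suff <- : c = ip (W (b - a) u - u) phi by [].
rewrite -(cvg_lim _ cc)//; apply/cvg_lim => //.
apply: ip_cvg2; last exact: cvg_cst.
by apply: cvgB => //; apply: Wcvg => //; rewrite subr_ge0 ltW.
Qed.

End semigroup_weak.

(** * Functions with vanishing integrals *)

Section vanishing.
Context (R : realType).
Local Notation leb := (@lebesgue_measure R).

(** Lebesgue differentiation: the integrand is almost everywhere the derivative of its primitive,
    which is constant on ]0, T[. Extending the representative by 0 lets the primitive start at minus
    infinity. *)
Lemma has_int_vanish (h : R -> R) (T c : R) : has_int leb `]0, T[ h c ->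
  (forall t, 0 < t -> t < T -> has_int leb `]0, t] h 0) ->
  {ae leb, forall x, x \in `]0, T[ -> h x = 0}.
Proof.
move=> [g [gi hg _]] h0; pose gD := g \_ `]0, T[.
have gDi : leb.-integrable setT (EFin \o gD).
  rewrite -restrict_EFin.
  exact: ((integrable_mkcond (mu := leb) (EFin \o g) (measurable_itv `]0, T[)).1 gi).
have F0 x : 0 < x -> x < T -> \int[leb]_(t in `]-oo, x]) gD t = 0.
  move=> x0 xT; rewrite -Rintegral_mkcondr.
  have -> : `]-oo, x] `&` `]0, T[ = `]0, x]%classic :> set R.
    apply/seteqP; split => t /=; rewrite !in_itv/=.
      by move=> [tx /andP[-> _]].
    by move=> /andP[t0 tx]; rewrite tx t0/= (le_lt_trans tx).
  have sub : `]0, x] `<=` `]0, T[.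
    move=> t /=; rewrite !in_itv/= => /andP[-> tx] /=.
    exact: le_lt_trans xT.
  have gi' : leb.-integrable `]0, x] (EFin \o g).
    by apply: integrableS gi.
  apply: (has_int_uniq (has_int_integrable (mu := leb) _ gi')) => //.
  apply: has_int_ae (h0 x x0 xT); apply: aeS hg => t hg tx.
  by rewrite hg//; exact: sub.
have loc : locally_integrable setT gD.
  apply: integrable_locally => //.
have gDy y : leb.-integrable `]-oo, y] (EFin \o gD) by apply: integrableS gDi.
have /= H := FTC1Ny gDy loc.
apply: aeS2 H hg => x [d1 d2] hgx xT; rewrite hgx//.
have -> : g x = gD x by rewrite /gD patchE mem_set.
rewrite -d2; move: xT; rewrite in_itv/= => /andP[x0 xT].
suff dF : is_derive x 1 (fun x => \int[leb]_(t in `]-oo, x]) gD t) 0.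
  by rewrite derive1E derive_val.
apply: (@near_eq_is_derive _ R^o R^o (cst 0)).
near=> y; rewrite F0//; first by near: y; exact: lt_nbhsr.
by near: y; exact: lt_nbhsl.
Unshelve. all: by end_near. Qed.

End vanishing.

Definition convection (R : realType) (L : R) (y : R -> L2 L) (x : R) : L2 L :=
  L2mul (y x) (wderiv (y x)).

Definition damping (R : realType) (L a us : R) (y : R -> L2 L) (x : R) : L2 L :=
  sat us (a *: y x).

(** * Mild solutions: Duhamel's formula and a priori bounds *)

Section mild.
Context (R : realType) (L : R).
Hypothesis L0 : 0 < L.
Local Notation leb := (@lebesgue_measure R).
Local Notation leb0L := (leb0L L).
Local Notation cls := (L2class L).
Context (a us : R) (W : R -> {linear L2 L -> L2 L}) (y0 : L2 L) (y : R -> L2 L).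
Hypothesis a0 : 0 < a.
Hypothesis us0 : 0 < us.
Hypothesis cW : c0_contraction_semigroup W.
Hypothesis gW : generates (@kdv_op R L) (@kdv_dom R L) W.
Hypothesis My : mild_solution a us W y0 y.
Implicit Types (u v w : L2 L) (c : R) (f g : R -> R).

Local Notation conv := (convection y).
Local Notation damp := (damping a us y).

Lemma fin_cc (p q : R) : (leb `[p, q] < +oo)%E.
Proof. by rewrite lebesgue_measure_itv/=; case: ifP; rewrite -?EFinB ltry. Qed.

Lemma bochner_ip (F : R -> L2 L) I s t phi : 0 <= s ->
  is_bochner_integral `[0, t] F I ->
  has_int leb `[0, t] (fun x => ip phi (W s (F x))) (ip phi (W s I)).
Proof.
move=> s0 FI; pose l : {linear L2 L -> R^o} := ip phi \o W s.
apply: (@bochner_functional _ _ _ F I l `|phi|) => //.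
  exact: fin_cc.
move=> u; rewrite /l/= (le_trans (ip_cauchy _ _))// ler_wpM2l//.
exact: sg_le.
Qed.

Lemma mild0 : y 0 = y0.
Proof.
have [_ /(_ 0 (lexx _))[I1 [I2 [B1 B2 ->]]]] := My.
have null (F : R -> L2 L) I : is_bochner_integral `[0, 0] F I -> I = 0.
  (* Paired with [I] itself, the integral over a single point gives |I|^2 = 0. *)
  move=> /(bochner_ip I (lexx 0)) [g [_ _ gc]].
  apply: ip_eq0; apply: EFin_inj; rewrite -{2}(sg0 cW I) -gc set_itv1.
  exact: integral_set1.
by rewrite (null _ _ B1) (null _ _ B2) !subr0 (sg0 cW).
Qed.

(** Duhamel's formula restarted at [s]. The given integrals all start at 0; as W(t - s) W(s - x) =
    W(t - x), the part over [0, s] is W(t - s) applied to the integral at time [s], and it is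
    removed after pairing, between scalars. *)
Lemma mild_increment s t phi : 0 <= s -> s < t ->
  has_int leb `]s, t]
    (fun x => ip phi (W (t - x) (conv x)) + ip phi (W (t - x) (damp x)))
    (ip phi (W (t - s) (y s) - y t)).
Proof.
move=> s0 st; have t0 : 0 <= t := ltW (le_lt_trans s0 st).
have [_ My2] := My.
have [I1 [I2 [B1 B2 yt]]] := My2 t t0.
have [J1 [J2 [C1 C2 ys]]] := My2 s s0.
have ts0 : 0 <= t - s by rewrite subr_ge0 ltW.
have step (F : R -> L2 L) (I J : L2 L) :
    is_bochner_integral `[0, t] (fun x => W (t - x) (F x)) I ->
    is_bochner_integral `[0, s] (fun x => W (s - x) (F x)) J ->
    has_int leb `]s, t] (fun x => ip phi (W (t - x) (F x))) (ip phi (I - W (t - s) J)).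
  move=> /(bochner_ip phi (lexx 0)) FI /(bochner_ip phi ts0) FJ.
  rewrite ipBr; apply: (@has_intUB _ _ _ leb `[0, s]) => //.
  - rewrite -itv_bndbnd_setU ?bnd_simp//; last exact: ltW.
    by rewrite -(sg0 cW I); apply: has_int_eq FI => x _; rewrite (sg0 cW).
  - apply: has_int_eq FJ => x /=; rewrite in_itv/= => /andP[x0 xs].
    by rewrite -(sgD cW) ?subr_ge0 ?(ltW st)// subrKA.
  - apply/disj_setPS => x [] /=; rewrite !in_itv/= => /andP[_ xp] /andP[].
    by move=> /(le_lt_trans xp); rewrite ltxx.
have := has_intD (step _ _ _ B1 C1) (step _ _ _ B2 C2) (measurable_itv _).
congr has_int; rewrite -ipDr; congr ip.
rewrite yt ys 2!(linearB (W (t - s))) -(sgD cW)// subrK.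
have E (A B C I J : L2 L) : (I - B) + (J - C) = (A - B - C) - (A - I - J).
  rewrite !opprD !opprK [RHS]addrACA (addrACA A) subrr add0r.
  by rewrite (addrC I) (addrC J).
exact: E.
Qed.

Lemma mild_dist s : 0 <= s -> forall e : R, 0 < e -> exists2 d : R, 0 < d &
  forall t, 0 <= t -> `|t - s| < d -> `|y t - y s| <= e.
Proof.
move=> s0 e e0; have [My1 _] := My.
have s1 : 0 < s + 1 by rewrite ltr_wpDl.
have [cy _] := My1 _ s1.
have sin : `[0, s + 1]%classic s by rewrite /= in_itv/= s0 lerDl ler01.
have /subspace_continuousP/(_ s sin)/cvgrPdist_le/(_ _ e0) := cy.
rewrite near_withinE => -[/= d d0 H].
exists (Num.min d 1) => [|t t0]; first by rewrite lt_min d0/=.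
rewrite lt_min => /andP[td t1]; rewrite distrC; apply: H.
  by rewrite /ball/= distrC.
rewrite /= in_itv/= t0/= -lerBlDl ltW// (le_lt_trans _ t1)//.
exact: ler_norm.
Qed.

Lemma mild_bounded t : exists2 B : R, 0 <= B &
  forall s, 0 <= s -> s <= t -> `|y s| <= B.
Proof.
have [My1 _] := My; have t1 : 0 < `|t| + 1 by rewrite ltr_wpDl.
have [cy _] := My1 _ t1.
have [M [_ yM]] : bounded_set (y @` `[0, `|t| + 1]).
  by apply: compact_bounded; apply: continuous_compact => //; exact: segment_compact.
exists `|M + 1| => // s s0 st.
rewrite (le_trans (yM (M + 1) _ _ _)) ?ltrDl ?ler_norm//.
exists s => //=; rewrite in_itv/= s0 (le_trans st)//.
by rewrite (le_trans (ler_norm t))// lerDl.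
Qed.

Lemma mild_sobolev t : {ae leb, forall x, x \in `]0, t[ -> sobolev 1 (y x)}.
Proof.
have [My1 _] := My; have t1 : 0 < `|t| + 1 by rewrite ltr_wpDl.
have [_ [sy _ _]] := My1 _ t1.
apply: aeS sy => x sx xt; apply: sx; move: xt; rewrite !in_itv/= => /andP[-> xt] /=.
by rewrite (lt_le_trans xt)// (le_trans (ler_norm t))// lerDl.
Qed.

Lemma H1norm_sqr u : H1norm u ^+ 2 = `|u| ^+ 2 + `|wderiv u| ^+ 2.
Proof. by rewrite /H1norm sqr_sqrtr// addr_ge0 ?sqr_ge0. Qed.

(** The finite integral in [L2H1] does not by itself make the integrand measurable; that comes from
    the simple maps converging in the H^1 norm. *)
Lemma mild_H1 t : 0 < t ->
  exists M, has_int leb `]0, t[ (fun x => H1norm (y x) ^+ 2) M.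
Proof.
move=> t0; have [My1 _] := My; have [_ [sy [s_ [ss sc]] lt]] := My1 _ t0.
have [g mg yg] : exists2 g, measurable_fun `]0, t[ g &
    {ae leb, forall x, `]0, t[%classic x -> H1norm (y x) ^+ 2 = g x}.
  apply: (@ae_lim_measurable _ _ _ leb `]0, t[ (fun n x => H1norm (s_ n x) ^+ 2)).
    move=> n; apply: measurable_funTS.
    exact: (measurable_simple (fun u => H1norm u ^+ 2) (ss n).1).
  apply: aeS2 sy sc => x sx Nx xt; have {}sx := sx xt; have {}Nx := Nx xt.
  have cv F : (forall n, `|F n| <= H1norm (y x - s_ n x)) ->
      F n @[n --> \oo] --> (0 : R).
    move=> FH; apply/norm_cvg0P; apply: squeeze_cvgr Nx; last exact: cvg_cst.
    by apply: nearW => n; rewrite normr_ge0/=.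
  have c1 : `|s_ n x| @[n --> \oo] --> `|y x|.
    apply: cvg_norm; apply: (iffRL (cvg_distP _ _ _)); apply: (cv (fun n => `|y x - s_ n x|)) => n.
    by rewrite normr_id; exact: (H1norm_ge _).1.
  (* The simple maps take values in [sobolev 1], where [wderiv] is compatible with differences. *)
  have c2 : `|wderiv (s_ n x)| @[n --> \oo] --> `|wderiv (y x)|.
    apply: cvg_norm; apply: (iffRL (cvg_distP _ _ _)).
    apply: (cv (fun n => `|wderiv (y x) - wderiv (s_ n x)|)) => n.
    by rewrite normr_id -wderivB//; [exact: (H1norm_ge _).2|exact: (ss n).2].
  rewrite H1norm_sqr !expr2.
  under eq_fun do rewrite H1norm_sqr !expr2.
  by apply: cvgD; apply: cvgM.
exists (\int[leb]_(x in `]0, t[) g x).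
apply: (@has_int_ae _ _ _ leb _ g).
  by apply: aeS yg => x yg xt; rewrite yg.
apply: has_int_integrable => //; apply/integrableP; split.
  exact/measurable_EFinP.
apply: le_lt_trans lt; apply: ge0_le_lower_integral => //.
- by apply: measurableT_comp => //; exact/measurable_EFinP.
- by move=> x _; rewrite lee_fin sqr_ge0.
- apply: aeS yg => x yg xt; rewrite /= lee_fin -yg//.
  by rewrite ger0_norm ?sqr_ge0.
Qed.

Lemma damp_le x : `|damp x| <= us.
Proof.
rewrite /damping /sat; case: ifPn => //; rewrite -ltNge => h.
have n0 : 0 < `|a *: y x| by exact: lt_trans h.
by rewrite normrZ ger0_norm ?divfK ?gt_eqF// divr_ge0// ltW.
Qed.

Lemma ip_damp x : ip (damp x) (y x) = `|y x| * Num.min (a * `|y x|) us.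
Proof.
rewrite /damping /sat normrZ (gtr0_norm a0); case: leP => h.
  by rewrite ipZl ip_norm expr2 mulrCA.
rewrite !ipZl ip_norm.
have y0' : `|y x| != 0.
  by apply: contraTneq h => ->; rewrite mulr0 -leNgt ltW.
by field; rewrite y0' gt_eqF.
Qed.

(** The sup norm of y is controlled by its H^1 norm. By [mild_H1] the right-hand side is integrable
    in time; it is the source of every majorant below. *)
Lemma convection_le : exists2 K : R, 0 < K & forall x, sobolev 1 (y x) ->
  `|conv x| <= K * H1norm (y x) ^+ 2.
Proof.
have [K K0 uK] := crep_bound L0; exists K => // x sx.
have KH : 0 <= K * H1norm (y x) by rewrite mulr_ge0 ?(ltW K0)// sqrtr_ge0.
have [_ h] := L2mul_spec (wderiv (y x)) KH
  (crep_ae_bound L0 sx (fun z => uK (y x) z)).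
apply: le_trans h _; rewrite expr2 mulrA ler_wpM2l//.
exact: (H1norm_ge _).2.
Qed.

End mild.

(** * Weak equation and energy inequality *)

Section mild_identities.
Context (R : realType) (L : R).
Hypothesis L0 : 0 < L.
Local Notation leb := (@lebesgue_measure R).
Local Notation leb0L := (leb0L L).
Local Notation cls := (L2class L).
Context (a us : R) (W : R -> {linear L2 L -> L2 L}) (y0 : L2 L) (y : R -> L2 L).
Hypothesis a0 : 0 < a.
Hypothesis us0 : 0 < us.
Hypothesis cW : c0_contraction_semigroup W.
Hypothesis gW : generates (@kdv_op R L) (@kdv_dom R L) W.
Hypothesis My : mild_solution a us W y0 y.
Implicit Types (u v w : L2 L) (c : R) (f g : R -> R).
Local Notation conv := (convection y).
Local Notation damp := (damping a us y).

(** Used with [z] constant for the weak equation and with [z] the solution for the energy, where the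
    vector paired on each piece also moves. *)
Lemma pairing_cvg u (z : R -> L2 L) (x e : R) :
  (forall e : R, 0 < e -> exists2 d : R, 0 < d &
    forall b, x <= b -> b - x < d -> `|z b - z x| <= e) -> 0 < e ->
  exists2 d : R, 0 < d & forall b, x <= b -> b - x < d ->
    `|ip (z b) (W (b - x) u) - ip (z x) u| <= e.
Proof.
move=> zc e0; have [d1 d10 H1] := zc 1 ltr01.
have e1 : 0 < e / 2 / (`|u| + 1) by rewrite !divr_gt0// ltr_wpDl.
have [d2 d20 H2] := zc _ e1.
have e2 : 0 < e / 2 / (`|z x| + 1) by rewrite !divr_gt0// ltr_wpDl.
have [d3 d30 H3] := sg_right cW u e2.
exists (Num.min d1 (Num.min d2 d3)) => [|b xb]; first by rewrite !lt_min d10 d20.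
rewrite !lt_min => /and3P[b1 b2 b3].
have -> : ip (z b) (W (b - x) u) - ip (z x) u =
    ip (z b) (W (b - x) u - u) + ip (z b - z x) u by rewrite ipBr ipBl; ring.
rewrite (splitr e) (le_trans (ler_normD _ _))// lerD//.
  rewrite (le_trans (ip_cauchy _ _))//.
  have zb : `|z b| <= `|z x| + 1.
    by rewrite -[z b](subrK (z x)) addrC (le_trans (ler_normD _ _))// lerD2l H1.
  apply: (@le_trans _ _ ((`|z x| + 1) * (e / 2 / (`|z x| + 1)))).
    by apply: ler_pM => //; apply: H3; rewrite ?subr_ge0.
  by rewrite mulrC divfK// gt_eqF// ltr_wpDl.
rewrite (le_trans (ip_cauchy _ _))//.
apply: (@le_trans _ _ (e / 2 / (`|u| + 1) * (`|u| + 1))).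
  by apply: ler_pM => //; [exact: H2|rewrite lerDl].
by rewrite divfK// gt_eqF// ltr_wpDl.
Qed.

Lemma mild_H1_oc s t : 0 <= s -> s < t ->
  exists M, has_int leb `]s, t] (fun x => H1norm (y x) ^+ 2) M.
Proof.
move=> s0 st; have [M HM] := mild_H1 My (le_lt_trans s0 st).
have [|M' HM'] := has_int_sub HM (measurable_itv _) (measurable_itv `]s, t[).
  move=> x /=; rewrite !in_itv/= => /andP[sx ->]; rewrite andbT.
  exact: le_lt_trans sx.
by exists M'; apply: has_int_itv HM'.
Qed.

Lemma mild_sobolev_oc s t : 0 <= s ->
  {ae leb, forall x, x \in `]s, t] -> sobolev 1 (y x)}.
Proof.
move=> s0; apply: aeS (mild_sobolev My (t + 1)) => x H xst; apply: H.
move: xst; rewrite !in_itv/= => /andP[sx xt].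
by rewrite (le_lt_trans s0)//= (le_lt_trans xt)// ltrDl.
Qed.

(** On a piece ]p, q], y(q) - y(p) is W(q - p) y(p) - y(p) minus W(q - p) y(p) - y(q): the first
    difference is given by [semigroup_weak], the second by [mild_increment]. Refining the
    subdivision removes the semigroup from both integrands. *)
Lemma mild_weak (phi psi : L2 L) s t :
  (forall w, kdv_dom w -> ip (kdv_op w) phi = ip w psi) -> 0 <= s -> s < t ->
  has_int leb `]s, t]
    (fun x => ip (y x) psi - (ip phi (conv x) + ip phi (damp x)))
    (ip phi (y t) - ip phi (y s)).
Proof.
move=> adj s0 st; have [K K0 HK] := convection_le L0 y; have [M HM] := mild_H1_oc s0 st.
have [B B0 HB] := mild_bounded My t.
have mM := has_intD (has_int_const (mu := leb) (B * `|psi| + `|phi| * us)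
  (measurable_itv `]s, t]) (fin_itv s t)) (has_intZ (`|phi| * K) HM (measurable_itv _))
  (measurable_itv _).
apply: (@has_int_partition_eq _ _ _ (fun x => ip phi (y x))
  (fun p q x => ip (W (x - p) (y p)) psi -
    (ip phi (W (q - x) (conv x)) + ip phi (W (q - x) (damp x)))) _ _ _ st _ mM).
- move=> p q sp pq qt; have p0 : 0 <= p by exact: le_trans sp.
  have := has_intB (semigroup_weak L0 cW gW (y p) adj pq)
    (mild_increment cW My phi p0 pq) (measurable_itv _).
  by congr has_int; rewrite ipBl ipBr ![ip _ phi]ipC; ring.
- apply: aeS (mild_sobolev_oc t s0) => x sx xst p q sp px xq qt.
  have {}sx := HK x (sx xst).
  have p0 : 0 <= p by exact: le_trans sp.
  have qx0 : 0 <= q - x by rewrite subr_ge0.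
  have xp0 : 0 <= x - p by rewrite subr_ge0 ltW.
  rewrite (le_trans (ler_normB _ _))// -addrA lerD//.
    rewrite (le_trans (ip_cauchy _ _))// ler_wpM2r// (le_trans (sg_le cW _ xp0))//.
    by rewrite HB// (le_trans (ltW px))// (le_trans xq).
  rewrite addrC -mulrA -mulrDr -ipDr -linearD (le_trans (ip_cauchy _ _))// ler_wpM2l//.
  rewrite (le_trans (sg_le cW _ qx0))// (le_trans (ler_normD _ _))// lerD//.
  exact: damp_le.
- apply: aeW => x; rewrite in_itv/= => /andP[sx xt] e e0.
  have x0 : 0 <= x by rewrite ltW// (le_lt_trans s0).
  have e1 : 0 < e / 2 by rewrite divr_gt0.
  have [|d1 d10 H1] := @pairing_cvg (conv x + damp x) (fun=> phi) x _ _ e1.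
    by move=> e' e'0; exists 1 => // b _ _; rewrite subrr normr0 ltW.
  have e2 : 0 < e / 2 / (`|psi| + 1) / 2 by rewrite !divr_gt0// ltr_wpDl.
  have [d2 d20 H2] := mild_dist My x0 e2.
  have [d3 d30 H3] := sg_right cW (y x) e2.
  exists (Num.min d1 (Num.min d2 d3)) => [|p q sp px xq qt].
    by rewrite !lt_min d10 d20.
  rewrite !lt_min => /and3P[b1 b2 b3].
  have p0 : 0 <= p by exact: le_trans sp.
  have xpq : x - p <= q - p by rewrite lerD2r.
  have qxp : q - x <= q - p by rewrite lerD2l lerN2 ltW.
  have xp0 : 0 <= x - p by rewrite subr_ge0 ltW.
  set A1 := ip phi _; set A2 := ip phi _; set A3 := ip phi _; set A4 := ip phi _.
  have -> : ip (W (x - p) (y p)) psi - (A1 + A2) - (ip (y x) psi - (A3 + A4)) =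
      ip (W (x - p) (y p) - y x) psi - ((A1 + A2) - (A3 + A4)).
    by rewrite ipBl; ring.
  rewrite (splitr e) (le_trans (ler_normB _ _))// lerD//; last first.
    rewrite /A1 /A2 /A3 /A4 -!ipDr -linearD; apply: H1 => //.
    exact: le_lt_trans b1.
  rewrite (le_trans (ip_cauchy _ _))//.
  apply: (@le_trans _ _ (e / 2 / (`|psi| + 1) * (`|psi| + 1))); last first.
    by rewrite divfK// gt_eqF// ltr_wpDl.
  apply: ler_pM => //; last by rewrite lerDl.
  rewrite -(subrKA (W (x - p) (y x))) [leRHS]splitr.
  rewrite (le_trans (ler_normD _ _))// lerD//.
    rewrite -linearB (le_trans (sg_le cW _ xp0))// H2// distrC gtr0_norm ?subr_gt0//.
    exact: le_lt_trans b2.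
  by apply: H3 => //; exact: le_lt_trans b3.
Qed.

Lemma mild_energy s t : 0 <= s -> s < t ->
  exists2 c, has_int leb `]s, t]
    (fun x => -2 * (ip (y x) (conv x) + ip (y x) (damp x))) c &
    `|y t| ^+ 2 - `|y s| ^+ 2 <= c.
Proof.
move=> s0 st; have [K K0 HK] := convection_le L0 y; have [M HM] := mild_H1_oc s0 st.
have [B B0 HB] := mild_bounded My t.
have mM := has_intD (has_int_const (mu := leb) (2 * (B * us))
  (measurable_itv `]s, t]) (fin_itv s t)) (has_intZ (2 * (B * K)) HM (measurable_itv _))
  (measurable_itv _).
apply: (@has_int_partition _ _ _ (fun x => `|y x| ^+ 2)
  (fun p q x => -2 *
    (ip (y q) (W (q - x) (conv x)) + ip (y q) (W (q - x) (damp x)))) _ _ _ st _ mM).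
- move=> p q sp pq qt; have p0 : 0 <= p by exact: le_trans sp.
  eexists; first exact: has_intZ (mild_increment cW My (y q) p0 pq) (measurable_itv _).
  (* Expanding |y q + J|^2 <= |y p|^2 around [y q] and dropping |J|^2 leaves -2 <y q, J>; this is
     why each piece is paired with its right end. *)
  set J := _ - y q; have WE : W (q - p) (y p) = y q + J by rewrite (addrC (y q)) subrK.
  have : `|W (q - p) (y p)| ^+ 2 <= `|y p| ^+ 2.
    by rewrite ler_sqr ?nnegrE// (sg_le cW)// subr_ge0 ltW.
  rewrite WE normD_sqr => h.
  have J2 : 0 <= `|J| ^+ 2 by exact: sqr_ge0.
  rewrite lerBlDr mulNr addrC lerBrDr (le_trans _ h)// lerDl//.
- apply: aeS (mild_sobolev_oc t s0) => x sx xst p q sp px xq qt.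
  have {}sx := HK x (sx xst).
  have q0 : 0 <= q by rewrite (le_trans s0)// (le_trans sp)// (le_trans (ltW px)).
  have qx0 : 0 <= q - x by rewrite subr_ge0.
  rewrite -ipDr -linearD normrM normrN (ger0_norm (ler0n _ 2)).
  have -> : 2 * (B * us) + 2 * (B * K) * H1norm (y x) ^+ 2 =
      2 * (B * (us + K * H1norm (y x) ^+ 2)) by ring.
  rewrite ler_wpM2l// (le_trans (ip_cauchy _ _))//.
  apply: ler_pM => //; first exact: HB.
  rewrite (le_trans (sg_le cW _ qx0))// (le_trans (ler_normD _ _))// addrC lerD//.
  exact: damp_le.
- apply: aeW => x; rewrite in_itv/= => /andP[sx xt] e e0.
  have x0 : 0 <= x by rewrite ltW// (le_lt_trans s0).
  have e1 : 0 < e / 2 by rewrite divr_gt0.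
  have [|d1 d10 H1] := @pairing_cvg (conv x + damp x) y x _ _ e1.
    move=> e' e'0; have [d d0 H] := mild_dist My x0 e'0.
    exists d => // b xb bx; apply: H; first exact: le_trans xb.
    by rewrite ger0_norm// subr_ge0.
  exists d1 => // p q sp px xq qt pq.
  rewrite -mulrBr -!ipDr -linearD normrM normrN (ger0_norm (ler0n _ 2)) mulrC -ler_pdivlMr//.
  by apply: H1 => //; apply: le_lt_trans pq; rewrite lerD2l lerN2 ltW.
Qed.

End mild_identities.

(** * Traces of mild solutions at the end points *)

Section traces.
Context (R : realType) (L : R).
Hypothesis L0 : 0 < L.
Local Notation leb := (@lebesgue_measure R).
Local Notation leb0L := (leb0L L).
Local Notation cls := (L2class L).
Local Notation L2one := (@L2one R L).
Implicit Types (u v w : L2 L) (c : R) (f g : R -> R).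

Lemma cls_cvg0 (p : nat -> R -> R) B : (forall n, continuous (p n)) ->
  (forall n x, x \in `[0, L] -> `|p n x| <= B) ->
  (forall x, x \in `]0, L[ -> p n x @[n --> \oo] --> (0 : R)) ->
  cls (p n) @[n --> \oo] --> (0 : L2 L).
Proof.
move=> cp pB p0.
have -> : 0 = cls (cst 0).
  rewrite (_ : cst 0 = cst 0 * cst 1); first by rewrite L2classZ ?scale0r// Lfun2_cst.
  by apply/funext => t; rewrite !fctE mul0r.
apply: (L2_dct (g := cst B)).
- by move=> n; exact: Lfun2_continuous.
- exact: Lfun2_cst.
- exact: Lfun2_cst.
- by apply/ae_leb0LP; apply: aeW.
- move=> n; apply/ae_leb0LP; apply: aeW => x xL.
  by apply: pB; exact: subset_itv_oo_cc.
Qed.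

(* Test functions concentrated at the end points where [layz] is 1: as n grows,
   [lay0] and [lay1] vanish while [lay2], close to [layz ^+ n.+1], vanishes inside
   ]0, L[ only. In the weak equation tested against [lay0 l n] only the boundary
   terms of [- \int y_x lay2 + [y lay2]_0^L] survive. *)
Record layer := Layer {
  lay0 : nat -> R -> R; lay1 : nat -> R -> R; lay2 : nat -> R -> R;
  lay3 : nat -> R -> R; layz : R -> R; layC : R;
  lay_d0 : forall n x, is_derive x (1 : R) (lay0 n) (lay1 n x);
  lay_d1 : forall n x, is_derive x (1 : R) (lay1 n) (lay2 n x);
  lay_d2 : forall n x, is_derive x (1 : R) (lay2 n) (lay3 n x);
  lay_c3 : forall n, continuous (lay3 n);
  lay_00 : forall n, lay0 n 0 = 0;
  lay_0L : forall n, lay0 n L = 0;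
  lay_10 : forall n, lay1 n 0 = 0;
  lay_b0 : forall n x, x \in `[0, L] -> `|lay0 n x| <= layC / n.+1%:R;
  lay_b1 : forall n x, x \in `[0, L] -> `|lay1 n x| <= layC / n.+1%:R;
  lay_b2 : forall n x, x \in `[0, L] -> `|lay2 n x - layz x ^+ n.+1| <= layC / n.+1%:R;
  lay_z : forall x, x \in `[0, L] -> 0 <= layz x <= 1;
  lay_z1 : forall x, x \in `]0, L[ -> layz x < 1;
  lay_z0 : layz 0 ^+ 2 = layz 0;
  lay_zL : layz L ^+ 2 = layz L }.

Lemma idem_exp (z : R) n : z ^+ 2 = z -> z ^+ n.+1 = z.
Proof. by move=> z2; elim: n => // n IH; rewrite exprS IH -expr2. Qed.

Lemma harmonic_cvg0 C : C / n.+1%:R @[n --> \oo] --> (0 : R).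
Proof.
rewrite -[X in _ --> X](mulr0 C); apply: cvgM; first exact: cvg_cst.
exact: cvg_harmonic.
Qed.

Lemma squeeze0 (f g : nat -> R) : (forall n, `|f n| <= g n) ->
  g n @[n --> \oo] --> (0 : R) -> f n @[n --> \oo] --> (0 : R).
Proof.
move=> fg g0; apply/norm_cvg0P; apply: squeeze_cvgr g0; last exact: cvg_cst.
by apply: nearW => n; rewrite normr_ge0/=.
Qed.

Lemma lay_C0 (l : layer) : 0 <= layC l.
Proof.
have h : 0 \in `[0, L] by rewrite in_itv/= lexx ltW.
by have := le_trans (normr_ge0 _) (lay_b0 l 0%N h); rewrite divr1.
Qed.

Lemma lay_harm (l : layer) n : layC l / n.+1%:R <= layC l.
Proof. by rewrite ler_pdivrMr// ler_peMr ?lay_C0// ler1n. Qed.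

Lemma lay_cvg2 (l : layer) x (z : R) : x \in `[0, L] ->
  layz l x ^+ n.+1 @[n --> \oo] --> z -> lay2 l n x @[n --> \oo] --> z.
Proof.
move=> xL zz.
have h : lay2 l n x - layz l x ^+ n.+1 @[n --> \oo] --> (0 : R).
  by apply: (squeeze0 _ (harmonic_cvg0 (layC l))) => n; exact: lay_b2.
have -> : lay2 l ^~ x = (fun n => lay2 l n x - layz l x ^+ n.+1 + layz l x ^+ n.+1).
  by apply/funext => n; rewrite subrK.
by rewrite -[X in _ --> X]add0r; exact: cvgD.
Qed.

Lemma lay_bound2 (l : layer) n x : x \in `[0, L] -> `|lay2 l n x| <= layC l + 1.
Proof.
move=> xL; rewrite -[lay2 l n x](subrK (layz l x ^+ n.+1)).
have /andP[z0 z1] := lay_z l xL.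
rewrite (le_trans (ler_normD _ _))// lerD//.
  by rewrite (le_trans (lay_b2 l n xL))// lay_harm.
by rewrite ger0_norm ?exprn_ge0// exprn_ile1.
Qed.

Context (a us : R) (W : R -> {linear L2 L -> L2 L}) (y0 : L2 L) (y : R -> L2 L).
Hypothesis us0 : 0 < us.
Hypothesis cW : c0_contraction_semigroup W.
Hypothesis gW : generates (@kdv_op R L) (@kdv_dom R L) W.
Hypothesis My : mild_solution a us W y0 y.
Local Notation conv := (convection y).
Local Notation damp := (damping a us y).

Lemma layer_traces (l : layer) s t : 0 <= s -> s < t ->
  has_int leb `]s, t]
    (fun x => crep (y x) L * layz l L - crep (y x) 0 * layz l 0) 0.
Proof.
move=> s0 st.
have c2 n := is_derive_continuous (lay_d2 l n).
have c1 n := is_derive_continuous (lay_d1 l n).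
have c0 n := is_derive_continuous (lay_d0 l n).
pose C := layC l; pose B := C + 1.
have C0 : 0 <= C := lay_C0 l; have B0 : 0 <= B by rewrite addr_ge0.
have CB : C <= B by rewrite lerDl.
have bB n : C / n.+1%:R <= B by rewrite (le_trans (lay_harm l n)).
have b0 n x : x \in `[0, L] -> `|lay0 l n x| <= B.
  by move=> xL; rewrite (le_trans (lay_b0 l n xL)).
have b1 n x : x \in `[0, L] -> `|lay1 l n x| <= B.
  by move=> xL; rewrite (le_trans (lay_b1 l n xL)).
have b2 n x : x \in `[0, L] -> `|lay2 l n x| <= B by exact: lay_bound2.
have in0 : 0 \in `[0, L] by rewrite in_itv/= lexx ltW.
have inL : L \in `[0, L] by rewrite in_itv/= lexx ltW.
have l0 : cls (lay0 l n) @[n --> \oo] --> (0 : L2 L).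
  apply: (cls_cvg0 c0 b0) => x xL; have {}xL : x \in `[0, L] by exact: subset_itv_oo_cc.
  by apply: (squeeze0 _ (harmonic_cvg0 (layC l))) => n; exact: lay_b0.
have l1 : cls (lay1 l n) @[n --> \oo] --> (0 : L2 L).
  apply: (cls_cvg0 c1 b1) => x xL; have {}xL : x \in `[0, L] by exact: subset_itv_oo_cc.
  by apply: (squeeze0 _ (harmonic_cvg0 (layC l))) => n; exact: lay_b1.
have l2 : cls (lay2 l n) @[n --> \oo] --> (0 : L2 L).
  apply: (cls_cvg0 c2 b2) => x xL; have xL' : x \in `[0, L] by exact: subset_itv_oo_cc.
  apply: lay_cvg2 => //; have /andP[z0 _] := lay_z l xL'.
  have := cvg_expr (_ : `|layz l x| < 1); rewrite ger0_norm// => /(_ (lay_z1 l xL)).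
  by rewrite -(cvg_shiftS _).
have lL : lay2 l n L @[n --> \oo] --> layz l L.
  apply: lay_cvg2 => //; apply: cvg_near_cst; apply: nearW => n.
  by rewrite idem_exp// lay_zL.
have l00 : lay2 l n 0 @[n --> \oo] --> layz l 0.
  apply: lay_cvg2 => //; apply: cvg_near_cst; apply: nearW => n.
  by rewrite idem_exp// lay_z0.
have HW n := mild_weak L0 us0 cW gW My (fun w dw => kdv_adjoint L0 dw (lay_d0 l n)
  (lay_d1 l n) (lay_d2 l n) (@lay_c3 l n) (lay_00 l n) (lay_0L l n) (lay_10 l n)) s0 st.
(* Only [lay0], [lay1] and [lay2] are bounded uniformly in n, so [lay3] is integrated by parts; this
   is what produces the traces. *)
have E x n : sobolev 1 (y x) -> ip (y x) (cls (lay1 l n) + cls (lay3 l n)) =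
    ip (y x) (cls (lay1 l n)) + (crep (y x) L * lay2 l n L - crep (y x) 0 * lay2 l n 0
     - ip (wderiv (y x)) (cls (lay2 l n))).
  move=> sx; rewrite ipDr; congr (_ + _).
  by rewrite (sobolev_ibp L0 sx (lay_d2 l n) (@lay_c3 l n)) opprB addrC subrK.
have [K K0 HK] := convection_le L0 y; have [M HM] := mild_H1_oc My s0 st.
have [KT KT0 HT] := crep_bound L0.
set o := `|L2one|.
pose D := B * o + (KT * B + KT * B + B * o).
have D0 : 0 <= D by rewrite /D /o; do !apply: addr_ge0; rewrite ?mulr_ge0 ?(ltW KT0).
have mM := has_intD (has_int_const (mu := leb) (D + B * o * us)
  (measurable_itv `]s, t]) (fin_itv s t))
  (has_intZ (D + B * o * K) HM (measurable_itv _)) (measurable_itv _).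
have nle (p : nat -> R -> R) n : (forall n, continuous (p n)) ->
    (forall n x, x \in `[0, L] -> `|p n x| <= B) -> `|cls (p n)| <= B * o.
  move=> cp pB; apply: norm_cls_le => //; first exact: Lfun2_continuous.
  by move=> x xL; apply: pB; exact: subset_itv_oo_cc.
have [||c hc cc] := @has_int_dom _ _ _ leb _ _
  (fun x => crep (y x) L * layz l L - crep (y x) 0 * layz l 0) _ _ _
  HW mM (measurable_itv _).
- apply: aeS (mild_sobolev_oc My t s0) => x sx xst; have {}sx := sx xst.
  under eq_fun do rewrite E//.
  have -> : crep (y x) L * layz l L - crep (y x) 0 * layz l 0 =
    ip (y x) 0 + (crep (y x) L * layz l L - crep (y x) 0 * layz l 0 -
      ip (wderiv (y x)) 0) - (ip 0 (conv x) + ip 0 (damp x)).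
    by rewrite ![ip 0 _]ipC !linear0 add0r !addr0 subr0.
  apply: cvgB; last first.
    by apply: cvgD; apply: ip_cvg2 => //; exact: cvg_cst.
  apply: cvgD; first exact: ip_cvg.
  apply: cvgB; last exact: ip_cvg.
  by apply: cvgB; apply: cvgM => //; exact: cvg_cst.
- move=> n; apply: aeS (mild_sobolev_oc My t s0) => x sx xst; have {}sx := sx xst.
  have [h1 h2] := H1norm_ge (y x); have h3 := HK x sx.
  have H0 : 0 <= H1norm (y x) by exact: sqrtr_ge0.
  set H := H1norm (y x) in h1 h2 h3 H0 *.
  (* Terms linear in the H^1 norm are absorbed in the same integrable majorant as the quadratic
     one. *)
  have HH : H <= 1 + H ^+ 2 by nra.
  apply: (@le_trans _ _ (D * H + B * o * (us + K * H ^+ 2))); last first.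
    have := ler_wpM2l D0 HH; lra.
  rewrite (le_trans (ler_normB _ _))// lerD//.
        rewrite E// /D.
    have -> : (B * o + (KT * B + KT * B + B * o)) * H =
      H * (B * o) + ((KT * H) * B + (KT * H) * B + H * (B * o)) by ring.
    have hn0 u v : `|u| <= H -> `|v| <= B * o -> `|ip u v| <= H * (B * o).
      by move=> h h'; rewrite (le_trans (ip_cauchy _ _))// ler_pM.
    rewrite (le_trans (ler_normD _ _))// lerD//; first exact/hn0/nle.
    rewrite (le_trans (ler_normB _ _))// lerD//; last exact/hn0/nle.
    rewrite (le_trans (ler_normB _ _))// lerD// normrM.
      by apply: ler_pM => //; [exact: HT|exact: b2].
    by apply: ler_pM => //; [exact: HT|exact: b2].
  rewrite -ipDr (le_trans (ip_cauchy _ _))// ler_pM ?nle//.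
  by rewrite (le_trans (ler_normD _ _))// addrC lerD// damp_le.
suff c_0 : c = 0 by move: hc; rewrite c_0.
apply: (cvg_unique _ cc) => //; rewrite -(subrr (ip (0 : L2 L) (y s))).
have {1}-> : ip (0 : L2 L) (y s) = ip 0 (y t) by rewrite ![ip 0 _]ipC !linear0.
by apply: cvgB; apply: ip_cvg2 => //; exact: cvg_cst.
Qed.

End traces.

(** * Construction of the boundary layers *)

Section layers.
Context (R : realType) (L : R).
Hypothesis L0 : 0 < L.

Lemma is_derive_affineX (e k x : R) n :
  is_derive x (1 : R) (fun x => (e + k * x) ^+ n.+1) (n.+1%:R * k * (e + k * x) ^+ n).
Proof.
have := is_deriveX n.+1 (is_deriveD (is_derive_cst e x (1 : R))
  (is_deriveZ k (is_derive_id x (1 : R)))).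
move/is_derive_ext; apply => [y|] //; rewrite /GRing.scale/= !fctE/=; ring.
Qed.

Lemma is_derive_quad (A B C x : R) :
  is_derive x (1 : R) (fun x => A + B * x + C * x ^+ 2) (B + C * 2 * x).
Proof.
have := is_deriveD (is_deriveD (is_derive_cst A x (1 : R))
  (is_deriveZ B (is_derive_id x (1 : R)))) (is_deriveZ C (is_deriveX 2 (is_derive_id x (1 : R)))).
move/is_derive_ext; apply => [y|] //; rewrite /GRing.scale/=; ring.
Qed.

Lemma is_derive_ZB (c k x df dg : R) f g : is_derive x (1 : R) f df ->
  is_derive x (1 : R) g dg ->
  is_derive x (1 : R) (fun x => c * (k * f x - g x)) (c * (k * df - dg)).
Proof.
move=> hf hg; have := is_deriveZ c (is_deriveB (is_deriveZ k hf) hg).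
by move/is_derive_ext; apply.
Qed.

(* With z the affine function equal to [b] at 0 and to [~~ b] at L, [lay0] is a
   multiple of z^(n+3) minus the quadratic polynomial that restores
   [lay0 0 = lay1 0 = lay0 L = 0]. *)
Lemma boundary_layer (b : bool) :
  exists l : layer L, layz l 0 = b%:R /\ layz l L = (~~ b)%:R.
Proof.
(* The slope is 1 / L or -1 / L, so that z runs from e at 0 to 1 - e at L. *)
pose e : R := b%:R; pose k : R := (1 - e *+ 2) / L.
(* Normalised so that, as (k L)^2 = 1, the second derivative of c z^(n+3) is exactly z^(n+1). *)
pose c n : R := L ^+ 2 / (n.+2%:R * n.+3%:R).
(* Since e is idempotent, e + (n+3) k e x is the tangent to z^(n+3) at 0; this coefficient of x^2
   then corrects the value at L. *)
pose C n : R := ((~~ b)%:R - e - n.+3%:R * k * e * L) / L ^+ 2.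
pose z x := e + k * x.
pose p0 n x := c n * (z x ^+ n.+3 - (e + n.+3%:R * k * e * x + C n * x ^+ 2)).
pose p1 n x := c n * (n.+3%:R * k * z x ^+ n.+2 - (n.+3%:R * k * e + C n * 2 * x)).
pose p2 n x := c n * (n.+3%:R * k * (n.+2%:R * k * z x ^+ n.+1) - C n * 2).
pose p3 n x := c n * (n.+3%:R * k * (n.+2%:R * k * (n.+1%:R * k * z x ^+ n))).
have Ln0 : L != 0 by rewrite gt_eqF.
have kL : k * L = 1 - e *+ 2 by rewrite divfK.
have kL2 : (k * L) ^+ 2 = 1.
  by rewrite kL /e; case: (b); rewrite ?mulr0n ?mulr1n; ring.
have z0 : z 0 = e by rewrite /z mulr0 addr0.
have zL : z L = (~~ b)%:R.
  by rewrite /z kL /e; case: (b); rewrite ?mulr0n ?mulr1n/=; ring.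
have eX n : e ^+ n.+1 = e by rewrite /e; case: (b); rewrite ?expr1n ?expr0n.
have nX n : ((~~ b)%:R : R) ^+ n.+1 = (~~ b)%:R by case: (b); rewrite ?expr1n ?expr0n.
have z01 x : x \in `[0, L] -> 0 <= z x <= 1.
  rewrite in_itv/= => /andP[x0 xL]; rewrite /z /k /e; case: (b).
    rewrite mulr1n; have -> : 1 + (1 - 1 *+ 2) / L * x = 1 - x / L by ring.
    by rewrite subr_ge0 gerBl ler_pdivrMr// mul1r xL divr_ge0// ltW.
  rewrite mulr0n mul0rn subr0 add0r mul1r mulrC.
  by rewrite divr_ge0 ?ler_pdivrMr ?mul1r// ltW.
have z1 x : x \in `]0, L[ -> z x < 1.
  rewrite in_itv/= => /andP[x0 xL]; rewrite /z /k /e; case: (b).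
    rewrite mulr1n; have -> : 1 + (1 - 1 *+ 2) / L * x = 1 - x / L by ring.
    by rewrite gtrBl divr_gt0.
  by rewrite mulr0n mul0rn subr0 add0r mul1r mulrC ltr_pdivrMr ?mul1r.
clearbody k.
have d0 n x : is_derive x (1 : R) (p0 n) (p1 n x).
  have := is_derive_ZB (c n) 1 (is_derive_affineX e k x n.+2)
    (is_derive_quad e (n.+3%:R * k * e) (C n) x).
  by move/is_derive_ext; apply; [move=> y|]; rewrite mul1r.
have d1 n x : is_derive x (1 : R) (p1 n) (p2 n x).
  have := is_derive_ZB (c n) (n.+3%:R * k) (is_derive_affineX e k x n.+1)
    (is_derive_quad (n.+3%:R * k * e) (C n * 2) 0 x).
  move/is_derive_ext; apply => [y|]; first by rewrite mul0r addr0.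
  by rewrite !mul0r addr0.
have d2 n x : is_derive x (1 : R) (p2 n) (p3 n x).
  have := is_derive_ZB (c n) (n.+3%:R * k * (n.+2%:R * k)) (is_derive_affineX e k x n)
    (is_derive_quad (C n * 2) 0 0 x).
  by move/is_derive_ext; apply => [y|]; rewrite ?/p2 ?/p3 /z; ring.
have c3 n : continuous (p3 n).
  move=> x; apply: cvgM; first exact: cvg_cst.
  do 3 (apply: cvgM; first exact: cvg_cst).
  apply: (@continuous_comp _ _ _ z (@GRing.exp R ^~ n)); last exact: exprn_continuous.
  apply: cvgD; first exact: cvg_cst.
  by apply: cvgM; [exact: cvg_cst|exact: cvg_id].
have CL n : C n * L ^+ 2 = (~~ b)%:R - e - n.+3%:R * k * e * L.
  by rewrite divfK// expf_neq0.
have p00 n : p0 n 0 = 0 by rewrite /p0 z0 eX; ring.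
have p0L n : p0 n L = 0 by rewrite /p0 zL nX CL; ring.
have p10 n : p1 n 0 = 0 by rewrite /p1 z0 eX; ring.
(* It dominates K L^2 for the factors K = 4, 4 / L and 2 / L^2 met in bounding [p0], [p1] and
   [p2 - z ^+ n.+1]. *)
pose M : R := 4 * (L ^+ 2 + L + 1).
have n1 n : (0 : R) < n.+1%:R by [].
have n2 n : (0 : R) < n.+2%:R by [].
have n3 n : (0 : R) < n.+3%:R by [].
have n12 n : (n.+1%:R : R) <= n.+2%:R by rewrite ler_nat.
have n23 n : (n.+2%:R : R) <= n.+3%:R by rewrite ler_nat.
have c0 n : 0 <= c n by rewrite divr_ge0 ?sqr_ge0 ?mulr_ge0.
have cn n : c n * n.+3%:R <= L ^+ 2 / n.+1%:R.
  rewrite /c invfM mulrA divfK ?gt_eqF// ler_wpM2l ?sqr_ge0//.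
  by rewrite lef_pV2 ?posrE.
have zX x m : x \in `[0, L] -> `|z x ^+ m| <= 1.
  by move=> /z01/andP[z0' z1']; rewrite ger0_norm ?exprn_ge0 ?exprn_ile1.
have e1 : `|e| <= 1 by rewrite /e; case: (b); rewrite ?normr1 ?normr0.
have kV : `|k| = L^-1.
  apply: (mulIf Ln0); rewrite mulVf// -[X in _ * X](gtr0_norm L0) -normrM.
  by apply/eqP; rewrite -sqr_norm_eq1 kL2.
have CLn n : `|C n| <= n.+3%:R / L ^+ 2.
  rewrite normrM normfV (ger0_norm (sqr_ge0 L)) ler_pM2r ?invr_gt0 ?exprn_gt0//.
  have -> : n.+3%:R * k * e * L = n.+3%:R * (k * L) * e by ring.
  rewrite kL /e; case: (b) => /=; rewrite ?mulr1n ?mulr0n.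
    rewrite (_ : _ - _ = n.+2%:R) ?normr_nat ?ler_nat//.
    by rewrite -[n.+3]addn1 natrD; ring.
  by rewrite !mulr0 !subr0 normr1 ler1n.
clearbody C.
have xn x : x \in `[0, L] -> `|x| <= L.
  by rewrite in_itv/= => /andP[x0 xL]; rewrite ger0_norm.
have MK n K : 0 <= K -> K * L ^+ 2 <= M -> K * (c n * n.+3%:R) <= M / n.+1%:R.
  move=> K0 KM; apply: (@le_trans _ _ (K * (L ^+ 2 / n.+1%:R))).
    by rewrite ler_wpM2l.
  by rewrite mulrA ler_wpM2r.
have L2V : L ^+ 2 / L ^+ 2 = 1 by rewrite divff// expf_neq0.
have LV : L / L = 1 by rewrite divff.
have L20 : 0 <= L ^+ 2 by exact: sqr_ge0.
have b0 n x : x \in `[0, L] -> `|p0 n x| <= M / n.+1%:R.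
  move=> xL; apply: le_trans (MK n 4 _ _) => //; last by rewrite ler_wpM2l//; move: L0 L20; lra.
  rewrite /p0 normrM (ger0_norm (c0 n)) [leRHS]mulrCA ler_wpM2l//.
  rewrite (le_trans (ler_normB _ _))//.
  have h1 := zX x n.+3 xL.
  have h2 : `|n.+3%:R * k * e * x| <= n.+3%:R.
    rewrite !normrM normr_nat kV -!mulrA ler_piMr// mulrC ler_pdivrMr// mul1r.
    by rewrite -[leRHS]mul1r ler_pM// xn.
  have h3 : `|C n * x ^+ 2| <= n.+3%:R.
    rewrite normrM normrX (@le_trans _ _ (`|C n| * L ^+ 2))//.
      by rewrite ler_wpM2l// ler_sqr ?nnegrE ?xn// ltW.
    by rewrite -ler_pdivlMr ?exprn_gt0.
  have h4 := ler_normD (e + n.+3%:R * k * e * x) (C n * x ^+ 2).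
  have h5 := ler_normD e (n.+3%:R * k * e * x).
  have h6 : (1 : R) <= n.+3%:R by rewrite ler1n.
  lra.
have b1 n x : x \in `[0, L] -> `|p1 n x| <= M / n.+1%:R.
  move=> xL; apply: le_trans (MK n (4 / L) _ _) => //.
  - rewrite /p1 normrM (ger0_norm (c0 n)) [leRHS]mulrCA ler_wpM2l//.
    rewrite (le_trans (ler_normB _ _))//.
    have nk : 0 <= n.+3%:R / L by rewrite divr_ge0// ltW.
    have h1 : `|n.+3%:R * k * z x ^+ n.+2| <= n.+3%:R / L.
      rewrite normrM (le_trans (ler_wpM2l _ (zX x n.+2 xL)))//.
      by rewrite mulr1 normrM normr_nat kV.
    have h2 : `|n.+3%:R * k * e| <= n.+3%:R / L.
      by rewrite !normrM normr_nat kV ler_piMr.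
    have h3 : `|C n * 2 * x| <= 2 * (n.+3%:R / L).
      rewrite !normrM (ger0_norm (ler0n _ 2)) mulrAC mulrC ler_wpM2l//.
      have -> : n.+3%:R / L = n.+3%:R / L ^+ 2 * L by rewrite expr2 invfM; field.
      by rewrite ler_pM// xn.
    have h4 := ler_normD (n.+3%:R * k * e) (C n * 2 * x).
    lra.
  - by rewrite divr_ge0// ltW.
  - rewrite (_ : 4 / L * L ^+ 2 = 4 * L); last by field.
    by rewrite ler_wpM2l//; move: L0 L20; lra.
have b2 n x : x \in `[0, L] -> `|p2 n x - z x ^+ n.+1| <= M / n.+1%:R.
  move=> xL; apply: le_trans (MK n (2 / L ^+ 2) _ _) => //.
  - rewrite (_ : _ - _ = - (2 * c n * C n)); last first.
      rewrite /p2 mulrBr.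
      have -> : c n * (n.+3%:R * k * (n.+2%:R * k * z x ^+ n.+1)) =
          (k * L) ^+ 2 * z x ^+ n.+1.
        rewrite /c; field; by rewrite !gt_eqF.
      by rewrite kL2; ring.
    rewrite normrN normrM normrM (ger0_norm (ler0n _ 2)) (ger0_norm (c0 n)).
    rewrite (_ : 2 / _ * _ = 2 * c n * (n.+3%:R / L ^+ 2)); last by field.
    by rewrite ler_wpM2l// mulr_ge0.
  - by rewrite divr_ge0.
  - by rewrite divfK ?expf_neq0//; rewrite /M; move: L0 L20; lra.
have zz0 : z 0 ^+ 2 = z 0 by rewrite z0 eX.
have zzL : z L ^+ 2 = z L by rewrite zL nX.
by exists (Layer d0 d1 d2 c3 p00 p0L p10 b0 b1 b2 z01 z1 zz0 zzL).
Qed.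

End layers.

(** * Decay *)

Section decay.
Context (R : realType) (L : R).
Hypothesis L0 : 0 < L.
Local Notation leb := (@lebesgue_measure R).
Context (a us : R) (W : R -> {linear L2 L -> L2 L}) (y0 : L2 L) (y : R -> L2 L).
Hypothesis a0 : 0 < a.
Hypothesis us0 : 0 < us.
Hypothesis cW : c0_contraction_semigroup W.
Hypothesis gW : generates (@kdv_op R L) (@kdv_dom R L) W.
Hypothesis My : mild_solution a us W y0 y.
Local Notation conv := (convection y).
Local Notation damp := (damping a us y).

(** The layer equal to 1 at the chosen end and 0 at the other isolates one trace in [layer_traces];
    its integral over every ]0, t] vanishes, hence so does the trace almost everywhere. *)
Lemma mild_trace (b : bool) T : 0 < T ->
  {ae leb, forall x, x \in `]0, T[ -> crep (y x) (if b then L else 0) = 0}.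
Proof.
move=> T0; have [l [l0 lL]] := boundary_layer L0 (~~ b).
have H t : 0 < t -> has_int leb `]0, t] (fun x => crep (y x) (if b then L else 0)) 0.
  move=> t0; have := layer_traces L0 us0 cW gW My l (lexx 0) t0; rewrite l0 lL negbK.
  case: (b); rewrite /= ?mulr0n ?mulr1n => h.
    by apply: has_int_eq h => x _; rewrite mulr1 mulr0 subr0.
  rewrite -[X in has_int _ _ _ X](mulr0 (-1)).
  have h' := has_intZ (-1) h (measurable_itv _).
  by apply: has_int_eq h' => x _; rewrite mulr1 mulr0 sub0r mulN1r opprK.
apply: (@has_int_vanish _ _ T 0); first exact: has_int_itv (H T T0).
by move=> t t0 _; exact: H.
Qed.

Lemma mild_convection0 s t : 0 <= s -> s < t ->
  {ae leb, forall x, x \in `]s, t] -> ip (y x) (conv x) = 0}.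
Proof.
move=> s0 st; have t0 : 0 < t + 1 by rewrite ltr_wpDl// (le_trans s0)// ltW.
apply: aeS3 (mild_sobolev_oc My t s0) (mild_trace false t0) (mild_trace true t0).
move=> x sx cx0 cxL xst; rewrite ipC ip_convection//; last exact: sx.
have xI : x \in `]0, t + 1[.
  move: xst; rewrite !in_itv/= => /andP[? xt].
  by rewrite (le_lt_trans s0)//= (le_lt_trans xt)// ltrDl.
by rewrite (cx0 xI) (cxL xI) subrr mul0r.
Qed.

Lemma mild_dissipation s t k : 0 <= s -> s < t ->
  (forall x, x \in `]s, t] -> k <= `|y x| * Num.min (a * `|y x|) us) ->
  `|y t| ^+ 2 + 2 * k * (t - s) <= `|y s| ^+ 2.
Proof.
move=> s0 st Hk; have [c hc] := mild_energy L0 us0 cW My s0 st.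
suff : c <= - 2 * k * (t - s) by lra.
have -> : - 2 * k * (t - s) = - 2 * k * fine (leb `]s, t]).
  by rewrite lebesgue_measure_itv/= lte_fin st.
apply: (has_int_le hc (has_int_const (mu := leb) (-2 * k) (measurable_itv _)
  (fin_itv _ _)) (measurable_itv _)).
apply: aeS (mild_convection0 s0 st) => x c0 xst.
by rewrite c0// add0r ler_wnM2l// ipC ip_damp// Hk.
Qed.

Lemma mild_nonincreasing s t : 0 <= s -> s <= t -> `|y t| <= `|y s|.
Proof.
move=> s0; rewrite le_eqVlt => /predU1P[->//|st].
rewrite -ler_sqr ?nnegrE//.
have := @mild_dissipation s t 0 s0 st; rewrite mulr0 mul0r addr0; apply => x _.
by rewrite mulr_ge0// le_min mulr_ge0 ?(ltW us0)// ltW.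
Qed.

(** An implicit Euler step. As the norm is nonincreasing, |y x| >= |y t| on ]s, t], while mu |y x|
    <= us stays below saturation; the dissipation is then at least mu |y t|^2. *)
Lemma mild_step mu s t : 0 <= mu -> mu <= a -> 0 <= s -> s < t ->
  mu * `|y s| <= us ->
  `|y t| ^+ 2 * (1 + 2 * mu * (t - s)) <= `|y s| ^+ 2.
Proof.
move=> m0 ma s0 st ms; have := @mild_dissipation s t (mu * `|y t| ^+ 2) s0 st.
rewrite (_ : _ + _ = `|y t| ^+ 2 * (1 + 2 * mu * (t - s))); last by ring.
apply => x; rewrite in_itv/= => /andP[sx xt].
have x0 : 0 <= x by rewrite (le_trans s0)// ltW.
have tx := mild_nonincreasing x0 xt; have xs := mild_nonincreasing s0 (ltW sx).
apply: (@le_trans _ _ (`|y x| * (mu * `|y x|))).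
  by rewrite [leRHS]mulrCA ler_wpM2l// -expr2 ler_sqr ?nnegrE.
by rewrite ler_wpM2l// le_min ler_wpM2r//= (le_trans _ ms)// ler_wpM2l.
Qed.

(** Take inverses in e^(-x) >= 1 - x at x = z / (1 + z). It bounds (1 + z / n)^n below by an
    exponential whose exponent tends to z. *)
Lemma expR_frac_le (z : R) : 0 <= z -> expR (z / (1 + z)) <= 1 + z.
Proof.
move=> z0; have z1 : 0 < 1 + z by rewrite ltr_pwDl.
rewrite -lef_pV2 ?posrE ?expR_gt0// -expRN; apply: le_trans (expR_ge1Dx _).
by rewrite (_ : 1 + - _ = (1 + z)^-1)//; field; rewrite gt_eqF.
Qed.

(* [mild_step] iterated n times gives (1 + z / n)^n, which tends to e^z. *)
Lemma mild_decay mu s t : 0 <= mu -> mu <= a -> 0 <= s -> s <= t ->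
  mu * `|y s| <= us -> `|y t| <= `|y s| * expR (- mu * (t - s)).
Proof.
move=> m0 ma s0; rewrite le_eqVlt => /predU1P[<- _|st ms].
  by rewrite subrr mulr0 expR0 mulr1.
pose z := 2 * mu * (t - s).
have z0 : 0 <= z by rewrite !mulr_ge0// subr_ge0 ltW.
have step n k : (k <= n.+1)%N -> `|y (s + k%:R * ((t - s) / n.+1%:R))| ^+ 2 *
    (1 + z / n.+1%:R) ^+ k <= `|y s| ^+ 2.
  set h := (t - s) / n.+1%:R; have h0 : 0 < h by rewrite divr_gt0// subr_gt0.
  elim: k => [_|k IH kn]; first by rewrite mul0r addr0 expr0 mulr1.
  have sk : 0 <= s + k%:R * h by rewrite addr_ge0// mulr_ge0// ltW.
  apply: le_trans (IH (ltnW kn)); rewrite [(1 + _) ^+ k.+1]exprS [_ ^+ 2 * (_ * _)]mulrA.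
  have z1 : 0 <= 1 + z / n.+1%:R by rewrite addr_ge0// divr_ge0.
  apply: ler_wpM2r; first exact: exprn_ge0.
  have := @mild_step mu (s + k%:R * h) (s + k.+1%:R * h) m0 ma sk.
  rewrite -natr1 mulrDl mul1r addrA ltrDl => /(_ h0).
  rewrite (_ : 2 * mu * _ = z / n.+1%:R); last by rewrite /z /h; field.
  (* The condition mu |y| <= us persists along the steps because the norm is nonincreasing. *)
  apply; rewrite (le_trans _ ms)// ler_wpM2l//.
  by apply: mild_nonincreasing => //; rewrite lerDl mulr_ge0// ltW.
have exp_le n : `|y t| ^+ 2 * expR (z / (1 + z / n.+1%:R)) <= `|y s| ^+ 2.
  apply: le_trans (step n n.+1 (leqnn _)).
  rewrite (_ : s + _ = t); last by field.
  rewrite ler_wpM2l ?sqr_ge0//.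
  have zn : 0 <= z / n.+1%:R by rewrite divr_ge0.
  have zn1 : 0 < 1 + z / n.+1%:R by rewrite ltr_pwDl.
  have -> : z / (1 + z / n.+1%:R) = n.+1%:R * (z / n.+1%:R / (1 + z / n.+1%:R)).
    by rewrite [n.+1%:R * (_ * _)]mulrA [n.+1%:R * _]mulrC divfK.
  by rewrite expRM_natl lerXn2r ?nnegrE ?expR_ge0 ?expR_frac_le// ltW.
have lim_le : `|y t| ^+ 2 * expR z <= `|y s| ^+ 2.
  have cz : z / (1 + z / n.+1%:R) @[n --> \oo] --> z.
    rewrite -[X in _ --> X]divr1 -[X in _ / X](addr0 1).
    apply: cvgM; first exact: cvg_cst.
    apply: cvgV; first by rewrite addr0 oner_neq0.
    by apply: cvgD; [exact: cvg_cst|exact: harmonic_cvg0].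
  have c : `|y t| ^+ 2 * expR (z / (1 + z / n.+1%:R)) @[n --> \oo] -->
      `|y t| ^+ 2 * expR z.
    by apply: cvgM; [exact: cvg_cst|exact: (cvg_comp _ _ cz (@continuous_expR R z))].
  by rewrite -(cvg_lim _ c)//; apply: limr_le; [apply/cvg_ex; eexists; exact: c|exact: nearW].
rewrite -ler_sqr ?nnegrE ?mulr_ge0 ?expR_ge0// exprMn -expRM_natl.
rewrite -ler_pdivrMr ?expR_gt0// -expRN (le_trans _ lim_le)// ler_wpM2l ?sqr_ge0//.
by rewrite ler_expR /z; lra.
Qed.

End decay.

Section gain.
Context (R : realType) (a us : R).
Hypothesis a0 : 0 < a.
Hypothesis us0 : 0 < us.

Definition gain (rho : R) : R := rho * expR (a ^+ 2 * rho ^+ 2 / us ^+ 2).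

Lemma gain_classK : classK gain.
Proof.
split=> [r r0|r s r0 rs|]; last by rewrite /gain mul0r.
- by rewrite mulr_ge0 ?expR_ge0.
- rewrite /gain (@le_lt_trans _ _ (r * expR (a ^+ 2 * s ^+ 2 / us ^+ 2)))//.
    rewrite ler_wpM2l// ler_expR ler_wpM2r ?invr_ge0 ?sqr_ge0//.
    rewrite ler_wpM2l ?sqr_ge0// ler_sqr ?nnegrE ?(ltW rs)//.
    by rewrite (le_trans r0)// ltW.
  by rewrite ltr_pM2r ?expR_gt0.
Qed.

End gain.

Theorem theorem2 (R : realType) (L a us : R) (W : R -> {linear L2 L -> L2 L}) :
  0 < L -> 0 < a -> 0 < us ->
  c0_contraction_semigroup W ->
  generates (@kdv_op R L) (@kdv_dom R L) W ->
  (exists alpha : R -> R, classK alpha /\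
     forall (y0 : L2 L) (y : R -> L2 L), mild_solution a us W y0 y ->
     forall t, 0 <= t -> `|y t| <= alpha `|y0| * expR (- a * t)) /\
  (forall r, 0 < r ->
     forall (y0 : L2 L), `|y0| <= r ->
     forall (y : R -> L2 L), mild_solution a us W y0 y ->
     forall t, 0 <= t ->
       `|y t| <= `|y0| * expR (- Num.min a (us / r) * t)).
Proof.
move=> L0 a0 us0 cW gW; split; last first.
  move=> r r0 y0 y0r y My t t0; have y00 := mild0 cW My.
  have m0 : 0 <= Num.min a (us / r) by rewrite le_min (ltW a0) divr_ge0// ltW.
  have := mild_decay L0 a0 us0 cW gW My m0 _ (lexx 0) t0; rewrite y00 subr0; apply.
    by rewrite ge_min lexx.
  (* The ball of radius r is where the rate mu is allowed: mu |y0| <= (us / r) r = us. *)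
  apply: (@le_trans _ _ (us / r * r)); last by rewrite divfK ?gt_eqF.
  by apply: ler_pM => //; rewrite ge_min lexx orbT.
exists (gain a us); split; first exact: gain_classK.
move=> y0 y My t t0; have := mild0 cW My => y00.
set rho := `|y0|; have rho0 : 0 <= rho by exact: normr_ge0.
have decay := mild_decay L0 a0 us0 cW gW My.
(* The case rho = 0 is set apart, as the rate us / rho is used below. *)
have [T0|T0] := leP rho 0.
  have := mild_nonincreasing L0 a0 us0 cW gW My (lexx 0) t0.
  rewrite y00 => h; rewrite (le_trans h)// (le_trans T0)// mulr_ge0 ?expR_ge0//.
  by rewrite mulr_ge0 ?expR_ge0.
(* After time [T] the norm is at most [us / a], where the damping is linear. *)
pose T := a * rho ^+ 2 / us ^+ 2.
have T_ge0 : 0 <= T by rewrite divr_ge0 ?sqr_ge0// mulr_ge0 ?sqr_ge0// ltW.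
have -> : gain a us rho * expR (- a * t) = rho * expR (- a * (t - T)).
  rewrite /gain -mulrA -expRD; congr (_ * expR _); rewrite /T; field.
  by rewrite gt_eqF.
(* Up to time [T] the exponent -a (t - T) is nonnegative, so monotonicity of the norm suffices. *)
have [tT|Tt] := leP t T.
  have := mild_nonincreasing L0 a0 us0 cW gW My (lexx 0) t0.
  rewrite y00 => h; rewrite (le_trans h)// ler_peMr// -expR0 ler_expR mulNr oppr_ge0.
  by rewrite pmulr_rle0// subr_le0.
have yT : `|y T| <= rho.
  by have := mild_nonincreasing L0 a0 us0 cW gW My (lexx 0) T_ge0; rewrite y00.
apply: (le_trans (decay a T t (ltW a0) (lexx a) T_ge0 (ltW Tt) _)); last first.
  by rewrite ler_wpM2r// expR_ge0.
(* What remains is a |y T| <= us. If a rho > us, the rate us / rho is below [a] and admissible from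
   time 0, since (us / rho) rho = us. *)
have [ur|ur] := leP (a * rho) us.
  by rewrite (le_trans _ ur)// ler_wpM2l// ltW.
have q0 : 0 < us / rho by rewrite divr_gt0.
have := decay (us / rho) 0 T (ltW q0) _ (lexx 0) T_ge0 _.
rewrite y00 divfK ?gt_eqF// ler_pdivrMr// => /(_ (ltW ur) (lexx us)).
rewrite subr0 => h; rewrite mulrC -ler_pdivlMr// (le_trans h)//.
have -> : - (us / rho) * T = - (a * rho / us).
  rewrite /T; field; by rewrite !gt_eqF.
(* In terms of x, the claim rho e^(-x) <= us / a reads x <= e^x. *)
set x := a * rho / us; have x0 : 0 < x by rewrite divr_gt0// mulr_gt0.
rewrite expRN ler_pdivrMr ?expR_gt0//.
rewrite -/rho; have {1}-> : rho = us / a * x by rewrite /x; field; rewrite !gt_eqF.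
rewrite ler_wpM2l ?divr_ge0 ?(ltW us0) ?(ltW a0)//.
by rewrite (le_trans _ (expR_ge1Dx x))// lerDr.
Qed.
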